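(* Let $0\le \alpha<1$, let $p\ge 1$ be a real number, and let $\mu,\lambda:[0,\infty)\to[0,\infty)$ be monotone increasing functions. Let $f=h+\overline{g}\in\mathcal{P}_{\mathcal{H}}^{0}(\alpha)$ with $h(z)=z+\sum_{n=2}^{\infty}a_nz^n$ and $g(z)=\sum_{n=1}^{\infty}b_nz^n$. Then $$|z|^p+\sum_{n=2}^{\infty}(|a_n|+|b_n|)|z|^n+\mu\left(\frac{S_{|z|}}{\pi}\right)+\lambda\left(\left(\frac{S_{|z|}}{\pi}\right)^2\right)\le d(f(0),\partial f(\mathbb{D}))$$ holds for $|z|=r\le R_f(\alpha)$, where $R_f(\alpha)$ is the unique root in $(0,1)$ of the equation $$J_1(r):=r^p-2(1-\alpha)\big(r+\ln(1-r)\big)+\mu\big(M_\alpha(r)\big)+\lambda\big(M_\alpha(r)^2\big)-1-2(1-\alpha)(\ln 2-1)=0.$$ The radius $R_f(\alpha)$ is best possible.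
   Context: $\mathbb{D}=\{z\in\mathbb{C}:|z|<1\}$ is the open unit disk and $\mathbb{D}_r=\{z\in\mathbb{C}:|z|<r\}$. $\mathcal{H}$ denotes the class of orientation-preserving (sense-preserving, i.e. $|h'|^2-|g'|^2>0$) complex-valued harmonic mappings $f=h+\overline{g}$ on $\mathbb{D}$, with $h,g$ analytic in $\mathbb{D}$ and normalized by $h(0)=0=h'(0)-1$, $g(0)=0$. For $0\le\alpha<1$, $$\mathcal{P}_{\mathcal{H}}^{0}(\alpha)=\{f=h+\overline{g}\in\mathcal{H}:\ \operatorname{Re}(h'(z)-\alpha)>|g'(z)|\ \text{for all } z\in\mathbb{D},\ g'(0)=0\}.$$ Thus $h(z)=z+\sum_{n\ge2}a_nz^n$ and $g(z)=\sum_{n\ge1}b_nz^n$ with $b_1=0$. For $f=h+\overline{g}$ and $0\le r<1$, $S_r$ is the area integral of the Jacobian: $$S_r=\iint_{\mathbb{D}_r}\left(|h'(z)|^2-|g'(z)|^2\right)dx\,dy .$$ For $0\le r<1$, $$M_\alpha(r):=r^2+4(1-\alpha)^2\sum_{n=2}^{\infty}\frac{r^{2n}}{n}.$$ $d(f(0),\partial f(\mathbb{D}))$ is the Euclidean distance from $f(0)$ to the boundary of $f(\mathbb{D})$. The number $R_f(\alpha)$ depends only on $\alpha,p,\mu,\lambda$. ''Best possible'' means that $R_f(\alpha)$ cannot be replaced by any larger number in $(0,1)$ such that the inequality still holds for all $f\in\mathcal{P}_{\mathcal{H}}^{0}(\alpha)$.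
   Formalization: A root of J_1 in (0,1) need not exist for arbitrary increasing mu, lambda (e.g. mu = 5); existence is proved for continuous mu, lambda with J_1(0)<0, and uniqueness, the inequality and sharpness are proved for all increasing mu, lambda whenever a root exists. *)

(* Defs.v *)
From HB Require Import structures.
From mathcomp Require Import all_boot all_order all_algebra.
From mathcomp Require Import all_classical all_reals all_analysis.
From mathcomp Require Import complex.

Set Implicit Arguments.
Unset Strict Implicit.
Unset Printing Implicit Defensive.

Import Order.TTheory GRing.Theory Num.Theory.
Import ComplexField.Normc.
Import numFieldNormedType.Exports.

Local Open Scope classical_set_scope.
Local Open Scope ring_scope.
Local Open Scope complex_scope.

(* The complex plane with its usual topology, as a normed module over
   itself: [derivable] and [derive1] on it are complex differentiability and
   the complex derivative.  The modulus [normc] takes values in [R]. *)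
Notation cplx R := (R[i]^o).

Definition disk (R : realType) (r : R) : set (cplx R) :=
  [set z | normc z < r].

Definition analytic_on_disk (R : realType) (h : cplx R -> cplx R) : Prop :=
  forall z, disk 1 z -> derivable h z 1.

Definition harmonic_map (R : realType) (h g : cplx R -> cplx R) :
  cplx R -> cplx R := fun z => h z + (g z)^*.

Definition jacobian (R : realType) (h g : cplx R -> cplx R) (z : cplx R) : R :=
  normc (derive1 h z) ^+ 2 - normc (derive1 g z) ^+ 2.

(* Since g 0 = 0, the pair (h, g) is determined on the disk by the map
   h + conj g, so membership of the map is a property of the pair. *)
Definition classH (R : realType) (h g : cplx R -> cplx R) : Prop :=
  [/\ analytic_on_disk h, analytic_on_disk g,
      [/\ h 0 = 0, derive1 h 0 = 1 & g 0 = 0] &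
      forall z, disk 1 z -> 0 < jacobian h g z].

Definition classP0 (R : realType) (alpha : R) (h g : cplx R -> cplx R) : Prop :=
  [/\ classH h g,
      forall z, disk 1 z ->
        normc (derive1 g z) < complex.Re (derive1 h z - alpha%:C) &
      derive1 g 0 = 0].

Definition h_expansion (R : realType) (h : cplx R -> cplx R)
    (a : nat -> cplx R) : Prop :=
  forall z, disk 1 z ->
    (fun N => z + \sum_(2 <= n < N) a n * z ^+ n : cplx R) @ \oo --> h z.

Definition g_expansion (R : realType) (g : cplx R -> cplx R)
    (b : nat -> cplx R) : Prop :=
  forall z, disk 1 z ->
    (fun N => \sum_(1 <= n < N) b n * z ^+ n : cplx R) @ \oo --> g z.

Definition area (R : realType) (h g : cplx R -> cplx R) (r : R) : R :=
  Rintegral (@lebesgue_measure R \x @lebesgue_measure R)%E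
    [set u : R * R | disk r (u.1 +i* u.2)]
    (fun u => jacobian h g (u.1 +i* u.2)).

Definition boundary (T : topologicalType) (A : set T) : set T :=
  closure A `\` interior A.

(* Extended-real valued: the distance to an empty boundary is +oo. *)
Definition dist_to (R : realType) (w : cplx R) (B : set (cplx R)) : \bar R :=
  ereal_inf [set (normc (v - w))%:E | v in B].

Definition M_ (R : realType) (alpha r : R) : R :=
  r ^+ 2 + 4 * (1 - alpha) ^+ 2 *
    limn (fun N => \sum_(2 <= n < N) r ^+ (2 * n) / n%:R : R).

Definition J1 (R : realType) (alpha p : R) (mu lambda : R -> R) (r : R) : R :=
  r `^ p - 2 * (1 - alpha) * (r + ln (1 - r))
  + mu (M_ alpha r) + lambda (M_ alpha r ^+ 2)
  - 1 - 2 * (1 - alpha) * (ln 2 - 1).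

(* Functions [0, +oo[ -> [0, +oo[ are represented by functions on R of which
   only the values on [0, +oo[ matter. *)
Definition nonneg_increasing (R : realType) (mu : R -> R) : Prop :=
  (forall x, 0 <= x -> 0 <= mu x) /\
  (forall x y, 0 <= x -> x <= y -> mu x <= mu y).

Definition bohr_inequality (R : realType) (p : R) (mu lambda : R -> R)
    (h g : cplx R -> cplx R) (a b : nat -> cplx R) (z : cplx R) : Prop :=
  let f := harmonic_map h g in
  let r := normc z in
  let s := area h g r / pi in
  let c := fun n => normc (a n) + normc (b n) in
  let d := dist_to (f 0) (boundary (f @` disk 1)) in
  ((r `^ p)%:E + \sum_(2 <= n <oo) (c n * r ^+ n)%:E
   + (mu s)%:E + (lambda (s ^+ 2))%:E <= d)%E.

Definition bohr_holds_upto (R : realType) (alpha p : R) (mu lambda : R -> R)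
    (rho : R) : Prop :=
  forall (h g : cplx R -> cplx R) (a b : nat -> cplx R),
    classP0 alpha h g -> h_expansion h a -> g_expansion g b ->
    forall z : cplx R, normc z <= rho -> bohr_inequality p mu lambda h g a b z.

(* Main.v *)
Require Import Defs.
From mathcomp Require Import all_boot all_order all_algebra.
From mathcomp Require Import all_classical all_reals all_analysis measurable_realfun.
From mathcomp Require Import complex zify ring lra.

(** Write [beta = 1 - alpha].  Three estimates for a member [f = h + conj g] of the
class give the inequality, and one map attains all three at once.

For every unimodular [c] the function [h' + c g' - alpha] has nonnegative real
part and the value [beta] at 0.  Choosing [c] suitably at each place, the
Caratheodory bound gives [|a_n| + |b_n| <= 2 beta / n] ([coef_bound]), and the
Harnack inequality gives
[Re h' - |g'| >= alpha + beta (1 - |z|) / (1 + |z|)] ([jacobian_rate]).  Both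
come from one principle ([pairing_ge0]): the product of two functions with
nonnegative real part has nonnegative mean over a circle, and the mean over
the vertices of a regular polygon is computed exactly by the orthogonality of
the roots of unity.

Distance to the boundary.  Integrating the second estimate along a radius
gives [|f z| >= growth |z|] ([growth_le]), with
[growth 1 = 1 + 2 beta (ln 2 - 1)].  The same estimate makes [f] strongly
monotone on smaller disks ([strongly_monotone]), hence open with uniform
constants ([uniformly_open]).  A point of the closure of the image of modulus
less than [growth 1] is then interior to the image, so every boundary point
has modulus at least [growth 1] ([boundary_normc_ge]).

Area.  Plane measure is invariant under rotations, so on a thin annulus the
Jacobian can be replaced by its mean over a circle, which by Parseval is
[sum (|p_k|^2 - |q_k|^2) |z|^(2k)], with [p], [q] the coefficients of [h'],
[g'].  The coefficient bound makes this at most [area_density], whose primitive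
in [t = r^2] is the [area_bound] with [M_ alpha r = area_bound alpha (r^2)];
summing over thin annuli gives [S_r / pi <= M_ alpha r].

Together the left side of the inequality is at most [J1 r + growth 1], and
[J1] is increasing, which settles uniqueness of the root and the inequality
up to it ([J1_lt], [bohr_inequality_le]); existence is the intermediate value
theorem, [J1] being unbounded above near 1 ([J1_root_exists]).

Sharpness: for [h' = alpha + beta (1 + z) / (1 - z)] and [g = 0] the
coefficient bound and the area bound are equalities, and [h (- t)] equals
[- growth t].  The limit [- growth 1] is a boundary point of the image, so the
distance is at most [growth 1], and the inequality fails wherever [J1 > 0]
([extremal_violates]).

Differential inequalities are integrated by one elementary device
([subdivision_le]): increments of the form derivative times length, with an
error that telescopes, are summed over an equal subdivision. *)

Import Order.TTheory GRing.Theory Num.Theory.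
Import numFieldNormedType.Exports.
Import ComplexField.Normc.
Set Implicit Arguments.
Unset Strict Implicit.
Unset Printing Implicit Defensive.
Local Open Scope classical_set_scope.
Local Open Scope ring_scope.
Local Open Scope complex_scope.
Local Notation "z ^*" := (conjc z) : ring_scope.

(** * Modulus, real part and conjugation *)

Section Modulus.
Variable R : realType.
Implicit Types (z w : R[i]) (x y : R).

Lemma normc_norm z : (normc z)%:C = `|z|.
Proof. by []. Qed.

Lemma normc_ge0 z : 0 <= normc z.
Proof. by case: z => a b; exact: sqrtr_ge0. Qed.

Lemma sqr_normcE z : normc z ^+ 2 = complex.Re z ^+ 2 + complex.Im z ^+ 2.
Proof. by case: z => a b /=; rewrite sqr_sqrtr// addr_ge0// sqr_ge0. Qed.

Lemma normcB z w : normc (z - w) <= normc z + normc w.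
Proof. by rewrite -(normcN w) le_normcD. Qed.

Lemma normc_distC z w : normc (z - w) = normc (w - z).
Proof. by rewrite -normcN opprB. Qed.

Lemma le_normc_dist z w : normc z - normc w <= normc (z - w).
Proof. by rewrite lerBlDr -{1}(subrK w z) le_normcD. Qed.

Lemma normcX z n : normc (z ^+ n) = normc z ^+ n.
Proof.
by elim: n => [|n IH]; rewrite ?expr0 ?normc1// !exprS normcM IH.
Qed.

Lemma normc_real x : normc x%:C = `|x|.
Proof. by rewrite /= expr0n/= addr0 sqrtr_sqr. Qed.

Lemma normcJ z : normc z^* = normc z.
Proof. by case: z => a b /=; rewrite sqrrN. Qed.

Lemma normc_nat n : normc (n%:R : R[i]) = n%:R.
Proof. by rewrite -(rmorph_nat (real_complex R)) normc_real ger0_norm. Qed.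

Lemma normc_sum (I : Type) (r : seq I) (P : pred I) (F : I -> R[i]) :
  normc (\sum_(i <- r | P i) F i) <= \sum_(i <- r | P i) normc (F i).
Proof.
elim/big_ind2 : _ => [|z x w y zx wy|//]; first by rewrite normc0.
exact: le_trans (le_normcD _ _) (lerD zx wy).
Qed.

Lemma ReD z w : complex.Re (z + w) = complex.Re z + complex.Re w.
Proof. by case: z w => [? ?] []. Qed.

Lemma ReN z : complex.Re (- z) = - complex.Re z.
Proof. by case: z. Qed.

Lemma ReB z w : complex.Re (z - w) = complex.Re z - complex.Re w.
Proof. by rewrite ReD ReN. Qed.

Lemma Re_sum (I : Type) (r : seq I) (P : pred I) (F : I -> R[i]) :
  complex.Re (\sum_(i <- r | P i) F i) = \sum_(i <- r | P i) complex.Re (F i).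
Proof.
by elim/big_ind2 : _ => [//|z x w y <- <-|//]; rewrite ReD.
Qed.

Lemma ReZ x z : complex.Re (x%:C * z) = x * complex.Re z.
Proof. by case: z => a b /=; rewrite mul0r subr0. Qed.

Lemma Re_real x : complex.Re x%:C = x.
Proof. by []. Qed.

Lemma ReJ z : complex.Re z^* = complex.Re z.
Proof. by case: z. Qed.

Lemma conjcN z : (- z)^* = - z^*.
Proof. by case: z. Qed.

Lemma conjcM z w : (z * w)^* = z^* * w^*.
Proof.
by case: z w => [a b] [c d]; apply/eqP; rewrite eq_complex/=;
  apply/andP; split; apply/eqP; ring.
Qed.

Lemma conjcX z n : (z ^+ n)^* = z^* ^+ n.
Proof.
elim: n => [|n IH]; last by rewrite !exprS conjcM IH.
by rewrite !expr0 /conjc/= oppr0.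
Qed.

Lemma conjc_realE x : x%:C^* = x%:C.
Proof. by rewrite /= oppr0. Qed.

Lemma ReM z w : complex.Re (z * w) =
  complex.Re z * complex.Re w - complex.Im z * complex.Im w.
Proof. by case: z w => [? ?] []. Qed.

Lemma ReMJ z : complex.Re (z * z^*) = normc z ^+ 2.
Proof. by rewrite sqr_normcE; case: z => a b /=; ring. Qed.

Lemma normcMJ z : z * z^* = (normc z ^+ 2)%:C.
Proof.
rewrite sqr_normcE; case: z => a b; apply/eqP; rewrite eq_complex/=.
by apply/andP; split; apply/eqP; ring.
Qed.

Lemma ImM z w : complex.Im (z * w) =
  complex.Re z * complex.Im w + complex.Im z * complex.Re w.
Proof. by case: z w => [? ?] []. Qed.

Lemma ImD z w : complex.Im (z + w) = complex.Im z + complex.Im w.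
Proof. by case: z w => [? ?] []. Qed.

Lemma Im_sum (I : Type) (r : seq I) (P : pred I) (F : I -> R[i]) :
  complex.Im (\sum_(i <- r | P i) F i) = \sum_(i <- r | P i) complex.Im (F i).
Proof.
by elim/big_ind2 : _ => [//|z x w y <- <-|//]; rewrite ImD.
Qed.

Lemma ler_Re_normc z : `|complex.Re z| <= normc z.
Proof.
rewrite -(@ler_pXn2r _ 2)// ?nnegrE ?normc_ge0//.
by rewrite sqr_normcE real_normK ?num_real// lerDl sqr_ge0.
Qed.

Lemma ler_Im_normc z : `|complex.Im z| <= normc z.
Proof.
rewrite -(@ler_pXn2r _ 2)// ?nnegrE ?normc_ge0//.
by rewrite sqr_normcE real_normK ?num_real// lerDr sqr_ge0.
Qed.

Lemma Re_le_normc z : complex.Re z <= normc z.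
Proof. exact: le_trans (ler_norm _) (ler_Re_normc z). Qed.

Lemma Re_geN_normc z : - normc z <= complex.Re z.
Proof. by rewrite lerNl -ReN -normcN Re_le_normc. Qed.

Lemma normc_le_ReIm z : normc z <= `|complex.Re z| + `|complex.Im z|.
Proof.
rewrite -(@ler_pXn2r _ 2)// ?nnegrE ?normc_ge0 ?addr_ge0//.
rewrite sqr_normcE sqrrD !real_normK ?num_real//.
have := mulr_ge0 (normr_ge0 (complex.Re z)) (normr_ge0 (complex.Im z)).
by lra.
Qed.

End Modulus.

(** * Geometric majorants *)

Section GeometricBounds.
Variable R : realType.
Implicit Types (x y K q s : R).

(** Each of the [n] terms of [1 + s + ... + s^(n-1)] is at least [s^n]. *)
Lemma natr_expr_le s n : 0 <= s < 1 -> n%:R * s ^+ n <= (1 - s)^-1.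
Proof.
move=> /andP[s0 s1]; have s1' : 0 < 1 - s by rewrite subr_gt0.
rewrite -(ler_pM2r s1') mulVf ?gt_eqF//.
have -> : n%:R * s ^+ n * (1 - s) = (\sum_(i < n) s ^+ n) * (1 - s).
  by rewrite sumr_const card_ord -[in RHS]mulr_natl.
apply: (@le_trans _ _ ((\sum_(i < n) s ^+ i) * (1 - s))).
  rewrite ler_wpM2r ?(ltW s1')//; apply: ler_sum => i _.
  by rewrite ler_wiXn2l ?(ltW s1)// ltnW.
rewrite mulrC -opprB mulNr -subrX1 opprB.
by rewrite gerBl exprn_ge0.
Qed.

(** With [s] the midpoint of [q] and 1, [q <= s^2]; in [q^n <= s^n s^n] one
    factor absorbs [n] and the other keeps the decay. *)
Lemma geometric_absorb_nat K q : 0 <= K -> 0 <= q < 1 ->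
  exists K' q', [/\ 0 <= K', 0 <= q' < 1 &
    forall n, n%:R * (K * q ^+ n) <= K' * q' ^+ n].
Proof.
move=> K0 /andP[q0 q1]; pose s := (1 + q) / 2.
have s01 : 0 <= s < 1 by rewrite /s; lra.
exists (K / (1 - s)), s; split=> //.
  by rewrite divr_ge0// subr_ge0; case/andP: s01 => _ /ltW.
move=> n; have [s0 s1] := andP s01.
have qs : q <= s * s.
  have := sqr_ge0 ((1 - q) / 2); rewrite /s expr2; lra.
have qn : q ^+ n <= s ^+ n * s ^+ n.
  rewrite -exprMn; apply: lerXn2r => //; rewrite ?nnegrE.
  exact: mulr_ge0.
apply: (@le_trans _ _ (K * (n%:R * s ^+ n) * s ^+ n)).
  by rewrite mulrCA -!mulrA ler_wpM2l// ler_wpM2l.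
rewrite -!mulrA ler_wpM2l// [n%:R * _]mulrA ler_wpM2r ?exprn_ge0//.
exact: natr_expr_le.
Qed.

Lemma geometric_le0 K q x : 0 <= q < 1 -> (forall n, x <= K * q ^+ n) -> x <= 0.
Proof.
move=> /andP[q0 q1] H.
have cv : (fun n => K * q ^+ n) @ \oo --> K * 0.
  by apply: cvgM; [exact: cvg_cst|apply: cvg_expr; rewrite ger0_norm].
rewrite mulr0 in cv; rewrite -(cvg_lim (@Rhausdorff R) cv).
by apply: limr_ge; [apply/cvg_ex; exists 0|exact: nearW].
Qed.

Lemma geometric_small K q e : 0 <= q < 1 -> 0 < e ->
  exists n0, forall n, (n0 <= n)%N -> K * q ^+ n <= e.
Proof.
move=> /andP[q0 q1] e0.
have cv : (fun n => K * q ^+ n) @ \oo --> K * 0.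
  by apply: cvgM; [exact: cvg_cst|apply: cvg_expr; rewrite ger0_norm].
rewrite mulr0 in cv.
have [n0 _ H] : \forall n \near \oo, K * q ^+ n < e by exact: (cvgr_lt _ cv).
by exists n0 => n /H /ltW.
Qed.

Lemma geometric_sum_le q n m : 0 <= q < 1 ->
  \sum_(n <= k < m) q ^+ k <= q ^+ n / (1 - q).
Proof.
move=> /andP[q0 q1]; have q1' : 0 < 1 - q by rewrite subr_gt0.
have [mn|/ltnW nm] := leqP m n.
  by rewrite big_geq// divr_ge0 ?exprn_ge0// ltW.
rewrite -{1}(add0n n) big_addn big_mkord ler_pdivlMr//.
rewrite (eq_bigr (fun k : 'I__ => q ^+ n * q ^+ k)); last first.
  by move=> k _; rewrite addnC exprD.
rewrite -mulr_sumr -mulrA ler_piMr ?exprn_ge0//.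
rewrite mulrC -opprB mulNr -subrX1 opprB.
by rewrite gerBl exprn_ge0.
Qed.
End GeometricBounds.

(** * Power series on the unit disk *)

Section PowerSeries.
Variable R : realType.
Local Notation C := (R[i]).
Implicit Types (a b : nat -> C) (f g : C -> C) (z w : C) (K q rho : R).

(** Completeness of the complex plane, in the form needed both for power series
    and for contraction iterations: the limit comes with its rate. *)
Lemma geometric_cauchy_cvg (u : nat -> C) K q : 0 <= K -> 0 <= q < 1 ->
    (forall n, normc (u n.+1 - u n) <= K * q ^+ n) ->
  exists l, forall n, normc (l - u n) <= K / (1 - q) * q ^+ n.
Proof.
move=> K0 q01 H; have [q0 q1] := andP q01.
have key (v : nat -> R) : (forall n, `|v n.+1 - v n| <= K * q ^+ n) -> cvgn v.
  move=> Hv.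
  rewrite -(_ : (fun n => v 0%N + series (telescope v) n) = v); last first.
    by apply/funext => n; rewrite seriesEnat/= telescope_sumr// addrC subrK.
  apply: is_cvgD; first exact: is_cvg_cst.
  apply: normed_cvg.
  apply: (@series_le_cvg _ _ (fun n => K * q ^+ n)) => //=.
  - by move=> n; rewrite mulr_ge0// exprn_ge0.
  - by apply: is_cvg_geometric_series; rewrite ger0_norm.
have /cvg_ex[x Hx] : cvgn (fun n => complex.Re (u n)).
  apply: key => n; rewrite -ReB; exact: le_trans (ler_Re_normc _) (H n).
have /cvg_ex[y Hy] : cvgn (fun n => complex.Im (u n)).
  apply: key => n; apply: le_trans (H n); apply: le_trans (ler_Im_normc _).
  by case: (u n.+1) (u n) => [? ?] [].
exists (x +i* y) => n.
have Hm m : (n <= m)%N -> normc (u m - u n) <= K / (1 - q) * q ^+ n.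
  move=> nm; rewrite -(telescope_sumr _ nm).
  apply: le_trans (normc_sum _ _ _) _.
  apply: le_trans (ler_sum _ (fun i _ => H i)) _.
  rewrite -mulr_sumr -mulrA ler_wpM2l// [_^-1 * _]mulrC.
  exact: geometric_sum_le.
have cv : (fun m => `|x - complex.Re (u m)| + `|y - complex.Im (u m)|) @ \oo
    --> `|x - x| + `|y - y|.
  by apply: cvgD; apply: cvg_norm; apply: cvgB => //; exact: cvg_cst.
rewrite !subrr normr0 addr0 in cv.
rewrite -subr_le0 -(cvg_lim (@Rhausdorff R) cv).
apply: limr_ge; first by apply/cvg_ex; exists 0.
exists n => // m /= nm.
rewrite lerBlDr -(subrK (u m) (x +i* y)) -addrA.
apply: le_trans (le_normcD _ _) _; apply: lerD (Hm _ nm).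
by apply: le_trans (normc_le_ReIm _) _; case: (u m).
Qed.

Definition psum a n z : C := \sum_(k < n) a k * z ^+ k.

(** Radius of convergence at least 1.  A geometric bound at each radius, rather
    than boundedness, is what passes to the differentiated series and to tails
    without further loss. *)
Definition coef_geometric a := forall rho, 0 <= rho < 1 ->
  exists K q, [/\ 0 <= K, 0 <= q < 1 &
    forall n, normc (a n) * rho ^+ n <= K * q ^+ n].

(** The error is uniform on each smaller disk and geometric in the number of
    terms; outside the open unit disk [f] is unconstrained. *)
Definition sums_to a f := forall rho, 0 <= rho < 1 ->
  exists K q, [/\ 0 <= K, 0 <= q < 1 &
    forall z n, normc z <= rho -> normc (f z - psum a n z) <= K * q ^+ n].

(** Abel's argument: terms bounded at the larger radius [(1 + rho) / 2] decay
    geometrically at [rho]. *)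
Lemma coef_geometric_of_bounded a :
  (forall rho, 0 < rho < 1 ->
     exists B, forall n, normc (a n) * rho ^+ n <= B) ->
  coef_geometric a.
Proof.
move=> H rho /andP[r0 r1]; pose s := (1 + rho) / 2.
have s01 : 0 < s < 1 by rewrite /s; lra.
have [s0 s1] := andP s01.
have [B HB] := H s s01.
exists `|B|, (rho / s); split=> //.
  rewrite divr_ge0// ?(ltW s0)//= ltr_pdivrMr// mul1r /s; lra.
move=> n; rewrite expr_div_n mulrA ler_pdivlMr ?exprn_gt0//.
rewrite mulrAC ler_wpM2r ?exprn_ge0//.
exact: le_trans (HB n) (ler_norm _).
Qed.

Lemma psum_tail a rho : coef_geometric a -> 0 <= rho < 1 ->
  exists K q, [/\ 0 <= K, 0 <= q < 1 &
    forall z n m, normc z <= rho -> (n <= m)%N ->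
      normc (psum a m z - psum a n z) <= K * q ^+ n].
Proof.
move=> Ha r01; have [K [q [K0 q01 H]]] := Ha rho r01.
have [q0 q1] := andP q01.
exists (K / (1 - q)), q; split=> //.
  by rewrite divr_ge0// subr_ge0 ltW.
move=> z n m zr nm.
have -> : psum a m z - psum a n z = \sum_(n <= k < m) a k * z ^+ k.
  by rewrite /psum -!(big_mkord xpredT (fun k => a k * z ^+ k))
    (big_cat_nat (leq0n n) nm)/= [X in X - _]addrC addrK.
apply: le_trans (normc_sum _ _ _) _.
apply: (@le_trans _ _ (\sum_(n <= k < m) K * q ^+ k)).
  apply: ler_sum => k _; apply: le_trans (H k).
  rewrite normcM normcX ler_wpM2l ?normc_ge0//.
  by apply: lerXn2r; rewrite // nnegrE ?normc_ge0//; case/andP: r01.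
rewrite -mulr_sumr -mulrA ler_wpM2l// [_^-1 * _]mulrC.
exact: geometric_sum_le.
Qed.

Lemma sums_to_pointwise a f : coef_geometric a ->
  (forall z, normc z < 1 -> (fun n => normc (f z - psum a n z)) @ \oo --> 0) ->
  sums_to a f.
Proof.
move=> Ha Hf rho r01; have [K [q [K0 q01 H]]] := psum_tail Ha r01.
exists K, q; split=> // z n zr.
have z1 : normc z < 1 by case/andP: r01 => _; exact: le_lt_trans.
rewrite -subr_le0 -(cvg_lim (@Rhausdorff R) (Hf z z1)).
apply: limr_ge; first by apply/cvg_ex; exists 0; exact: Hf.
exists n => // m /= nm; rewrite lerBlDr.
apply: le_trans (lerD (lexx _) (H z n m zr nm)).
by rewrite -{1}(subrK (psum a m z) (f z)) -addrA le_normcD.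
Qed.

Lemma exists_sums_to a : coef_geometric a -> exists f, sums_to a f.
Proof.
move=> Ha.
have lim z : exists l, normc z < 1 ->
    (fun n => normc (l - psum a n z)) @ \oo --> 0.
  have [z1|/negP nz1] := boolP (normc z < 1); last by exists 0.
  have [|K [q [K0 q01 H]]] := Ha (normc z); first by rewrite normc_ge0.
  have [l Hl] : exists l, forall n,
      normc (l - psum a n z) <= K / (1 - q) * q ^+ n.
    apply: geometric_cauchy_cvg => // n.
    by rewrite /psum big_ord_recr/= [X in X - _]addrC addrK normcM normcX.
  exists l => _; apply/cvgr0Pnorm_le => e e0.
  have [n0 Hn0] := geometric_small (K / (1 - q)) q01 e0.
  exists n0 => // n /= n0n; rewrite ger0_norm ?normc_ge0//.
  exact: le_trans (Hl n) (Hn0 n n0n).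
have [f Hf] := choice lim.
by exists f; exact: sums_to_pointwise.
Qed.

(** Convergence at the positive real points alone bounds the coefficients. *)
Lemma pointwise_sums_to a f :
  (forall z, normc z < 1 -> (fun n => normc (f z - psum a n z)) @ \oo --> 0) ->
  coef_geometric a /\ sums_to a f.
Proof.
move=> Hf; suff Ha : coef_geometric a by split=> //; exact: sums_to_pointwise.
apply: coef_geometric_of_bounded => rho /andP[r0 r1].
have rc : normc rho%:C = rho by rewrite normc_real gtr0_norm.
have := Hf rho%:C; rewrite rc => /(_ r1) cv.
have [B [_ HB]] : bounded_fun (fun n => normc (f rho%:C - psum a n rho%:C)).
  by apply: cvg_seq_bounded; apply/cvg_ex; exists 0.
have {}HB n : normc (f rho%:C - psum a n rho%:C) <= B + 1.
  apply: le_trans (ler_norm _) _; apply: (HB (B + 1)) => //.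
  by rewrite ltrDl.
exists ((B + 1) + (B + 1)) => n.
apply: le_trans (lerD (HB n) (HB n.+1)).
rewrite [X in _ * X ^+ _](esym rc) -normcX -normcM.
have -> : a n * rho%:C ^+ n = (f rho%:C - psum a n rho%:C)
   - (f rho%:C - psum a n.+1 rho%:C).
  by rewrite /psum big_ord_recr/=; ring.
exact: normcB.
Qed.

Definition dcoef a : nat -> C := fun k => k.+1%:R * a k.+1.

Lemma coef_geometricD a b : coef_geometric a -> coef_geometric b ->
  coef_geometric (fun n => a n + b n).
Proof.
move=> Ha Hb rho r01; have [K [q [K0 /andP[q0 q1] H]]] := Ha rho r01.
have [K' [q' [K'0 /andP[q'0 q'1] H']]] := Hb rho r01.
exists (K + K'), (Num.max q q'); split; first exact: addr_ge0.
  by rewrite le_max q0/= gt_max q1.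
move=> n; have [r0 _] := andP r01.
apply: le_trans (_ : (normc (a n) + normc (b n)) * rho ^+ n <= _).
  by rewrite ler_wpM2r ?exprn_ge0// le_normcD.
rewrite !mulrDl; apply: lerD.
  apply: le_trans (H n) _; rewrite ler_wpM2l//.
  by apply: lerXn2r; rewrite ?nnegrE ?le_max ?q0 ?lexx.
apply: le_trans (H' n) _; rewrite ler_wpM2l//.
by apply: lerXn2r; rewrite ?nnegrE ?le_max ?q0 ?q'0 ?lexx ?orbT.
Qed.

Lemma coef_geometricZ c a : coef_geometric a ->
  coef_geometric (fun n => c * a n).
Proof.
move=> Ha rho r01; have [K [q [K0 q01 H]]] := Ha rho r01.
exists (normc c * K), q; split=> //; first by rewrite mulr_ge0 ?normc_ge0.
by move=> n; rewrite normcM -!mulrA ler_wpM2l ?normc_ge0.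
Qed.

Lemma coef_geometric_nat a : coef_geometric a ->
  coef_geometric (fun n => n%:R * a n).
Proof.
move=> Ha rho r01; have [K [q [K0 q01 H]]] := Ha rho r01.
have [K' [q' [K'0 q'01 H']]] := geometric_absorb_nat K0 q01.
exists K', q'; split=> // n; apply: le_trans (H' n).
by rewrite normcM normc_nat -mulrA ler_wpM2l.
Qed.

Lemma coef_geometric_shift a : coef_geometric a ->
  coef_geometric (fun n => a n.+1).
Proof.
move=> Ha; apply: coef_geometric_of_bounded => rho /andP[r0 r1].
have [|K [q [K0 /andP[q0 q1] H]]] := Ha rho; first by rewrite (ltW r0).
exists (K / rho) => n; rewrite ler_pdivlMr// -mulrA -exprSr.
by apply: le_trans (H n.+1) _; rewrite ler_piMr// exprn_ile1// ltW.
Qed.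

Lemma coef_geometric_dcoef a : coef_geometric a -> coef_geometric (dcoef a).
Proof. by move=> /coef_geometric_nat/coef_geometric_shift. Qed.

End PowerSeries.

(** * Termwise differentiation *)

Section TermwiseDerivative.
Variable R : realType.
Local Notation C := (R[i]).
Implicit Types (a b : nat -> C) (f g : C -> C) (z w : C) (K q rho : R).

Lemma geometric2_le0 K q K' q' (x : R) :
    0 <= K -> 0 <= K' -> 0 <= q < 1 -> 0 <= q' < 1 ->
  (forall n, x <= K * q ^+ n + K' * q' ^+ n) -> x <= 0.
Proof.
move=> K0 K'0 /andP[q0 q1] /andP[q'0 q'1] H.
apply: (@geometric_le0 _ (K + K') (Num.max q q')).
  by rewrite le_max q0/= gt_max q1.
move=> n; apply: le_trans (H n) _; rewrite mulrDl; apply: lerD.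
  by rewrite ler_wpM2l//; apply: lerXn2r; rewrite ?nnegrE ?le_max ?q0 ?lexx.
rewrite ler_wpM2l//.
by apply: lerXn2r; rewrite ?nnegrE ?le_max ?q0 ?q'0 ?lexx ?orbT.
Qed.

(** Induction on [n], the new error being [w] times the old one plus
    [(n + 1) z^n (w - z)^2].  The factor [rho] on the left avoids the exponent
    [n - 1] on the right. *)
Lemma expr_taylor rho z w n : 0 <= rho -> normc z <= rho -> normc w <= rho ->
  rho * normc (w ^+ n.+1 - z ^+ n.+1 - n.+1%:R * z ^+ n * (w - z)) <=
  n.+1%:R ^+ 2 * rho ^+ n * normc (w - z) ^+ 2.
Proof.
move=> r0 zr wr; elim: n => [|n IH].
  rewrite expr0 !expr1 !mulr1 mul1r subrr normc0 mulr0.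
  by rewrite expr1n mul1r exprn_ge0 ?normc_ge0.
have -> : w ^+ n.+2 - z ^+ n.+2 - n.+2%:R * z ^+ n.+1 * (w - z) =
    w * (w ^+ n.+1 - z ^+ n.+1 - n.+1%:R * z ^+ n * (w - z))
    + n.+1%:R * z ^+ n * (w - z) ^+ 2.
  by rewrite !exprS -[n.+2]addn1 natrD; ring.
apply: le_trans (_ : rho * (rho *
    normc (w ^+ n.+1 - z ^+ n.+1 - n.+1%:R * z ^+ n * (w - z))
    + n.+1%:R * rho ^+ n * normc (w - z) ^+ 2) <= _).
  rewrite ler_wpM2l//; apply: le_trans (le_normcD _ _) _; apply: lerD.
    by rewrite normcM ler_wpM2r ?normc_ge0.
  rewrite !(normcX, normcM) normc_nat; apply: ler_wpM2r.
    by rewrite exprn_ge0 ?normc_ge0.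
  apply: ler_wpM2l; first exact: ler0n.
  by apply: lerXn2r; rewrite ?nnegrE ?normc_ge0.
rewrite mulrDr.
apply: (@le_trans _ _ (rho * (n.+1%:R ^+ 2 * rho ^+ n * normc (w - z) ^+ 2)
  + rho * (n.+1%:R * rho ^+ n * normc (w - z) ^+ 2))).
  by rewrite lerD2r ler_wpM2l.
have -> : rho * (n.+1%:R ^+ 2 * rho ^+ n * normc (w - z) ^+ 2)
  + rho * (n.+1%:R * rho ^+ n * normc (w - z) ^+ 2) =
  (n.+1%:R ^+ 2 + n.+1%:R) * (rho ^+ n.+1 * normc (w - z) ^+ 2).
  by rewrite (exprS rho); ring.
rewrite -mulrA; apply: ler_wpM2r.
  by rewrite mulr_ge0 ?exprn_ge0 ?normc_ge0.
rewrite -[n.+2]addn1 (natrD _ n.+1); have : 0 <= n.+1%:R :> R by [].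
by rewrite expr2; nra.
Qed.

(** The constant does not depend on the number of terms, so the estimate
    survives the limit without interchanging limits. *)
Lemma psum_taylor a rho : coef_geometric a -> 0 < rho < 1 ->
  exists2 M, 0 <= M & forall z w n, normc z <= rho -> normc w <= rho ->
    normc (psum a n.+1 w - psum a n.+1 z - (w - z) * psum (dcoef a) n z) <=
    M * normc (w - z) ^+ 2.
Proof.
move=> Ha /andP[r0 r1].
have [|K [q [K0 q01 H]]] := coef_geometric_shift
  (coef_geometric_nat (coef_geometric_nat Ha)) (rho := rho).
  by rewrite ltW.
have [q0 q1] := andP q01.
exists (K / (1 - q) / rho).
  by rewrite !divr_ge0 ?(ltW r0)// subr_ge0 ltW.
move=> z w n zr wr.
have -> : psum a n.+1 w - psum a n.+1 z - (w - z) * psum (dcoef a) n z =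
    \sum_(k < n) a k.+1 *
      (w ^+ k.+1 - z ^+ k.+1 - k.+1%:R * z ^+ k * (w - z)).
  rewrite /psum !big_ord_recl/= !expr0 mulr_sumr.
  rewrite opprD addrACA subrr add0r -!sumrB; apply: eq_bigr => k _.
  by rewrite /dcoef /bump/= !add1n; ring.
apply: le_trans (normc_sum _ _ _) _.
apply: (@le_trans _ _ (\sum_(k < n) K * q ^+ k * (normc (w - z) ^+ 2 / rho))).
  apply: ler_sum => k _; rewrite mulrA ler_pdivlMr// normcM mulrC mulrCA.
  apply: le_trans (_ : normc (a k.+1) *
     (k.+1%:R ^+ 2 * rho ^+ k * normc (w - z) ^+ 2) <= _).
    by rewrite ler_wpM2l ?normc_ge0// expr_taylor// ltW.
  rewrite mulrA; apply: ler_wpM2r; first by rewrite exprn_ge0 ?normc_ge0.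
  rewrite mulrA; apply: le_trans (H k).
  rewrite !normcM !normc_nat.
  by rewrite le_eqVlt; apply/orP; left; apply/eqP; ring.
rewrite -mulr_suml -mulr_sumr.
rewrite [leRHS](_ : _ = K / (1 - q) * (normc (w - z) ^+ 2 / rho)); last by ring.
apply: ler_wpM2r; first by rewrite divr_ge0 ?exprn_ge0 ?normc_ge0// ltW.
rewrite ler_wpM2l// -(big_mkord xpredT (fun k => q ^+ k)).
by have := geometric_sum_le 0 n q01; rewrite expr0 mul1r.
Qed.

Lemma sums_to_taylor a f f' rho : coef_geometric a ->
    sums_to a f -> sums_to (dcoef a) f' -> 0 < rho < 1 ->
  exists2 M, 0 <= M & forall z w, normc z <= rho -> normc w <= rho ->
    normc (f w - f z - (w - z) * f' z) <= M * normc (w - z) ^+ 2.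
Proof.
move=> Ha Hf Hf' r01; have [M M0 HM] := psum_taylor Ha r01.
have r01' : 0 <= rho < 1 by case/andP: r01 => /ltW -> ->.
have [K [q [K0 q01 H]]] := Hf rho r01'.
have [K' [q' [K'0 q'01 H']]] := Hf' rho r01'.
exists M => // z w zr wr; rewrite -subr_le0.
apply: (@geometric2_le0 (K * q + K * q) q (normc (w - z) * K') q') => //.
- by rewrite addr_ge0// mulr_ge0//; case/andP: q01.
- by rewrite mulr_ge0// normc_ge0.
move=> n; rewrite lerBlDr.
have -> : f w - f z - (w - z) * f' z = (f w - psum a n.+1 w)
   - (f z - psum a n.+1 z) - (w - z) * (f' z - psum (dcoef a) n z)
   + (psum a n.+1 w - psum a n.+1 z - (w - z) * psum (dcoef a) n z) by ring.
apply: le_trans (le_normcD _ _) _; apply: lerD; last exact: HM.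
apply: le_trans (normcB _ _) _; apply: lerD.
  apply: le_trans (normcB _ _) _; rewrite mulrDl -!mulrA -exprS.
  by rewrite lerD ?H.
by rewrite normcM -mulrA ler_wpM2l ?normc_ge0// H'.
Qed.

Lemma sums_to_bound a f rho : sums_to a f -> 0 <= rho < 1 ->
  exists2 B, 0 <= B & forall z, normc z <= rho -> normc (f z) <= B.
Proof.
move=> Hf r01; have [K [q [K0 _ H]]] := Hf rho r01.
exists K => // z zr.
by have := H z 0%N zr; rewrite /psum big_ord0 subr0 expr0 mulr1.
Qed.

Lemma sums_to_lipschitz a f f' rho : coef_geometric a ->
    sums_to a f -> sums_to (dcoef a) f' -> 0 < rho < 1 ->
  exists2 L, 0 <= L & forall z w, normc z <= rho -> normc w <= rho ->
    normc (f w - f z) <= L * normc (w - z).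
Proof.
move=> Ha Hf Hf' r01; have [M M0 HM] := sums_to_taylor Ha Hf Hf' r01.
have r01' : 0 <= rho < 1 by case/andP: r01 => /ltW -> ->.
have [B B0 HB] := sums_to_bound Hf' r01'.
exists (M * (rho + rho) + B).
  by rewrite addr_ge0// mulr_ge0// addr_ge0//; case/andP: r01'.
move=> z w zr wr; rewrite -(subrK ((w - z) * f' z) (f w - f z)).
apply: le_trans (le_normcD _ _) _; rewrite [leRHS]mulrDl; apply: lerD.
  apply: le_trans (HM _ _ zr wr) _; rewrite expr2 mulrA.
  apply: ler_wpM2r; first exact: normc_ge0.
  rewrite ler_wpM2l//; apply: le_trans (normcB _ _) _; exact: lerD.
by rewrite normcM mulrC ler_wpM2r ?normc_ge0// HB.
Qed.

Lemma sums_to_0 a f : sums_to a f -> f 0 = a 0%N.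
Proof.
move=> Hf; have [|K [q [K0 q01 H]]] := Hf 0; first by rewrite lexx ltr01.
apply/eqP; rewrite -subr_eq0; apply/eqP/eq0_normc/le_anti.
rewrite normc_ge0 andbT; have [q0 q1] := andP q01.
apply: (@geometric_le0 _ (K * q) q) => // n.
have := H 0 n.+1; rewrite normc0 lexx => /(_ isT).
rewrite /psum big_ord_recl/= expr0 mulr1 big1 ?addr0 ?exprS ?mulrA//.
by move=> k _; rewrite /bump/= add1n exprS mul0r mulr0.
Qed.

Lemma sums_toD a b f g : sums_to a f -> sums_to b g ->
  sums_to (fun n => a n + b n) (fun z => f z + g z).
Proof.
move=> Hf Hg rho r01; have [K [q [K0 /andP[q0 q1] H]]] := Hf rho r01.
have [K' [q' [K'0 /andP[q'0 q'1] H']]] := Hg rho r01.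
exists (K + K'), (Num.max q q'); split; first exact: addr_ge0.
  by rewrite le_max q0/= gt_max q1.
move=> z n zr.
have -> : f z + g z - psum (fun n => a n + b n) n z =
    (f z - psum a n z) + (g z - psum b n z).
  rewrite /psum (eq_bigr (fun k : 'I_n => a k * z ^+ k + b k * z ^+ k)).
    by rewrite big_split/=; ring.
  by move=> k _; rewrite mulrDl.
apply: le_trans (le_normcD _ _) _; rewrite mulrDl; apply: lerD.
  apply: le_trans (H _ n zr) _; rewrite ler_wpM2l//.
  by apply: lerXn2r; rewrite ?nnegrE ?le_max ?q0 ?lexx.
apply: le_trans (H' _ n zr) _; rewrite ler_wpM2l//.
by apply: lerXn2r; rewrite ?nnegrE ?le_max ?q0 ?q'0 ?lexx ?orbT.
Qed.

Lemma sums_toZ a f c : sums_to a f ->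
  sums_to (fun n => c * a n) (fun z => c * f z).
Proof.
move=> Hf rho r01; have [K [q [K0 q01 H]]] := Hf rho r01.
exists (normc c * K), q; split=> //; first by rewrite mulr_ge0 ?normc_ge0.
move=> z n zr.
have -> : c * f z - psum (fun n => c * a n) n z = c * (f z - psum a n z).
  rewrite /psum mulrBr mulr_sumr; congr (_ - _).
  by apply: eq_bigr => k _; rewrite mulrA.
by rewrite normcM -mulrA ler_wpM2l ?normc_ge0// H.
Qed.

(** Identifies the formal derivative with the derivative of [cplx R] over
    itself. *)
Lemma taylor_is_derive (f : cplx R -> cplx R) z (d : C) (M e : R) :
    0 < e ->
    (forall w, normc (w - z) <= e ->
      normc (f w - f z - (w - z) * d) <= M * normc (w - z) ^+ 2) ->
  derivable f z 1 /\ derive1 f z = d.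
Proof.
move=> e0 H.
have cv : (fun h : cplx R => h^-1 *: (f (h + z) - f z)) @ 0^' --> (d : cplx R).
  apply/(@cvgrPdist_le _ (cplx R)) => /= eps eps0.
  have /complex_realP[x xE] := gtr0_real eps0.
  subst eps.
  have x0 : 0 < x by move: eps0; rewrite ltcR.
  pose r := Num.min e (x / (`|M| + 1)).
  have M1 : 0 < `|M| + 1 by rewrite ltr_wpDl.
  have r0 : 0 < r by rewrite /r lt_min e0 divr_gt0.
  exists r%:C => //=; first by rewrite ltcR.
  move=> h; rewrite /= sub0r normrN => hr hn0.
  have {}hr : normc h < r by rewrite -ltcR.
  have h0 : h != 0 by [].
  have [hre hrx] : normc h <= e /\ normc h <= x / (`|M| + 1).
    by have := ltW hr; rewrite /r le_min => /andP.
  have := H (h + z); rewrite addrK => /(_ hre) Hh.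
  suff : normc (d - h^-1 * (f (h + z) - f z)) <= x by rewrite -lecR.
  have -> : d - h^-1 * (f (h + z) - f z) =
      - (h^-1 * (f (h + z) - f z - h * d)).
    by rewrite [in RHS]mulrBr mulKf// opprB.
  have nh0 : 0 < normc h.
    rewrite lt_neqAle normc_ge0 andbT eq_sym.
    by apply: contra h0 => /eqP/eq0_normc ->.
  rewrite normcN normcM normcV mulrC ler_pdivrMr//.
  apply: le_trans Hh _; rewrite expr2 mulrA ler_wpM2r ?normc_ge0//.
  apply: le_trans (_ : (`|M| + 1) * normc h <= _).
    by rewrite ler_wpM2r ?normc_ge0// (le_trans (ler_norm _))// lerDl.
  by rewrite mulrC -ler_pdivlMr.
split; last first.
  by rewrite /derive1; apply: cvg_lim => //; exact: norm_hausdorff.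
rewrite /derivable; apply/cvg_ex; exists d.
by under eq_fun do rewrite scaler1.
Qed.

End TermwiseDerivative.

(** * Averages over roots of unity *)

Section RootsOfUnity.
Variable R : realType.
Local Notation C := (R[i]).
Implicit Types (p q : nat -> C) (z w c : C) (n N : nat).

Definition root_of_unity N : C :=
  cos (2 * pi / N%:R) +i* sin (2 * pi / N%:R).

Lemma cis_exp (t : R) n :
  (cos t +i* sin t) ^+ n = cos (n%:R * t) +i* sin (n%:R * t) :> C.
Proof.
elim: n => [|n IH]; first by rewrite expr0 mul0r cos0 sin0.
rewrite exprS IH -natr1 mulrDl mul1r cosD sinD.
by apply/eqP; rewrite eq_complex/=; apply/andP; split; apply/eqP; ring.
Qed.

Lemma normc_root_of_unity N : normc (root_of_unity N) = 1.
Proof. by rewrite /= cos2Dsin2 sqrtr1. Qed.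

Lemma root_of_unity_expN N : (0 < N)%N -> root_of_unity N ^+ N = 1.
Proof.
move=> N0; rewrite cis_exp mulrCA divff ?pnatr_eq0 -?lt0n// mulr1.
by rewrite mulrC mulr_natr cos2pi sin2pi.
Qed.

Lemma root_of_unity_exp_neq1 N k : (0 < k < N)%N -> root_of_unity N ^+ k != 1.
Proof.
move=> /andP[k0 kN]; rewrite cis_exp eq_complex/= negb_and; apply/orP; left.
have N0' : (0 < N)%N by exact: leq_ltn_trans kN.
have N0 : 0 < N%:R :> R by rewrite ltr0n.
pose t : R := k%:R * pi / N%:R.
have -> : k%:R * (2 * pi / N%:R) = t *+ 2 by rewrite /t -mulr_natl; ring.
rewrite cos_mulr2n -subr_eq0; apply/negP => /eqP E.
have : 0 < sin t.
  apply: sin_gt0_pi; rewrite /t divr_gt0 ?mulr_gt0 ?pi_gt0 ?ltr0n//=.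
  by rewrite ltr_pdivrMr// mulrC ltr_pM2l ?pi_gt0// ltr_nat.
move=> s0; have := cos2Dsin2 t; have := exprn_gt0 2 s0.
by move: E; rewrite -mulr_natl; lra.
Qed.

Lemma sum_expr_unity_root (u : C) N : u ^+ N = 1 -> u != 1 ->
  \sum_(j < N) u ^+ j = 0.
Proof.
move=> uN u1; apply: (@mulfI _ (u - 1)); first by rewrite subr_eq0.
by rewrite -subrX1 uN subrr mulr0.
Qed.

Lemma sum_root_of_unity_exp N k : (0 < k < N)%N ->
  \sum_(j < N) (root_of_unity N ^+ j) ^+ k = 0.
Proof.
move=> kN; have N0 : (0 < N)%N by case/andP: kN => _; apply: leq_ltn_trans.
rewrite -[RHS](@sum_expr_unity_root (root_of_unity N ^+ k) N).
- by apply: eq_bigr => j _; rewrite -!exprM mulnC.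
- by rewrite -exprM mulnC exprM root_of_unity_expN ?expr1n.
- exact: root_of_unity_exp_neq1.
Qed.

Lemma root_of_unity_mulJ N j : root_of_unity N ^+ j * (root_of_unity N ^+ j)^* = 1.
Proof. by rewrite normcMJ normcX normc_root_of_unity !expr1n. Qed.

(** Orthogonality of the characters of the cyclic group of order [N]. *)
Lemma sum_root_of_unity_expJ N k l : (k < N)%N -> (l < N)%N ->
  \sum_(j < N) (root_of_unity N ^+ j) ^+ k * ((root_of_unity N ^+ j) ^+ l)^* =
  if k == l then N%:R else 0.
Proof.
move=> kN lN; have E (m d j : nat) : (root_of_unity N ^+ j) ^+ (m + d) *
    ((root_of_unity N ^+ j) ^+ m)^* = (root_of_unity N ^+ j) ^+ d.
  rewrite exprD mulrAC rmorphXn/= -exprMn root_of_unity_mulJ.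
  by rewrite expr1n mul1r.
have [->|kl] := eqVneq k l.
  rewrite (eq_bigr (fun=> 1)) ?sumr_const ?card_ord// => j _.
  by have := E l 0%N j; rewrite addn0 expr0.
have [kl'|lk] := ltnP k l.
  rewrite (eq_bigr (fun j : 'I_N => ((root_of_unity N ^+ j) ^+ (l - k))^*)).
    rewrite -rmorph_sum sum_root_of_unity_exp ?rmorph0//; lia.
  by move=> j _; rewrite -(E k (l - k)%N j) rmorphM/= conjcK subnKC ?(ltnW kl')// mulrC.
rewrite (eq_bigr (fun j : 'I_N => (root_of_unity N ^+ j) ^+ (k - l))).
  by rewrite sum_root_of_unity_exp//; lia.
by move=> j _; rewrite -(E l (k - l)%N j) subnKC.
Qed.

Lemma sum_psum_root_of_unityJ p q n N : (n <= N)%N ->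
  \sum_(j < N) psum p n (root_of_unity N ^+ j) * (psum q n (root_of_unity N ^+ j))^* =
  N%:R * \sum_(k < n) p k * (q k)^*.
Proof.
move=> nN; rewrite mulr_sumr.
under eq_bigr => j _ do rewrite /psum rmorph_sum mulr_suml.
rewrite exchange_big/=; apply: eq_bigr => k _.
under eq_bigr => j _ do rewrite mulr_sumr.
rewrite exchange_big/= (bigD1 k)//= [X in _ + X]big1 ?addr0.
  rewrite (eq_bigr (fun j : 'I_N => p k * (q k)^* *
     ((root_of_unity N ^+ j) ^+ k * ((root_of_unity N ^+ j) ^+ k)^*))).
    rewrite -mulr_sumr sum_root_of_unity_expJ ?(leq_trans (ltn_ord _) nN)// eqxx.
    by rewrite mulrC.
  by move=> j _; rewrite rmorphM/=; ring.
move=> l lk; rewrite (eq_bigr (fun j : 'I_N => p k * (q l)^* *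
     ((root_of_unity N ^+ j) ^+ k * ((root_of_unity N ^+ j) ^+ l)^*))).
  rewrite -mulr_sumr sum_root_of_unity_expJ ?(leq_trans (ltn_ord _) nN)//.
  by rewrite -[_ == _]/(k == l) eq_sym (negbTE lk) mulr0.
by move=> j _; rewrite rmorphM/=; ring.
Qed.

Lemma sum_psum_root_of_unity p n N : (0 < n)%N -> (n <= N)%N ->
  \sum_(j < N) psum p n (root_of_unity N ^+ j) = N%:R * p 0%N.
Proof.
case: n => // n _ nN.
under eq_bigr => j _ do rewrite /psum.
rewrite exchange_big/= big_ord_recl/= [X in _ + X]big1 ?addr0.
  by rewrite -mulr_sumr (eq_bigr (fun=> 1)) ?sumr_const ?card_ord 1?mulrC.
move=> k _; rewrite -mulr_sumr sum_root_of_unity_exp ?mulr0//.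
by rewrite /bump/= add1n (leq_trans _ nN)// ltnS ltn_ord.
Qed.

(** The exponents [k + l] stay below [N], so that only the constant terms
    contribute. *)
Lemma sum_psum_root_of_unityM p q n N : (0 < n)%N -> (n + n <= N)%N ->
  \sum_(j < N) psum p n (root_of_unity N ^+ j) * psum q n (root_of_unity N ^+ j) =
  N%:R * (p 0%N * q 0%N).
Proof.
move=> n0 nN.
under eq_bigr => j _ do rewrite {1}/psum mulr_suml.
rewrite exchange_big/=; case: n n0 nN => // n _ nN.
rewrite big_ord_recl/= [X in _ + X]big1 ?addr0.
  rewrite (eq_bigr (fun j : 'I_N => p 0%N * psum q n.+1 (root_of_unity N ^+ j))).
    rewrite -mulr_sumr sum_psum_root_of_unity//; last by lia.
    by rewrite mulrCA.
  by move=> j _; rewrite expr0 mulr1.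
move=> k _.
under eq_bigr => j _ do rewrite /psum mulr_sumr.
rewrite exchange_big/= big1// => l _.
rewrite (eq_bigr (fun j : 'I_N => p (bump 0 k) * q l *
     (root_of_unity N ^+ j) ^+ (bump 0 k + l))).
  rewrite -mulr_sumr sum_root_of_unity_exp ?mulr0// /bump/= add1n.
  by have := ltn_ord k; have := ltn_ord l; lia.
by move=> j _; rewrite exprD; ring.
Qed.

Lemma Re_mul_Re z w : complex.Re z * complex.Re w =
  (complex.Re (z * w) + complex.Re (z * w^*)) / 2.
Proof. by case: z w => [a b] [c d] /=; field. Qed.

Lemma natC_Re N z : complex.Re (N%:R * z) = N%:R * complex.Re z.
Proof. by rewrite -(rmorph_nat (real_complex R)) ReZ. Qed.

Lemma psum_scale p n z w :
  psum p n (z * w) = psum (fun k => p k * z ^+ k) n w.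
Proof. by apply: eq_bigr => k _; rewrite exprMn mulrA. Qed.

(** A truncated series has degree less than [N], hence the mean over [N] rotations is
    already the full circular mean. *)
Lemma parseval_root_of_unity p n N z : (n <= N)%N ->
  \sum_(j < N) normc (psum p n (root_of_unity N ^+ j * z)) ^+ 2 =
  N%:R * \sum_(k < n) normc (p k) ^+ 2 * (normc z ^+ 2) ^+ k.
Proof.
move=> nN.
under eq_bigr => j _ do rewrite mulrC psum_scale -ReMJ.
rewrite -Re_sum sum_psum_root_of_unityJ// natC_Re Re_sum; congr (_ * _).
by apply: eq_bigr => k _; rewrite ReMJ normcM normcX exprMn -!exprM mulnC.
Qed.

(** The mean over the roots of unity of the product of two nonnegative
    quantities is nonnegative; orthogonality evaluates it, because
    [Re z Re w = Re (z w + z conj w) / 2].  The slacks [e] and [d] allow for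
    truncation.  This plays the role of the Poisson and Herglotz integrals. *)
Lemma pairing_ge0 p q n (e d : R) : (0 < n)%N ->
    (forall w, normc w = 1 -> - e <= complex.Re (psum p n w)) ->
    (forall w, normc w = 1 -> - d <= complex.Re (psum q n w)) ->
  0 <= complex.Re (p 0%N * q 0%N + \sum_(k < n) p k * (q k)^*)
    + 2 * (d * complex.Re (p 0%N) + e * complex.Re (q 0%N) + e * d).
Proof.
move=> n0 Hp Hq; pose N := (n + n)%N.
have nN : (n <= N)%N by rewrite /N leq_addr.
have N0 : 0 < N%:R / 2 :> R by rewrite divr_gt0 ?ltr0n// (leq_trans n0).
rewrite -(pmulr_rge0 _ N0).
have w1 j : normc (root_of_unity N ^+ j) = 1 by rewrite normcX normc_root_of_unity expr1n.
have : 0 <= \sum_(j < N) (complex.Re (psum p n (root_of_unity N ^+ j)) + e) *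
     (complex.Re (psum q n (root_of_unity N ^+ j)) + d).
  apply: sumr_ge0 => j _; rewrite mulr_ge0// -lerBlDr sub0r.
    exact: Hp.
  exact: Hq.
rewrite (eq_bigr (fun j : 'I_N =>
    complex.Re (psum p n (root_of_unity N ^+ j) * psum q n (root_of_unity N ^+ j)) / 2
    + complex.Re (psum p n (root_of_unity N ^+ j) * (psum q n (root_of_unity N ^+ j))^*) / 2
    + (complex.Re (psum p n (root_of_unity N ^+ j)) * d
       + complex.Re (psum q n (root_of_unity N ^+ j)) * e + e * d))); last first.
  by move=> j _; have := Re_mul_Re (psum p n (root_of_unity N ^+ j))
    (psum q n (root_of_unity N ^+ j)); lra.
rewrite !big_split/= -!mulr_suml -!Re_sum sumr_const card_ord.
rewrite sum_psum_root_of_unityM// sum_psum_root_of_unityJ// !sum_psum_root_of_unity// !natC_Re ReD.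
rewrite -(mulr_natl e).
move=> H; apply: le_trans H _.
by rewrite le_eqVlt; apply/orP; left; apply/eqP; field.
Qed.

End RootsOfUnity.

(** * Functions with nonnegative real part *)

Section PositiveRealPart.
Variable R : realType.
Local Notation C := (R[i]).
Implicit Types (a b : nat -> C) (f g : C -> C) (z w c : C) (rho : R).

Lemma le_of_linear_slack (A B D c : R) : 0 < c ->
  (forall x, 0 < x < c -> A <= B + x * D) -> A <= B.
Proof.
move=> c0 H; apply/ler_addgt0Pr => e e0.
have D1 : 0 < `|D| + 1 by rewrite ltr_wpDl.
pose x := Num.min (c / 2) (e / (`|D| + 1)).
have x0 : 0 < x by rewrite /x lt_min !divr_gt0.
have xc : x < c.
  by apply: (@le_lt_trans _ _ (c / 2)); rewrite /x ?ge_min ?lexx//; lra.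
apply: le_trans (H x _) _; first by rewrite x0.
rewrite lerD2l; apply: le_trans (_ : x * (`|D| + 1) <= _).
  by rewrite ler_wpM2l ?(ltW x0)// (le_trans (ler_norm _))// lerDl.
by rewrite -ler_pdivlMr// /x ge_min lexx orbT.
Qed.

Lemma sum_ordS n (F : nat -> C) :
  \sum_(k < n.+1) F k = F 0%N + \sum_(k < n) F k.+1.
Proof. by rewrite big_ord_recl. Qed.

Lemma psum_pick n (u v : C) m w : (0 < m < n)%N ->
  psum (fun k => if k == 0%N then u else if k == m then v else 0) n w =
  u + v * w ^+ m.
Proof.
case: n => [|n] /andP[m0 mn]//.
rewrite /psum big_ord_recl/= expr0 mulr1; congr (_ + _).
have mn' : (m.-1 < n)%N by lia.
rewrite (bigD1 (Ordinal mn'))//= big1 ?addr0 /bump/= ?add1n ?prednK ?eqxx//.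
move=> k km; rewrite ifF ?mul0r//; apply/negbTE; apply: contra km => /eqP E.
by apply/eqP/val_inj => /=; lia.
Qed.

(** On the circle of radius [rho] a truncation of [f] inherits the sign of the
    real part of [f] up to the truncation error. *)
Lemma scaled_Re_ge f a rho n (K q : R) w : 0 <= rho < 1 ->
    (forall z, normc z < 1 -> 0 <= complex.Re (f z)) ->
    (forall z n, normc z <= rho -> normc (f z - psum a n z) <= K * q ^+ n) ->
    normc w = 1 ->
  - (K * q ^+ n) <= complex.Re (psum (fun k => a k * rho%:C ^+ k) n w).
Proof.
move=> /andP[r0 r1] Hf H w1; rewrite -psum_scale.
have nz : normc (rho%:C * w) = rho by rewrite normcM w1 mulr1 normc_real ger0_norm.
have := Hf (rho%:C * w); rewrite nz => /(_ r1) Hp.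
have := H (rho%:C * w) n; rewrite nz lexx => /(_ isT) Hq.
have := Re_le_normc (f (rho%:C * w) - psum a n (rho%:C * w)).
by rewrite ReB; lra.
Qed.

(** Pair [f] on the circle of radius [rho] with the kernel [1 + c w^m], where the
    unimodular [c] turns [a_m] into [- |a_m|]; then let [rho] tend to 1. *)
Lemma caratheodory_coef a f m : coef_geometric a -> sums_to a f ->
    (forall z, normc z < 1 -> 0 <= complex.Re (f z)) -> (0 < m)%N ->
  normc (a m) <= 2 * complex.Re (a 0%N).
Proof.
move=> Ha Hf Hp m0.
have [->|am0] := eqVneq (a m) 0.
  rewrite normc0 mulr_ge0// -(sums_to_0 Hf) Hp// normc0//.
have nam0 : normc (a m) != 0 by apply: contra am0 => /eqP/eq0_normc ->.
(* Chosen so that [a m * conj c = - |a m|]. *)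
pose c := - (a m * ((normc (a m))^-1)%:C).
have c1 : normc c = 1.
  by rewrite normcN normcM normc_real ger0_norm ?invr_ge0 ?normc_ge0// divff.
have ac : a m * c^* = - (normc (a m))%:C.
  have -> : c^* = - ((a m)^* * ((normc (a m))^-1)%:C).
    by rewrite /c conjcN conjcM conjc_realE.
  rewrite mulrN mulrA normcMJ.
  by rewrite -rmorphM/= expr2 mulfK.
have key rho : 0 < rho < 1 -> normc (a m) * rho ^+ m <= 2 * complex.Re (a 0%N).
  move=> r01; have r01' : 0 <= rho < 1 by case/andP: r01 => /ltW -> ->.
  have [K [q [K0 q01 H]]] := Hf rho r01'; have [q0 q1] := andP q01.
  rewrite -subr_le0; apply: (@geometric_le0 _ (2 * K * q ^+ m.+1) q) => // n.
  have mn : (0 < m < m.+1 + n)%N by lia.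
  have n0 : (0 < m.+1 + n)%N by lia.
  have Hq w : normc w = 1 -> - 0 <= complex.Re (psum
      (fun k => if k == 0%N then 1 else if k == m then c else 0) (m.+1 + n) w).
    move=> w1; rewrite psum_pick// ReD/=.
    have := Re_geN_normc (c * w ^+ m).
    by rewrite normcM normcX w1 c1 expr1n mulr1; lra.
  have := @pairing_ge0 R (fun k => a k * rho%:C ^+ k)
    (fun k => if k == 0%N then 1 else if k == m then c else 0)
    (m.+1 + n) (K * q ^+ (m.+1 + n)) 0 n0 (fun w hw => scaled_Re_ge _ r01' Hp H hw) Hq.
  have -> : \sum_(k < m.+1 + n) a k * rho%:C ^+ k *
      (if (k : nat) == 0%N then 1 else if (k : nat) == m then c else 0)^* =
      a 0%N + (a m * c^*) * (rho ^+ m)%:C.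
    transitivity (psum (fun k => if k == 0%N then a 0%N
       else if k == m then a m * (rho ^+ m)%:C * c^* else 0) (m.+1 + n) 1).
      apply: eq_bigr => k _; rewrite expr1n mulr1.
      case: eqP => [->|_]; first by rewrite expr0 -[1]/(1%:C) conjc_realE !mulr1.
      case: eqP => [->|_]; first by rewrite rmorphXn.
      by rewrite -[0]/(0%:C) conjc_realE mulr0.
    by rewrite psum_pick// expr1n mulr1 mulrAC.
  rewrite eqxx expr0 !mulr1 ac.
  rewrite !ReD mulNr ReN -rmorphM/= exprD.
  have -> : 2 * K * q ^+ m.+1 * q ^+ n = 2 * (K * (q ^+ m.+1 * q ^+ n)) by ring.
  lra.
(* Let [rho = 1 - x] tend to 1, using Bernoulli's [rho^m >= 1 - m x]. *)
apply: (@le_of_linear_slack _ _ (normc (a m) * m%:R) 1) => // x /andP[x0 x1].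
have := key (1 - x); rewrite subr_gt0 x1/= gtrBl x0 => /(_ isT).
have bern : 1 - m%:R * x <= (1 - x) ^+ m.
  elim: (m) => [|k IH]; first by rewrite mul0r subr0 expr0.
  rewrite exprS -natr1.
  apply: (@le_trans _ _ ((1 - x) * (1 - k%:R * x))).
    have : 0 <= k%:R * x * x by rewrite !mulr_ge0// ltW.
    lra.
  by rewrite ler_wpM2l// subr_ge0 ltW.
have := ler_wpM2l (normc_ge0 (a m)) bern.
by lra.
Qed.

(** The real part equals [(1 - |u|^2) / |1 - u|^2], and [|1 - u| <= 1 + |u|]. *)
Lemma Re_cayley_ge (u : C) : normc u < 1 ->
  (1 - normc u) / (1 + normc u) <= complex.Re ((1 + u) / (1 - u)).
Proof.
move=> ul1; set s := normc u.
have s0 : 0 <= s by exact: normc_ge0.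
have s1' : 0 < 1 - s by rewrite subr_gt0.
have nu : 1 - s <= normc (1 - u).
  by have := le_normc_dist 1 u; rewrite normc1.
have u1 : 1 - u != 0.
  by apply/eqP => E; move: nu; rewrite E normc0 leNgt s1'.
have nn : (1 + u) / (1 - u) = ((normc (1 - u) ^+ 2)^-1)%:C * ((1 + u) * (1 - u)^*).
  have v0 : (1 - u)^* != 0.
    apply: contra u1 => /eqP /(congr1 (@conjc R)).
    by rewrite conjcK rmorph0 => ->.
  rewrite fmorphV/=; move: v0 (normcMJ (1 - u)); move: ((1 - u)^*) => v v0 <-.
  by field; rewrite u1 v0.
rewrite nn ReZ.
have -> : complex.Re ((1 + u) * (1 - u)^*) = 1 - s ^+ 2.
  by rewrite sqr_normcE; case: (u) => x y /=; ring.
have np : 0 < normc (1 - u) ^+ 2 by rewrite exprn_gt0// (lt_le_trans s1').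
rewrite [leRHS]mulrC ler_pdivlMr// mulrAC ler_pdivrMr ?ltr_wpDr//.
have : normc (1 - u) ^+ 2 <= (1 + s) ^+ 2.
  apply: lerXn2r; rewrite ?nnegrE ?normc_ge0 ?addr_ge0//.
  by have := normcB 1 u; rewrite normc1.
move=> /(ler_wpM2l (ltW s1')) h.
by apply: le_trans h _; rewrite le_eqVlt; apply/orP; left; apply/eqP; ring.
Qed.

(** The kernel is a truncated Poisson kernel from which its minimum
    [(1 - s) / (1 + s)] over the circle has been subtracted. *)
Lemma poisson_partial_ge (s : R) (t w : C) n : 0 <= s < 1 -> normc t = s ->
    normc w = 1 ->
  - (2 / (1 - s) * s ^+ n.+1) <= complex.Re (psum
    (fun k => if k == 0%N then (1 - (1 - s) / (1 + s))%:C else 2 * t ^+ k) n.+1 w).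
Proof.
move=> /andP[s0 s1] ts w1; pose u := t * w.
have us : normc u = s by rewrite normcM w1 ts mulr1.
have s1' : 0 < 1 - s by rewrite subr_gt0.
have nu : 1 - s <= normc (1 - u).
  by have := le_normc_dist 1 u; rewrite normc1 us.
have u1 : 1 - u != 0.
  by apply/eqP => E; move: nu; rewrite E normc0 leNgt s1'.
have -> : psum (fun k => if k == 0%N then (1 - (1 - s) / (1 + s))%:C
    else 2 * t ^+ k) n.+1 w =
    (1 + u) / (1 - u) - 2 * u ^+ n.+1 / (1 - u) - ((1 - s) / (1 + s))%:C.
  have -> : psum (fun k => if k == 0%N then (1 - (1 - s) / (1 + s))%:C
      else 2 * t ^+ k) n.+1 w =
      2 * (\sum_(k < n.+1) u ^+ k) - 1 - ((1 - s) / (1 + s))%:C.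
    rewrite /psum !big_ord_recl/= !expr0 mulr1.
    rewrite (eq_bigr (fun i : 'I_n => 2 * u ^+ (bump 0 i))); last first.
      by move=> i _; rewrite exprMn mulrA.
    by rewrite -mulr_sumr mulrDr rmorphB/= rmorph1; ring.
  have -> : \sum_(k < n.+1) u ^+ k = (1 - u ^+ n.+1) / (1 - u).
    apply: (mulfI u1); rewrite mulrCA divff// mulr1.
    by rewrite -opprB mulNr -subrX1 opprB.
  by move: (((1 - s) / (1 + s))%:C) => kk; field.
rewrite !ReB Re_real.
have H1 : (1 - s) / (1 + s) <= complex.Re ((1 + u) / (1 - u)).
  by rewrite -us Re_cayley_ge// us.
have H2 : complex.Re (2 * u ^+ n.+1 / (1 - u)) <= 2 / (1 - s) * s ^+ n.+1.
  apply: le_trans (Re_le_normc _) _.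
  rewrite normcM normcV normcM normcX (normc_nat _ 2) us mulrAC.
  rewrite ler_wpM2r ?exprn_ge0// ler_wpM2l// lef_pV2// posrE//.
  exact: lt_le_trans nu.
lra.
Qed.

(** Pairing [f] with the Poisson kernel minus its minimum [kap] reproduces
    [f z - kap f 0] up to truncation errors. *)
Lemma harnack a f z : coef_geometric a -> sums_to a f ->
    (forall z, normc z < 1 -> 0 <= complex.Re (f z)) -> normc z < 1 ->
    complex.Im (a 0%N) = 0 ->
  (1 - normc z) / (1 + normc z) * complex.Re (a 0%N) <= complex.Re (f z).
Proof.
move=> Ha Hf Hp z1 im0; set r := normc z; set B := complex.Re (a 0%N).
have r0 : 0 <= r by exact: normc_ge0.
have a0E : a 0%N = B%:C by rewrite /B; case: (a 0%N) im0 => x y /= ->.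
have B0 : 0 <= B by rewrite /B -(sums_to_0 Hf) Hp// normc0.
have key rho : r < rho < 1 ->
    (1 - r / rho) / (1 + r / rho) * B <= complex.Re (f z).
  move=> /andP[rr r1]; set s := r / rho.
  have rho0 : 0 < rho by exact: le_lt_trans rr.
  have r01' : 0 <= rho < 1 by rewrite ltW.
  have s0 : 0 <= s by rewrite divr_ge0// ltW.
  have s1 : s < 1 by rewrite ltr_pdivrMr// mul1r.
  have s01 : 0 <= s < 1 by rewrite s0.
  have [K [q [K0 q01 H]]] := Hf rho r01'; have [q0 q1] := andP q01.
  set kap := (1 - s) / (1 + s).
  have kap01 : 0 <= kap <= 1.
    apply/andP; split; first by rewrite /kap; apply: divr_ge0; lra.
    by rewrite ler_pdivrMr ?ltr_wpDr//; lra.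
  have [kap0 kap1] := andP kap01.
  (* Conjugated, because the pairing conjugates the second factor. *)
  pose t := (z / rho%:C)^*.
  have ts : normc t = s.
    by rewrite normcJ normcM normcV normc_real gtr0_norm.
  pose D := 2 / (1 - s).
  have D0 : 0 <= D by rewrite divr_ge0// subr_ge0 ltW.
  rewrite -subr_le0; apply: (@geometric2_le0 _ ((K + K * (1 - kap) + K * D) * q)
     q (D * B * s) s) => //.
  - by rewrite mulr_ge0// !addr_ge0// mulr_ge0// subr_ge0.
  - exact: mulr_ge0 (mulr_ge0 D0 B0) s0.
  move=> n.
  have := @pairing_ge0 R (fun k => a k * rho%:C ^+ k)
    (fun k => if k == 0%N then (1 - kap)%:C else 2 * t ^+ k)
    n.+1 (K * q ^+ n.+1) (D * s ^+ n.+1) isT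
    (fun w hw => scaled_Re_ge _ r01' Hp H hw)
    (fun w hw => poisson_partial_ge n s01 ts hw).
  rewrite eqxx expr0 mulr1 [complex.Re (1 - kap)%:C]/= -/B.
  have -> : \sum_(k < n.+1) a k * rho%:C ^+ k *
      (if (k : nat) == 0%N then (1 - kap)%:C else 2 * t ^+ k)^* =
      2 * psum a n.+1 z - (B * (1 + kap))%:C.
    rewrite (sum_ordS n (fun k => a k * rho%:C ^+ k *
      (if k == 0%N then (1 - kap)%:C else 2 * t ^+ k)^*)).
    rewrite /psum (sum_ordS n (fun k => a k * z ^+ k)).
    rewrite eqxx !expr0 !mulr1 a0E conjc_realE mulrDr mulr_sumr.
    rewrite (_ : \sum_(k < n) _ = \sum_(k < n) 2 * (a k.+1 * z ^+ k.+1)).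
      by rewrite !rmorphM/= !(rmorphB, rmorphD)/= !rmorph1; ring.
    apply: eq_bigr => k _; rewrite -[k.+1 == 0%N]/false.
    rewrite conjcM conjcX conjcK -(rmorph_nat (real_complex R)) conjc_realE.
    rewrite rmorph_nat expr_div_n.
    have : rho%:C ^+ k.+1 != 0 by rewrite expf_neq0// eq_complex/= gt_eqF.
    by move: (rho%:C ^+ k.+1) => rk rk0; field.
  rewrite a0E -rmorphM ReD ReB natC_Re /=.
  have := Re_le_normc (psum a n.+1 z - f z).
  rewrite normc_distC ReB.
  have := H z n.+1 (ltW rr).
  have e0 : 0 <= K * q ^+ n.+1 by rewrite mulr_ge0 ?exprn_ge0.
  have : K * q ^+ n.+1 * (D * s ^+ n.+1) <= K * D * q * q ^+ n.
    rewrite -[K * D * q * _]mulrA -exprS mulrACA.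
    apply: ler_wpM2l; first exact: mulr_ge0.
    by rewrite ler_piMr ?exprn_ge0// exprn_ile1// ltW.
  rewrite !exprS; set qn := q ^+ n; set sn := s ^+ n.
  move=> h1 h2 h3 h4.
  have e1 : (K + K * (1 - kap) + K * D) * q * qn = K * (q * qn)
    + K * (q * qn) * (1 - kap) + K * D * q * qn by ring.
  have e2 : D * B * s * sn = D * (s * sn) * B by ring.
  by rewrite e1 e2; lra.
have [rr1] : r < 1 by [].
have D1 : 0 < 1 + r by rewrite ltr_wpDr.
rewrite mulrAC ler_pdivrMr//.
apply: (@le_of_linear_slack _ _ (B - complex.Re (f z)) (1 - r)).
  by rewrite subr_gt0.
move=> x /andP[x0 x1].
have rho0 : 0 < 1 - x by lra.
have /key : r < 1 - x < 1 by lra.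
have -> : (1 - r / (1 - x)) / (1 + r / (1 - x)) = (1 - x - r) / (1 - x + r).
  by field; rewrite !gt_eqF//; lra.
by rewrite mulrAC ler_pdivrMr; lra.
Qed.

End PositiveRealPart.

(** * Monotonicity and openness of harmonic maps *)

Section HarmonicMaps.
Variable R : realType.
Local Notation C := (R[i]).
Implicit Types (a b : nat -> C) (z w v : C) (rho s t : R).

(** Cut the interval into [n] equal pieces: the allowed losses telescope to
    [(psi y - psi x) (y - x) / n], which tends to 0.  With [psi] linear it says that
    a loss quadratic in the step is harmless; with [psi] the derivative of a
    comparison function it integrates a differential inequality. *)
Lemma subdivision_le (D psi : R -> R) (x y : R) : x <= y ->
    (forall s t, x <= s -> s <= t -> t <= y ->
       - ((psi t - psi s) * (t - s)) <= D t - D s) ->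
  D x <= D y.
Proof.
move=> xy H; apply/ler_addgt0Pr => e e0.
pose E := (psi y - psi x) * (y - x).
pose n := (Num.truncn (`|E| / e)).+1.
have n0 : 0 < n%:R :> R by rewrite ltr0n.
have En : `|E| / n%:R <= e.
  rewrite ler_pdivrMr// mulrC -ler_pdivrMr//.
  by apply: ltW; rewrite truncnS_gt.
pose p k : R := x + (y - x) * (k%:R / n%:R).
have p0 : p 0%N = x by rewrite /p mul0r mulr0 addr0.
have pn : p n = y by rewrite /p divff ?gt_eqF// mulr1 addrC subrK.
have step k : p k.+1 - p k = (y - x) / n%:R.
  by rewrite /p -natr1 mulrDl; ring.
have yx0 : 0 <= y - x by rewrite subr_ge0.
have st0 : 0 <= (y - x) / n%:R by rewrite divr_ge0// ltW.
have key : - \sum_(0 <= k < n) ((psi (p k.+1) - psi (p k)) * ((y - x) / n%:R)) <=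
    \sum_(0 <= k < n) (D (p k.+1) - D (p k)).
  rewrite -sumrN big_nat_cond [leRHS]big_nat_cond.
  apply: ler_sum => k /andP[/andP[_ kn] _].
  rewrite -(step k); apply: H.
  - by rewrite /p lerDl mulr_ge0// divr_ge0// ltW.
  - by rewrite -subr_ge0 step.
  - by rewrite -pn /p lerD2l ler_wpM2l// ler_wpM2r ?invr_ge0 ?ler_nat.
move: key; rewrite -mulr_suml !telescope_sumr// p0 pn.
have := ler_norm E; rewrite -(ler_pM2r (x := n%:R^-1)) ?invr_gt0// => h1.
rewrite mulrA -/E -subr_ge0 => h2.
by move: En; rewrite -/E; lra.
Qed.

Lemma segment_normc z w rho t : normc z <= rho -> normc w <= rho ->
  0 <= t <= 1 -> normc (w + t%:C * (z - w)) <= rho.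
Proof.
move=> zr wr /andP[t0 t1].
have -> : w + t%:C * (z - w) = (1 - t)%:C * w + t%:C * z.
  by rewrite rmorphB rmorph1; ring.
apply: le_trans (le_normcD _ _) _; rewrite !normcM !normc_real.
rewrite !ger0_norm ?subr_ge0//.
apply: le_trans (lerD (ler_wpM2l _ wr) (ler_wpM2l _ zr)) _ => //.
  by rewrite subr_ge0.
by rewrite -mulrDl subrK mul1r.
Qed.

Section Pair.
Variables (a b : nat -> C) (h h1 g g1 : C -> C).
Hypotheses (Ha : coef_geometric a) (Hb : coef_geometric b).
Hypotheses (Hh : sums_to a h) (Hh1 : sums_to (dcoef a) h1).
Hypotheses (Hg : sums_to b g) (Hg1 : sums_to (dcoef b) g1).

Let f z := h z + (g z)^*.

(** Along the segment from [w] to [z], with [u = z - w], the derivative of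
    [Re (f conj u)] is [|u|^2 Re h' + Re (conj (u g') conj u)], which is at least
    [|u|^2 (Re h' - |g'|)]. *)
Lemma strongly_monotone rho (c : R) z w : 0 < rho < 1 ->
    (forall v, normc v <= rho -> c <= complex.Re (h1 v) - normc (g1 v)) ->
    normc z <= rho -> normc w <= rho ->
  c * normc (z - w) ^+ 2 <= complex.Re ((f z - f w) * (z - w)^*).
Proof.
move=> r01 Hc zr wr; have [M M0 HM] := sums_to_taylor Ha Hh Hh1 r01.
have [M' M'0 HM'] := sums_to_taylor Hb Hg Hg1 r01.
set u := z - w.
pose P t := w + t%:C * u.
pose phi t := complex.Re (f (P t) * u^*).
pose K := (M + M') * normc u ^+ 3.
have PE s t : P t - P s = (t - s)%:C * u by rewrite /P rmorphB; ring.
have := @subdivision_le (fun t => phi t - c * normc u ^+ 2 * t) (fun t => K * t)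
  0 1 ler01.
have -> : phi 0 = complex.Re (f w * u^*) by rewrite /phi /P mul0r addr0.
have -> : phi 1 = complex.Re (f z * u^*).
  by rewrite /phi /P mul1r addrC subrK.
rewrite mulrBl ReB mulr0 mulr1 subr0 => sub.
suff : complex.Re (f w * u^*) <= complex.Re (f z * u^*) - c * normc u ^+ 2 by lra.
apply: sub => s t s0 st t1.
have Pr x : 0 <= x <= 1 -> normc (P x) <= rho by exact: segment_normc.
have Psr : normc (P s) <= rho by apply: Pr; lra.
have Ptr : normc (P t) <= rho by apply: Pr; lra.
have := HM _ _ Psr Ptr; have := HM' _ _ Psr Ptr; rewrite PE.
rewrite normcM normc_real ger0_norm ?subr_ge0//.
set E' := (g _ - g _ - _); set E := (h _ - h _ - _) => hE' hE.
have -> : phi t - c * normc u ^+ 2 * t - (phi s - c * normc u ^+ 2 * s) =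
    (t - s) * (normc u ^+ 2 * complex.Re (h1 (P s)) +
       complex.Re ((u * g1 (P s) * u)^*) - c * normc u ^+ 2)
    + complex.Re (E * u^*) + complex.Re ((E' * u)^*).
  rewrite /phi -ReMJ -(conjcK u) -conjcM conjcK.
  rewrite /E /E' /f.
  case: (h (P t)) (h (P s)) (g (P t)) (g (P s)) (h1 (P s)) (g1 (P s)) (u)
    => [? ?] [? ?] [? ?] [? ?] [? ?] [? ?] [? ?] /=.
  by ring.
have e1 : - (normc u ^+ 2 * normc (g1 (P s))) <= complex.Re ((u * g1 (P s) * u)^*).
  rewrite ReJ; apply: le_trans (Re_geN_normc _); rewrite lerN2 !normcM.
  by rewrite le_eqVlt; apply/orP; left; apply/eqP; ring.
have un0 : 0 <= normc u by exact: normc_ge0.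
have e2 : - (M * ((t - s) * normc u) ^+ 2 * normc u) <= complex.Re (E * u^*).
  apply: le_trans (Re_geN_normc _); rewrite lerN2 normcM normcJ.
  exact: ler_wpM2r.
have e3 : - (M' * ((t - s) * normc u) ^+ 2 * normc u) <= complex.Re ((E' * u)^*).
  rewrite ReJ; apply: le_trans (Re_geN_normc _); rewrite lerN2 normcM.
  exact: ler_wpM2r.
have e4 : 0 <= (t - s) * (normc u ^+ 2 * (complex.Re (h1 (P s)) -
     normc (g1 (P s)) - c)).
  rewrite !mulr_ge0 ?subr_ge0 ?exprn_ge0//.
  by rewrite Hc.
have e5 : 0 <= (t - s) * (complex.Re ((u * g1 (P s) * u)^*) +
    normc u ^+ 2 * normc (g1 (P s))).
  by rewrite mulr_ge0 ?subr_ge0// -lerBlDr sub0r.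
have -> : - ((K * t - K * s) * (t - s)) =
  - (M * ((t - s) * normc u) ^+ 2 * normc u)
  - (M' * ((t - s) * normc u) ^+ 2 * normc u) by rewrite /K; ring.
lra.
Qed.

Lemma harmonic_lipschitz rho : 0 < rho < 1 ->
  exists2 L, 0 <= L & forall z w, normc z <= rho -> normc w <= rho ->
    normc (f w - f z) <= L * normc (w - z).
Proof.
move=> r01; have [L L0 HL] := sums_to_lipschitz Ha Hh Hh1 r01.
have [L' L'0 HL'] := sums_to_lipschitz Hb Hg Hg1 r01.
exists (L + L'); first exact: addr_ge0.
move=> z w zr wr.
have -> : f w - f z = (h w - h z) + (g w - g z)^*.
  by rewrite /f; case: (g w) (g z) (h w) (h z) => [? ?] [? ?] [? ?] [? ?];
    apply/eqP; rewrite eq_complex/=; apply/andP; split; apply/eqP; ring.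
apply: le_trans (le_normcD _ _) _; rewrite normcJ mulrDl.
by apply: lerD; [exact: HL|exact: HL'].
Qed.

(** Strong monotonicity and the Lipschitz bound make
    [w |-> w - tau (f w - v)] a contraction for small [tau]; its fixed point
    solves [f w = v].  That [eta] does not depend on [z] is what allows the
    conclusion at limit points of the image. *)
Lemma uniformly_open rho r0 (c : R) : 0 < rho < 1 -> r0 < rho -> 0 < c ->
    (forall v, normc v <= rho -> c <= complex.Re (h1 v) - normc (g1 v)) ->
  exists2 eta, 0 < eta & forall z v, normc z <= r0 -> normc (v - f z) <= eta ->
    exists2 z', normc z' < 1 & f z' = v.
Proof.
move=> r01 r0r c0 Hc; have [L0 L00 HL0] := harmonic_lipschitz r01.
pose L := L0 + c.
have Lpos : 0 < L by rewrite /L ltr_wpDl.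
have HL z w : normc z <= rho -> normc w <= rho ->
    normc (f w - f z) <= L * normc (w - z).
  move=> zr wr; apply: le_trans (HL0 _ _ zr wr) _.
  by rewrite ler_wpM2r ?normc_ge0// /L lerDl ltW.
(* Minimizes [1 - 2 tau c + tau^2 L^2], the squared contraction factor. *)
pose tau := c / L ^+ 2.
have tau0 : 0 < tau by rewrite divr_gt0// exprn_gt0.
pose kap := c * tau.
have kapE : tau ^+ 2 * L ^+ 2 = kap.
  by rewrite /kap /tau; field; rewrite gt_eqF.
have kap0 : 0 < kap by rewrite mulr_gt0.
have kap1 : kap <= 1.
  rewrite /kap /tau mulrA -expr2 ler_pdivrMr ?exprn_gt0// mul1r.
  by apply: lerXn2r; rewrite ?nnegrE ?(ltW c0) ?(ltW Lpos)// /L lerDr.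
(* A rational upper bound for the contraction factor [sqrt (1 - kap)]. *)
pose q := 1 - kap / 2.
have q01 : 0 <= q < 1 by rewrite /q; lra.
have [q0 q1] := andP q01.
pose del := rho - r0.
have del0 : 0 < del by rewrite subr_gt0.
exists (del * (1 - q) / tau).
  by rewrite divr_gt0// mulr_gt0// subr_gt0.
move=> z v zr vz.
pose T w := w - tau%:C * (f w - v).
have Tcontr w w' : normc w <= rho -> normc w' <= rho ->
    normc (T w - T w') <= q * normc (w - w').
  move=> wr w'r.
  rewrite -(@ler_pXn2r _ 2)// ?nnegrE ?mulr_ge0 ?normc_ge0//.
  have -> : T w - T w' = (w - w') - tau%:C * (f w - f w') by rewrite /T; ring.
  have -> : normc (w - w' - tau%:C * (f w - f w')) ^+ 2 =
    normc (w - w') ^+ 2 - 2 * tau * complex.Re ((f w - f w') * (w - w')^*)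
    + tau ^+ 2 * normc (f w - f w') ^+ 2.
    rewrite !sqr_normcE; case: (w - w') (f w - f w') => [? ?] [? ?] /=.
    by ring.
  have m1 := strongly_monotone r01 Hc wr w'r.
  have m2 : normc (f w - f w') ^+ 2 <= L ^+ 2 * normc (w - w') ^+ 2.
    rewrite -exprMn; apply: lerXn2r; rewrite ?nnegrE ?mulr_ge0 ?normc_ge0//.
      exact: ltW.
    exact: HL.
  have m3 := ler_wpM2l (exprn_ge0 2 (ltW tau0)) m2.
  have m4 := ler_wpM2l (ltW tau0) m1.
  rewrite [leRHS]exprMn /q.
  have m5 : 0 <= (kap / 2) ^+ 2 * normc (w - w') ^+ 2.
    by rewrite mulr_ge0 ?sqr_ge0.
  rewrite [leRHS]mulrA kapE in m3.
  move: m4 m5.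
  have -> : tau * (c * normc (w - w') ^+ 2) = kap * normc (w - w') ^+ 2.
    by rewrite /kap; ring.
  move: (complex.Re _) (normc (w - w') ^+ 2) (normc _ ^+ 2) (kap) (tau) m3.
  by move=> A B D k t m3 m4 m5; lra.
pose u n := iter n T z.
have Hu n : normc (u n - z) <= del * (1 - q ^+ n) /\
    normc (u n.+1 - u n) <= del * (1 - q) * q ^+ n.
  have near w : normc (w - z) <= del -> normc w <= rho.
    move=> wz; rewrite -(subrK z w); apply: le_trans (le_normcD _ _) _.
    by move: wz zr; rewrite /del; lra.
  elim: n => [|n [IH1 IH2]].
    rewrite /u/= subrr normc0 expr0 subrr mulr0 mulr1; split=> //.
    rewrite /T [z - _]addrC addrK -mulrN opprB normcM normc_real gtr0_norm//.
    by rewrite mulrC -ler_pdivlMr.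
  have IH3 : normc (u n.+1 - z) <= del * (1 - q ^+ n.+1).
    rewrite -(subrK (u n) (u n.+1)) -addrA.
    apply: le_trans (le_normcD _ _) _; apply: le_trans (lerD IH2 IH1) _.
    by rewrite exprS le_eqVlt; apply/orP; left; apply/eqP; ring.
  have le1 m : del * (1 - q ^+ m) <= del.
    by rewrite ler_piMr ?(ltW del0)// gerBl exprn_ge0.
  split=> //.
  rewrite [u n.+2]iterS -/(u n.+1) {2}[u n.+1]iterS -/(u n).
  apply: le_trans (Tcontr _ _ _ _) _.
  - by apply: near; apply: le_trans IH3 (le1 _).
  - by apply: near; apply: le_trans IH1 (le1 _).
  by rewrite exprS mulrCA ler_wpM2l.
have K0 : 0 <= del * (1 - q) by rewrite mulr_ge0 ?(ltW del0)// subr_ge0 ltW.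
have [l Hl] := geometric_cauchy_cvg K0 q01 (fun n => (Hu n).2).
have {}Hl n : normc (l - u n) <= del * q ^+ n.
  by have := Hl n; rewrite mulfK// gt_eqF// subr_gt0.
have lr : normc l <= rho.
  have := Hl 0%N; rewrite expr0 mulr1 /u/= => lz.
  rewrite -(subrK z l); apply: le_trans (le_normcD _ _) _.
  by move: lz zr; rewrite /del; lra.
exists l; first by apply: le_lt_trans lr _; case/andP: r01.
apply/eqP; rewrite -subr_eq0; apply/eqP/eq0_normc/le_anti.
rewrite normc_ge0 andbT.
apply: (@geometric_le0 _ (L * del + del * (1 - q) / tau) q) => // n.
have ur : normc (u n) <= rho.
  rewrite -(subrK z (u n)); apply: le_trans (le_normcD _ _) _.
  have : del * (1 - q ^+ n) <= del.
    by rewrite ler_piMr ?(ltW del0)// gerBl exprn_ge0.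
  by have := (Hu n).1; move: zr; rewrite /del; lra.
rewrite -(subrK (f (u n)) (f l)) -addrA mulrDl.
apply: le_trans (le_normcD _ _) _; apply: lerD.
  apply: le_trans (HL _ _ ur lr) _; rewrite -mulrA ler_wpM2l ?(ltW Lpos)//.
have := (Hu n).2; rewrite [u n.+1]iterS -/(u n) /T [u n - _]addrC addrK normcN.
rewrite normcM normc_real gtr0_norm// => h2.
by rewrite mulrAC ler_pdivlMr// mulrC.
Qed.

End Pair.
End HarmonicMaps.

(** * Coefficient and growth estimates *)

Section ClassP.
Variable R : realType.
Local Notation C := (R[i]).
Implicit Types (a b : nat -> C) (z w v : C) (rho s t : R).

Lemma exists_phase z : exists2 c : C, normc c = 1 & c * z = (normc z)%:C.
Proof.
have [->|z0] := eqVneq z 0; first by exists 1; rewrite ?normc1// mul1r normc0.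
have nz : normc z != 0 by apply: contra z0 => /eqP/eq0_normc ->.
exists (z^* * ((normc z)^-1)%:C).
  by rewrite normcM normcJ normc_real ger0_norm ?invr_ge0 ?normc_ge0// divff.
by rewrite mulrAC [_ * z]mulrC normcMJ -rmorphM/= expr2 mulfK.
Qed.

Lemma exists_aligning_phase z w :
  exists2 c : C, normc c = 1 & normc (z + c * w) = normc z + normc w.
Proof.
have [c c1 cz] := exists_phase z; have [d d1 dw] := exists_phase w.
have c0 : c != 0 by apply/eqP => E; move: c1; rewrite E normc0 => /eqP;
  rewrite eq_sym oner_eq0.
exists (d / c); first by rewrite normcM normcV c1 d1 invr1 mulr1.
rewrite -[LHS]mul1r -c1 -normcM mulrDr cz mulrA [c * _]mulrC divfK// dw.
by rewrite -rmorphD normc_real ger0_norm// addr_ge0 ?normc_ge0.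
Qed.

Lemma sums_to_const (c : C) :
  sums_to (fun k => if k == 0%N then c else 0) (fun=> c).
Proof.
move=> rho _; exists (normc c), 0; split=> //; first exact: normc_ge0.
  by rewrite lexx ltr01.
move=> z [|n] _; first by rewrite /psum big_ord0 subr0 expr0 mulr1.
rewrite /psum big_ord_recl/= expr0 mulr1 big1 => [|k _]; last by rewrite mul0r.
by rewrite addr0 subrr normc0 mulr_ge0 ?normc_ge0 ?exprn_ge0.
Qed.

Lemma coef_geometric_const (c : C) :
  coef_geometric (fun k => if k == 0%N then c else 0).
Proof.
move=> rho _; exists (normc c), 0; split=> //; first exact: normc_ge0.
  by rewrite lexx ltr01.
case=> [|n]; first by rewrite !expr0.
by rewrite normc0 mul0r mulr_ge0 ?normc_ge0 ?exprn_ge0.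
Qed.

Section Pair.
Variables (a b : nat -> C) (h h1 g g1 : C -> C) (alpha : R).
Hypotheses (Ha : coef_geometric a) (Hb : coef_geometric b).
Hypotheses (Hh : sums_to a h) (Hh1 : sums_to (dcoef a) h1).
Hypotheses (Hg : sums_to b g) (Hg1 : sums_to (dcoef b) g1).
Hypotheses (a0 : a 0%N = 0) (a1 : a 1%N = 1) (b0 : b 0%N = 0) (b1 : b 1%N = 0).
Hypothesis alpha01 : 0 <= alpha < 1.
Hypothesis Hpos : forall z, normc z < 1 ->
  normc (g1 z) <= complex.Re (h1 z) - alpha.

(** The coefficients of [h' + c g' - alpha], whose real part is nonnegative when
    [c] is unimodular. *)
Let p (c : C) k := dcoef a k + c * dcoef b k +
  (if k == 0%N then (- alpha)%:C else 0).
Let F (c : C) z := h1 z + c * g1 z + (- alpha)%:C.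

Let Hp c : coef_geometric (p c).
Proof.
apply: coef_geometricD; last exact: coef_geometric_const.
apply: coef_geometricD; first exact: coef_geometric_dcoef.
by apply: coef_geometricZ; exact: coef_geometric_dcoef.
Qed.

Let HF c : sums_to (p c) (F c).
Proof.
apply: sums_toD; last exact: sums_to_const.
by apply: sums_toD => //; exact: sums_toZ.
Qed.

Let F_pos c z : normc c = 1 -> normc z < 1 -> 0 <= complex.Re (F c z).
Proof.
move=> c1 /Hpos Hz; rewrite /F !ReD Re_real.
have := Re_geN_normc (c * g1 z); rewrite normcM c1 mul1r; lra.
Qed.

Let p0 c : p c 0%N = (1 - alpha)%:C.
Proof.
by rewrite /p/= /dcoef a1 b1 !mulr0 addr0 mulr1 rmorphB rmorphN.
Qed.

(** Choose [c] so that [|a_n + c b_n| = |a_n| + |b_n|]. *)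
Lemma coef_bound n : (1 < n)%N ->
  normc (a n) + normc (b n) <= 2 * (1 - alpha) / n%:R.
Proof.
case: n => [|[|n]]// _; rewrite ler_pdivlMr ?ltr0n//.
have [c c1 cE] := exists_aligning_phase (a n.+2) (b n.+2).
rewrite -cE -(normc_nat R n.+2) -normcM.
have := caratheodory_coef (Hp c) (HF c) (fun z => F_pos c1) (ltn0Sn n).
rewrite p0 Re_real; apply: le_trans; rewrite /p/= addr0 /dcoef.
by rewrite le_eqVlt; apply/orP; left; apply/eqP; congr normc; ring.
Qed.

Definition harnack_rate t : R := alpha + (1 - alpha) * ((1 - t) / (1 + t)).

(** Choose [c] so that [c g' z = - |g' z|] at the given point [z]. *)
Lemma jacobian_rate z : normc z < 1 ->
  harnack_rate (normc z) <= complex.Re (h1 z) - normc (g1 z).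
Proof.
move=> z1; have [c c1 cE] := exists_phase (- g1 z).
have n1 : normc (- c) = 1 by rewrite normcN.
have cE' : - c * g1 z = (normc (g1 z))%:C by rewrite mulNr -mulrN cE normcN.
have := harnack (Hp c) (HF c) (fun z => F_pos c1) z1.
rewrite p0 Re_real => /(_ erefl).
rewrite /F -[c * g1 z]opprK -mulNr cE' !ReD ReN !Re_real /harnack_rate.
by rewrite mulrC; lra.
Qed.

Lemma harnack_rate_decr s t : 0 <= s -> s <= t -> harnack_rate t <= harnack_rate s.
Proof.
move=> s0 st; have [_ al1] := andP alpha01; rewrite /harnack_rate lerD2l.
rewrite ler_wpM2l//; first by rewrite subr_ge0 ltW.
rewrite ler_pdivrMr; last by lra.
rewrite mulrAC ler_pdivlMr; last by lra.
by lra.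
Qed.

Lemma harnack_rate_gt0 t : 0 <= t -> t < 1 -> 0 < harnack_rate t.
Proof.
move=> t0 t1; have [al0 al1] := andP alpha01.
by rewrite /harnack_rate ltr_wpDl// mulr_gt0 ?divr_gt0//; lra.
Qed.

(** The primitive of [harnack_rate] that vanishes at 0. *)
Definition growth t : R := alpha * t + (1 - alpha) * (2 * ln (1 + t) - t).

(** The primitive of a decreasing function lies below its tangents. *)
Lemma growth_tangent s t : 0 <= s -> 0 <= t ->
  growth t - growth s <= harnack_rate s * (t - s).
Proof.
move=> s0 t0; have [al0 al1] := andP alpha01.
have lnle : ln (1 + t) - ln (1 + s) <= (t - s) / (1 + s).
  rewrite -ln_div ?posrE; [|lra|lra].
  have -> : (1 + t) / (1 + s) = 1 + (t - s) / (1 + s) by field; lra.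
  apply: le_ln1Dx; rewrite ltr_pdivlMr; lra.
have : (1 - alpha) * (2 * (ln (1 + t) - ln (1 + s))) <=
    (1 - alpha) * (2 * ((t - s) / (1 + s))).
  by rewrite ler_wpM2l ?subr_ge0 ?(ltW al1)// ler_wpM2l.
rewrite /growth /harnack_rate.
have -> : (1 - s) / (1 + s) = 2 / (1 + s) - 1 by field; lra.
have -> : 2 * ((t - s) / (1 + s)) = 2 / (1 + s) * (t - s) by field; lra.
lra.
Qed.

Lemma growth_homo s t : 0 <= s -> s <= t -> t <= 1 -> growth s <= growth t.
Proof.
move=> s0 st t1; have [al0 al1] := andP alpha01.
have t0 : 0 <= t by exact: le_trans st.
have := growth_tangent t0 s0.
have : 0 <= harnack_rate t * (t - s).
  rewrite mulr_ge0 ?subr_ge0// /harnack_rate addr_ge0// mulr_ge0 ?divr_ge0//; lra.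
lra.
Qed.

Let f z := h z + (g z)^*.

(** On the radius through [z], in the direction [e], the quantity [Re (f conj e)]
    grows at least at the rate given by [jacobian_rate]. *)
Lemma growth_le z : normc z < 1 -> growth (normc z) <= normc (f z).
Proof.
move=> z1; set r := normc z.
have [z0|nz] := eqVneq r 0.
  by rewrite z0 /growth addr0 ln1 !mulr0 subr0 mulr0 addr0 normc_ge0.
have r0 : 0 < r by rewrite lt_neqAle eq_sym nz normc_ge0.
pose e : C := z * (r^-1)%:C.
have ne : normc e = 1.
  by rewrite normcM normc_real ger0_norm ?invr_ge0 ?(ltW r0)// divff.
pose P t : C := t%:C * e.
have Pn t : 0 <= t -> normc (P t) = t.
  by move=> t0; rewrite normcM normc_real ne mulr1 ger0_norm.
pose D t := complex.Re (f (P t) * e^*).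
have := @subdivision_le R (fun t => D t - growth t) (fun t => - harnack_rate t)
  0 r (ltW r0).
have f0 : f (P 0) = 0.
  by rewrite /P mul0r /f (sums_to_0 Hh) (sums_to_0 Hg) a0 b0 -[0]/(0%:C)
    conjc_realE addr0.
have -> : D 0 - growth 0 = 0.
  by rewrite /D f0 mul0r /growth addr0 ln1 !mulr0 subr0 mulr0 addr0 subr0.
have Pr : P r = z by rewrite /P /e mulrCA -rmorphM/= divff// mulr1.
have Dr : D r <= normc (f z).
  by apply: le_trans (Re_le_normc _) _; rewrite normcM normcJ ne mulr1 Pr.
move=> sub; suff : 0 <= D r - growth r by lra.
apply: sub => s t s0 st tr.
have [->|st'] := eqVneq s t; first by rewrite !subrr mulr0 oppr0.
have {}st' : s < t by rewrite lt_neqAle st'.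
have t0 : 0 < t by exact: le_lt_trans st'.
have t1 : t < 1 by exact: le_lt_trans z1.
have t01 : 0 < t < 1 by rewrite t0.
have Hc v : normc v <= t -> harnack_rate t <= complex.Re (h1 v) - normc (g1 v).
  move=> vt; apply: le_trans (jacobian_rate _); last exact: le_lt_trans t1.
  by apply: harnack_rate_decr => //; exact: normc_ge0.
have := strongly_monotone Ha Hb Hh Hh1 Hg Hg1 t01 Hc (z := P t) (w := P s).
rewrite !Pn// ?(ltW t0)// => /(_ (lexx _) st).
have -> : P t - P s = (t - s)%:C * e by rewrite /P rmorphB; ring.
rewrite normcM ne mulr1 normc_real ger0_norm ?subr_ge0//.
rewrite conjcM conjc_realE [X in _ <= complex.Re X -> _]mulrCA ReZ.
have -> : complex.Re ((h (P t) + (g (P t))^* - (h (P s) + (g (P s))^*)) * e^*)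
   = D t - D s by rewrite mulrBl ReB.
rewrite expr2 mulrA mulrC ler_pM2l ?subr_gt0// => h2.
by have := growth_tangent s0 (ltW t0); lra.
Qed.

End Pair.
End ClassP.

(** * The boundary of the image *)

Section Boundary.
Variable R : realType.
Local Notation C := (R[i]).
Implicit Types (z w v : cplx R).

Lemma nbhs_normcP (A : set (cplx R)) v :
  nbhs v A <-> exists2 e : R, 0 < e & forall w, normc (w - v) < e -> A w.
Proof.
split=> [/nbhs_ballP[eps /= eps0 H]|[e e0 H]].
  have /complex_realP[x xE] := gtr0_real eps0; subst eps.
  exists x; first by move: eps0; rewrite ltcR.
  move=> w wv; apply: H; rewrite /ball/= -ltcR in wv *.
  by rewrite normc_distC in wv.
apply/nbhs_ballP; exists e%:C => /=; first by rewrite ltcR.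
move=> w; rewrite /ball/= => wv; apply: H.
by rewrite normc_distC -ltcR.
Qed.

Lemma growth1 (alpha : R) : growth alpha 1 = 1 + 2 * (1 - alpha) * (ln 2 - 1).
Proof. by rewrite /growth; have -> : 1 + 1 = 2 :> R by []; ring. Qed.

Section Pair.
Variables (a b : nat -> C) (h h1 g g1 : C -> C) (alpha : R).
Hypotheses (Ha : coef_geometric a) (Hb : coef_geometric b).
Hypotheses (Hh : sums_to a h) (Hh1 : sums_to (dcoef a) h1).
Hypotheses (Hg : sums_to b g) (Hg1 : sums_to (dcoef b) g1).
Hypotheses (a0 : a 0%N = 0) (a1 : a 1%N = 1) (b0 : b 0%N = 0) (b1 : b 1%N = 0).
Hypothesis alpha01 : 0 <= alpha < 1.
Hypothesis Hpos : forall z, normc z < 1 ->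
  normc (g1 z) <= complex.Re (h1 z) - alpha.

Let f : cplx R -> cplx R := fun z => h z + (g z)^*.

(** If [|v| < growth 1], points of the image close to [v] have preimages in a
    fixed smaller disk by [growth_le]; openness with uniform constants there puts
    a neighbourhood of [v] inside the image. *)
Lemma boundary_normc_ge v : boundary (f @` disk 1) v -> growth alpha 1 <= normc v.
Proof.
case=> clv; rewrite leNgt; apply: contra_notN => vL.
pose gap := growth alpha 1 - normc v.
have gap0 : 0 < gap by rewrite subr_gt0.
have [al0 al1] := andP alpha01.
have G1 : growth alpha 1 <= 1.
  have := growth_tangent alpha01 (lexx 0) (@ler01 R).
  rewrite /harnack_rate {2}/growth !addr0 subr0 ln1 divr1; lra.
have nv := normc_ge0 v.
(* [growth] has slope at most 1, so [growth r0] still exceeds [|v|]. *)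
pose r0 := 1 - gap / 2.
have r00 : 0 <= r0 by rewrite /r0 /gap; lra.
have r01 : r0 < 1 by rewrite /r0; lra.
have Gr0 : normc v + gap / 2 <= growth alpha r0.
  have := growth_tangent alpha01 r00 (@ler01 R).
  have : harnack_rate alpha r0 <= 1.
    have := harnack_rate_decr alpha01 (lexx 0) r00.
    by rewrite {2}/harnack_rate addr0 subr0 divr1; lra.
  move=> /(ler_wpM2r (x := 1 - r0)); rewrite subr_ge0 (ltW r01) => /(_ isT).
  by rewrite /r0 /gap; lra.
pose rho := (1 + r0) / 2.
have rho01 : 0 < rho < 1 by rewrite /rho; lra.
have r0r : r0 < rho by rewrite /rho; lra.
have [rho0 rho1] := andP rho01.
have Hc w : normc w <= rho ->
    harnack_rate alpha rho <= complex.Re (h1 w) - normc (g1 w).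
  move=> wr; apply: le_trans (jacobian_rate Ha Hb Hh1 Hg1 a1 b1 Hpos _); last first.
    exact: le_lt_trans rho1.
  by apply: harnack_rate_decr => //; exact: normc_ge0.
have c0 : 0 < harnack_rate alpha rho by apply: harnack_rate_gt0 => //; exact: ltW.
have [eta eta0 Heta] := uniformly_open Ha Hb Hh Hh1 Hg Hg1 rho01 r0r c0 Hc.
pose e := Num.min (eta / 2) (gap / 2).
have e0 : 0 < e by rewrite /e lt_min !divr_gt0.
have /clv[_ [[z z1 <-] fz]] : nbhs v [set w | normc (w - v) < e].
  by apply/nbhs_normcP; exists e.
have {fz}[fz1 fz2] : normc (f z - v) < eta / 2 /\ normc (f z - v) < gap / 2.
  by move: fz; rewrite /= /e lt_min => /andP.
have zr0 : normc z <= r0.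
  rewrite leNgt; apply/negP => r0z.
  have := growth_le Ha Hb Hh Hh1 Hg Hg1 a0 a1 b0 b1 alpha01 Hpos z1.
  have := growth_homo alpha01 r00 (ltW r0z) (ltW z1).
  have := le_normc_dist (f z) v; rewrite -/(f z).
  by move: fz2; lra.
apply/nbhs_normcP; exists (eta / 2); first by rewrite divr_gt0.
move=> w wv; have [|z' z'1 fz'] := Heta z w zr0.
  have -> : w - (h z + (g z)^*) = (w - v) - (f z - v) by rewrite /f; ring.
  by apply: le_trans (normcB _ _) _; lra.
by exists z'.
Qed.

End Pair.
End Boundary.

(** * Rotation invariance of plane measure *)

Section PlaneMeasure.
Variable R : realType.
Local Notation mu := (@lebesgue_measure R).
Local Notation plane := (measurableTypeR R * measurableTypeR R)%type.
Local Notation mu2 := (@lebesgue_measure R \x @lebesgue_measure R)%E.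
Implicit Types (A : set plane).

Lemma lebesgue_measure_translate (c : R) (A : set (measurableTypeR R)) :
  measurable A -> mu ((fun x => x + c) @^-1` A) = mu A.
Proof.
move=> mA.
have mT : measurable_fun setT
    ((fun x => x + c) : measurableTypeR R -> measurableTypeR R).
  by apply: measurable_funD => //; exact: measurable_cst.
have := @lebesgue_measure_unique R
  (pushforward mu ((fun x => x + c) : measurableTypeR R -> measurableTypeR R)).
move=> H; rewrite [RHS]H// => _ [[x y] _ <-].
rewrite /pushforward/=.
rewrite [X in _ = lebesgue_measure X](_ : _ = `](x - c), (y - c)]%classic);
    last first.
  by apply/seteqP; split=> z /=; rewrite !in_itv/= ltrBlDr lerBrDr.
rewrite !lebesgue_measure_itv/= !lte_fin ltrD2r.
by case: ifP => // _; congr EFin; ring.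
Qed.

Definition shear_x (t : R) (u : plane) : plane := (u.1 + t * u.2, u.2).
Definition shear_y (t : R) (u : plane) : plane := (u.1, u.2 + t * u.1).

Lemma measurable_shear_x t : measurable_fun setT (shear_x t).
Proof.
apply/measurable_fun_pairP; split; last exact: measurable_snd.
apply: measurable_funD; first exact: measurable_fst.
by apply: measurable_funM; [exact: measurable_cst|exact: measurable_snd].
Qed.

Lemma measurable_shear_y t : measurable_fun setT (shear_y t).
Proof.
apply/measurable_fun_pairP; split; first exact: measurable_fst.
apply: measurable_funD; first exact: measurable_snd.
by apply: measurable_funM; [exact: measurable_cst|exact: measurable_fst].
Qed.

Lemma measure_shear_y t A : measurable A -> mu2 (shear_y t @^-1` A) = mu2 A.
Proof.
move=> mA; apply: eq_integral => x _ /=.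
have -> : xsection (shear_y t @^-1` A) x = (fun y => y + t * x) @^-1` xsection A x.
  by apply/seteqP; split=> y; rewrite /xsection/= !inE.
by rewrite lebesgue_measure_translate//; exact: measurable_xsection.
Qed.

Lemma measure_shear_x t A : measurable A -> mu2 (shear_x t @^-1` A) = mu2 A.
Proof.
move=> mA.
have E B : measurable B -> mu2 B = (mu \x^ mu)%E B.
  by apply: product_measure_unique => *; exact: product_measure2E.
rewrite !E//; last first.
  by rewrite -[X in measurable X]setTI; exact: measurable_shear_x.
apply: eq_integral => x _ /=.
have -> : ysection (shear_x t @^-1` A) x = (fun y => y + t * x) @^-1` ysection A x.
  by apply/seteqP; split=> y; rewrite /ysection/= !inE.
by rewrite lebesgue_measure_translate//; exact: measurable_ysection.
Qed.

Definition rotation (c s : R) (u : plane) : plane :=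
  (c * u.1 - s * u.2, s * u.1 + c * u.2).

(** The parameter [s / (1 + c)] is the tangent of half the angle. *)
Lemma rotation_shears c s : c ^+ 2 + s ^+ 2 = 1 -> 1 + c != 0 ->
  rotation c s = shear_x (- (s / (1 + c))) \o shear_y s \o shear_x (- (s / (1 + c))).
Proof.
move=> cs c1; apply/funext => -[x y].
rewrite /rotation /shear_x /shear_y/=.
have E : s * (s / (1 + c)) = 1 - c.
  rewrite mulrA -expr2 (_ : s ^+ 2 = (1 - c) * (1 + c)) ?mulfK//.
  by move: cs => /(congr1 (fun z => z - c ^+ 2)); rewrite addrC addKr => ->; ring.
have E2 : s / (1 + c) * (1 + c) = s by rewrite divfK.
set t := s / (1 + c) in E E2 *.
have -> : y + s * (x + - t * y) = s * x + c * y.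
  have -> : c = 1 - s * t by rewrite E; ring.
  by ring.
congr pair.
have -> : c * x - s * y = (1 - s * t) * x - (t * (1 + c)) * y.
  by rewrite E E2; ring.
by ring.
Qed.

Lemma measurable_rotation c s : measurable_fun setT (rotation c s).
Proof.
apply/measurable_fun_pairP; split.
  by apply: measurable_funB; apply: measurable_funM => //; exact: measurable_cst.
by apply: measurable_funD; apply: measurable_funM => //; exact: measurable_cst.
Qed.

(** Shears preserve the measure by Fubini and translation invariance on the
    line. *)
Lemma measure_rotation c s A : c ^+ 2 + s ^+ 2 = 1 -> 1 + c != 0 ->
  measurable A -> mu2 (rotation c s @^-1` A) = mu2 A.
Proof.
move=> cs c1 mA; rewrite rotation_shears// !comp_preimage.
have mx t B : measurable B -> measurable (shear_x t @^-1` B).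
  by move=> mB; rewrite -[X in measurable X]setTI; exact: measurable_shear_x.
have my t B : measurable B -> measurable (shear_y t @^-1` B).
  by move=> mB; rewrite -[X in measurable X]setTI; exact: measurable_shear_y.
by rewrite measure_shear_x ?measure_shear_y ?measure_shear_x//; do ?[exact: mx|exact: my]; apply: my; exact: mx.
Qed.

Lemma integral_rotation c s A (F : plane -> \bar R) :
    c ^+ 2 + s ^+ 2 = 1 -> 1 + c != 0 -> measurable A ->
    measurable_fun A F -> (forall u, A u -> 0 <= F u)%E ->
    rotation c s @^-1` A = A ->
  (\int[mu2]_(u in A) F (rotation c s u) = \int[mu2]_(u in A) F u)%E.
Proof.
move=> cs c1 mA mF F0 rA.
have := @ge0_integral_pushforward _ _ plane plane R _ (measurable_rotation c s)
  mu2 A F mA mF.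
rewrite rA => <-; last by move=> u; rewrite inE; exact: F0.
apply: eq_measure_integral => [|mr B mB _]; first exact: measurable_rotation.
exact: measure_rotation.
Qed.

End PlaneMeasure.

(** * Area of disks and annuli *)

Section DiskArea.
Variable R : realType.
Local Notation mu := (@lebesgue_measure R).
Local Notation plane := (measurableTypeR R * measurableTypeR R)%type.
Local Notation mu2 := (@lebesgue_measure R \x @lebesgue_measure R)%E.
Implicit Types (A B : set plane) (r t x y : R).

Lemma sin_increment x y : 0 <= x -> x <= y -> y <= pi ->
  cos y * (y - x) <= sin y - sin x <= cos x * (y - x).
Proof.
move=> x0; rewrite le_eqVlt => /orP[/eqP->|xy] ypi.
  by rewrite !subrr !mulr0 lexx.
have [|c /andP[xc cy] ->] := @MVT R sin cos x y xy (fun z _ => is_derive_sin z).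
  by apply: continuous_subspaceT => z; exact: continuous_sin.
have h (u v : R) : 0 <= u -> u <= v -> v <= pi -> cos v <= cos u.
  move=> u0; rewrite le_eqVlt => /orP[/eqP->//|uv] vpi; apply: ltW.
  have v0 : 0 <= v by exact: le_trans (ltW uv).
  have upi : u <= pi by exact: le_trans (ltW uv) vpi.
  by rewrite ltr_cos// in_itv/= ?u0 ?v0.
have yx : 0 <= y - x by rewrite subr_ge0 ltW.
have c0 : 0 <= c by apply: le_trans x0 (ltW xc).
by rewrite !ler_wpM2r// h// ltW// (lt_le_trans cy).
Qed.

Definition norm2 (u : plane) : R := u.1 ^+ 2 + u.2 ^+ 2.

Lemma measurable_norm2 : measurable_fun setT norm2.
Proof. by apply: measurable_funD; apply: measurable_funX. Qed.

(** Indexed by the squared radius, the variable in which areas are linear. *)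
Definition disc t : set plane := [set u | norm2 u < t].

Lemma measurable_disc t : measurable (disc t).
Proof.
rewrite (_ : disc t = norm2 @^-1` `]-oo, t[).
  rewrite -[X in measurable X]setTI.
  by apply: measurable_norm2 => //; exact: measurable_itv.
by apply/seteqP; split=> u /=; rewrite in_itv.
Qed.

Lemma measurable_strip (i : interval R) : measurable [set u : plane | u.1 \in i].
Proof.
rewrite (_ : [set _ | _] = [set` i] `*` setT).
  by apply: measurableX; [exact: measurable_itv|exact: measurableT].
by apply/seteqP; split=> u //= [].
Qed.

Lemma measurable_box (i j : interval R) :
  measurable [set u : plane | u.1 \in i /\ u.2 \in j].
Proof.
rewrite (_ : [set _ | _] = [set` i] `*` [set` j])//.
by apply: measurableX; exact: measurable_itv.
Qed.

Lemma measure_box (i j : interval R) :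
  mu2 [set u : plane | u.1 \in i /\ u.2 \in j] =
  (mu [set` i] * mu [set` j])%E.
Proof. by rewrite -product_measure1E. Qed.

Lemma measure_disc_fin t A : measurable A -> A `<=` disc t ->
  mu2 A \is a fin_num.
Proof.
move=> mA At; rewrite ge0_fin_numE//.
pose i : interval R := `](- (`|t| + 1)), (`|t| + 1)[.
apply: (@le_lt_trans _ _ (mu2 [set u : plane | u.1 \in i /\ u.2 \in i])).
  apply: le_measure; rewrite ?inE//.
    exact: measurable_box.
  move=> u /At; rewrite /disc/norm2/= => ut.
  have key z : z ^+ 2 < t -> z \in i.
    move=> zt; rewrite in_itv/= -ltr_norml.
    rewrite -(@ltr_pXn2r _ 2)// ?nnegrE ?addr_ge0//.
    rewrite real_normK ?num_real//; apply: (lt_le_trans zt).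
    have := ler_norm t; have := sqr_ge0 `|t|; have := normr_ge0 t.
    by rewrite sqrrD expr1n mulr1; lra.
  have := sqr_ge0 u.1; have := sqr_ge0 u.2.
  by move=> h1 h2; split; apply: key; lra.
rewrite measure_box lebesgue_measure_itv/= lte_fin.
by case: ifP => _; rewrite ?mul0e ?ltry// -EFinB -EFinM ltry.
Qed.

Lemma fine_measureU t A B : measurable A -> measurable B ->
    A `<=` disc t -> B `<=` disc t -> A `&` B = set0 ->
  fine (mu2 (A `|` B)) = fine (mu2 A) + fine (mu2 B).
Proof.
move=> mA mB At Bt AB; rewrite measureU// fineD//.
  exact: measure_disc_fin At.
exact: measure_disc_fin Bt.
Qed.

Lemma fine_measure_itv x y (b1 b2 : bool) : x <= y ->
  mu [set` Interval (BSide b1 x) (BSide b2 y)] = (y - x)%:E.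
Proof.
move=> xy; rewrite lebesgue_measure_itv/= lte_fin.
case: ltP => // yx; congr EFin; lra.
Qed.

Lemma sandwich_difference (c1 c2 d b1 b2 g1 g2 : R) :
  c1 * d <= b1 - b2 <= c2 * d -> c1 * d <= g1 - g2 <= c2 * d ->
  - ((- c1 - - c2) * d) <= b1 - g1 - (b2 - g2).
Proof. lra. Qed.

(** In the parameter [x = r sin th] the strip between two abscissas lies between
    two boxes; their areas enclose the increments of
    [r^2 (th + sin th cos th)], whose derivative is [2 r^2 (cos th)^2]. *)
Lemma measure_half_disc r : 0 < r ->
  fine (mu2 (disc (r ^+ 2) `&` [set u : plane | u.1 \in `[0, +oo[])) =
  pi / 2 * r ^+ 2.
Proof.
move=> r0; have pi0 := @pi_gt0 R.
have pihalf : pi / 2 <= pi :> R by lra.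
pose S (x y : R) := disc (r ^+ 2) `&` [set u : plane | u.1 \in `[x, y[].
have mS x y : measurable (S x y).
  by apply: measurableI; [exact: measurable_disc|exact: measurable_strip].
have Sd x y : S x y `<=` disc (r ^+ 2) by move=> u [].
pose B th := fine (mu2 (S 0 (r * sin th))).
pose G th := r ^+ 2 * (th + sin (th *+ 2) / 2).
have trig_mono (a b : R) : 0 <= a -> a <= b -> b <= pi / 2 ->
    [/\ 0 <= sin a, sin a <= sin b, 0 <= cos b & cos b <= cos a].
  move=> a0 ab b2; have [b0 apih] : 0 <= b /\ a <= pi / 2 by lra.
  have cb : 0 <= cos b by apply: cos_ge0_pihalf; lra.
  have ca : 0 <= cos a by apply: cos_ge0_pihalf; lra.
  have sa : 0 <= sin a by apply: sin_ge0_pi; lra.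
  have bpi : b <= pi by exact: le_trans pihalf.
  have /andP[h1 h2] := sin_increment a0 ab bpi.
  have sab : sin a <= sin b.
    by rewrite -subr_ge0; apply: le_trans h1; rewrite mulr_ge0// subr_ge0.
  split=> //; rewrite -(@ler_pXn2r _ 2)// ?nnegrE// !cos2sin2.
  by rewrite lerD2l lerN2 lerXn2r ?nnegrE// (le_trans sa).
have incB (a b : R) : 0 <= a -> a <= b -> b <= pi / 2 ->
    r ^+ 2 * ((sin b - sin a) * (2 * cos b)) <= B b - B a <=
    r ^+ 2 * ((sin b - sin a) * (2 * cos a)).
  move=> a0 ab b2; have [sa sab cb cba] := trig_mono _ _ a0 ab b2.
  have ca : 0 <= cos a by exact: le_trans cba.
  have -> : B b - B a = fine (mu2 (S (r * sin a) (r * sin b))).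
    rewrite /B (_ : S 0 (r * sin b) = S 0 (r * sin a) `|` S (r * sin a) (r * sin b)).
      have disj : S 0 (r * sin a) `&` S (r * sin a) (r * sin b) = set0.
        apply/seteqP; split=> [u|u []//]; move=> [] [_ h1] [_ h2].
        move: h1 h2; rewrite /= !in_itv/= => /andP[_ h1] /andP[h2 _].
        by move: h1; rewrite ltNge h2.
      rewrite (fine_measureU (mS _ _) (mS _ _) (@Sd _ _) (@Sd _ _) disj).
      by rewrite [X in X - _]addrC addrK.
    have sra : 0 <= r * sin a by rewrite mulr_ge0// ltW.
    have srab : r * sin a <= r * sin b by rewrite ler_wpM2l// ltW.
    apply/seteqP; split=> u /=; rewrite /S/= !in_itv/=.
      move=> [du /andP[u0 ub]]; have [ua|ua] := ltP u.1 (r * sin a).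
        by left; split=> //; rewrite u0.
      by right; split=> //; rewrite ub.
    move=> [[du /andP[u0 ua]]|[du /andP[ua ub]]]; split=> //; apply/andP; split=> //.
      exact: lt_le_trans ua srab.
    exact: le_trans ua.
  have fS := measure_disc_fin (mS (r * sin a) (r * sin b)) (@Sd _ _).
  pose J (c : R) : interval R := `](- (r * c)), (r * c)[.
  pose box c := [set u : plane | (u.1 \in `[r * sin a, r * sin b[) /\ u.2 \in J c].
  have mbox c : measurable (box c) by exact: measurable_box.
  have vbox c : 0 <= c -> mu2 (box c) =
      (r ^+ 2 * ((sin b - sin a) * (2 * c)))%:E.
    move=> c0; rewrite measure_box.
    rewrite !fine_measure_itv; last 2 first.
      by rewrite -subr_ge0 opprK addr_ge0 ?mulr_ge0// ltW.
      by rewrite ler_wpM2l// ltW.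
    by rewrite -EFinM; congr EFin; ring.
  have Hsq (c : R) (u : plane) : 0 <= c -> u.2 ^+ 2 < (r * c) ^+ 2 <->
      u.2 \in J c.
    move=> c0; rewrite in_itv/= -ltr_norml -(real_normK (num_real u.2)).
    by rewrite ltr_pXn2r// nnegrE ?mulr_ge0// ltW.
  apply/andP; split.
    rewrite -lee_fin (fineK fS) -(vbox _ cb); apply: le_measure.
    - by rewrite inE; exact: mbox.
    - by rewrite inE; exact: mS.
    move=> u [u1 /Hsq-/(_ cb) u2]; split=> //; rewrite /disc/norm2/=.
    move: u1; rewrite in_itv/= => /andP[u1 u1'].
    have : u.1 ^+ 2 <= (r * sin b) ^+ 2.
      have u10 : 0 <= u.1 by apply: le_trans u1; rewrite mulr_ge0// ltW.
      by rewrite lerXn2r ?nnegrE// ?(ltW u1')// (le_trans u10 (ltW u1')).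
    have := cos2Dsin2 b; move: u2; rewrite !exprMn => h1 h2 h3.
    have -> : r ^+ 2 = r ^+ 2 * (cos b ^+ 2 + sin b ^+ 2) by rewrite h2 mulr1.
    lra.
  rewrite -lee_fin (fineK fS) -(vbox _ ca); apply: le_measure.
  - by rewrite inE; exact: mS.
  - by rewrite inE; exact: mbox.
  move=> u [du]; rewrite /= => u1; split=> //; apply/Hsq => //.
  move: u1; rewrite in_itv/= => /andP[u1 u1'].
  have : (r * sin a) ^+ 2 <= u.1 ^+ 2.
    have h : 0 <= r * sin a by rewrite mulr_ge0// ltW.
    by rewrite lerXn2r ?nnegrE// (le_trans h).
  have := cos2Dsin2 a; move: du; rewrite /disc/norm2/= !exprMn => h1 h2 h3.
  have e : r ^+ 2 = r ^+ 2 * (cos a ^+ 2 + sin a ^+ 2) by rewrite h2 mulr1.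
  by rewrite {1}e in h1; lra.
have r20 : 0 <= r ^+ 2 by rewrite sqr_ge0.
have incB' (a b : R) : 0 <= a -> a <= b -> b <= pi / 2 ->
    2 * r ^+ 2 * cos b ^+ 2 * (b - a) <= B b - B a <=
    2 * r ^+ 2 * cos a ^+ 2 * (b - a).
  move=> a0 ab b2; have [sa sab cb cba] := trig_mono _ _ a0 ab b2.
  have ca : 0 <= cos a by exact: le_trans cba.
  have /andP[h1 h2] := incB _ _ a0 ab b2.
  have bpi : b <= pi by exact: le_trans pihalf.
  have /andP[h3 h4] := sin_increment a0 ab bpi.
  have e c : 2 * r ^+ 2 * c ^+ 2 * (b - a) = r ^+ 2 * (c * (b - a) * (2 * c)).
    by ring.
  rewrite !e; apply/andP; split; [apply: le_trans h1|apply: le_trans h2 _].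
    by rewrite ler_wpM2l// ler_wpM2r// mulr_ge0.
  by rewrite ler_wpM2l// ler_wpM2r// mulr_ge0.
have incG (a b : R) : 0 <= a -> a <= b -> b <= pi / 2 ->
    2 * r ^+ 2 * cos b ^+ 2 * (b - a) <= G b - G a <=
    2 * r ^+ 2 * cos a ^+ 2 * (b - a).
  move=> a0 ab b2.
  have a20 : 0 <= a *+ 2 by rewrite mulrn_wge0.
  have ab2 : a *+ 2 <= b *+ 2 by rewrite lerMn2r.
  have b2pi : b *+ 2 <= pi by rewrite -mulr_natl; lra.
  have /andP[] := sin_increment a20 ab2 b2pi.
  have cE x : cos (x *+ 2) = 2 * cos x ^+ 2 - 1 by rewrite cos_mulr2n mulr_natl.
  rewrite !cE -mulrnBl -(mulr_natl (b - a) 2) /G => h1 h2.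
  by have := ler_wpM2l r20 h1; have := ler_wpM2l r20 h2; lra.
have E0 : B 0 = 0.
  rewrite /B sin0 mulr0 (_ : S 0 0 = set0) ?measure0//.
  by apply/seteqP; split=> u //= [_]; rewrite /= in_itv/=; lra.
have piH : 0 <= pi / 2 :> R by lra.
have -> : disc (r ^+ 2) `&` [set u : plane | u.1 \in `[0, +oo[] = S 0 (r * sin (pi / 2)).
  rewrite sin_pihalf mulr1; apply/seteqP; split=> u /= [du]; rewrite /S/= !in_itv/=.
    rewrite andbT => u0; split=> //; rewrite u0/=.
    rewrite -(@ltr_pXn2r _ 2)// ?nnegrE ?(ltW r0)//.
    by move: du; rewrite /disc/norm2/=; have := sqr_ge0 u.2; lra.
  by move=> /andP[-> _].
rewrite -/(B (pi / 2)).
have GE : G (pi / 2) - G 0 = pi / 2 * r ^+ 2.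
  have p2 : (pi / 2) *+ 2 = pi :> R by rewrite -(mulr_natr (pi / 2) 2) divfK.
  by rewrite /G mul0rn sin0 p2 sinpi; ring.
have D1 := @subdivision_le R (fun th => B th - G th)
  (fun th => - (2 * r ^+ 2 * cos th ^+ 2)) 0 (pi / 2) piH.
have D2 := @subdivision_le R (fun th => G th - B th)
  (fun th => - (2 * r ^+ 2 * cos th ^+ 2)) 0 (pi / 2) piH.
have {}D1 : B 0 - G 0 <= B (pi / 2) - G (pi / 2).
  apply: D1 => s t s0 st t2.
  exact: sandwich_difference (incB' _ _ s0 st t2) (incG _ _ s0 st t2).
have {}D2 : G 0 - B 0 <= G (pi / 2) - B (pi / 2).
  apply: D2 => s t s0 st t2.
  exact: sandwich_difference (incG _ _ s0 st t2) (incB' _ _ s0 st t2).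
clear -D1 D2 E0 GE.
by move: E0 GE D1 D2; move: (B 0) (B _) (G 0) (G _) => ? ? ? ?; lra.
Qed.

End DiskArea.

Section PlaneDiscs.
Variable R : realType.
Local Notation mu := (@lebesgue_measure R).
Local Notation plane := (measurableTypeR R * measurableTypeR R)%type.
Local Notation mu2 := (@lebesgue_measure R \x @lebesgue_measure R)%E.
Implicit Types (A B : set plane) (r t x y : R).

(** Two quarter turns exchange the left and right half planes, and the axis
    between them is a null set. *)
Lemma measure_centrally_symmetric A : measurable A -> mu2 A \is a fin_num ->
    (forall u, A (- u.1, - u.2) <-> A u) ->
  mu2 A = (2 * fine (mu2 (A `&` [set u : plane | u.1 \in `[0, +oo[])))%:E.
Proof.
move=> mA fA symA.
set P := A `&` _.
pose N := A `&` [set u : plane | u.1 \in `]-oo, 0[].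
pose L := A `&` [set u : plane | u.1 \in `[0, 0]].
pose Q := A `&` [set u : plane | u.1 \in `]0, +oo[].
have mP : measurable P by apply: measurableI => //; exact: measurable_strip.
have mN : measurable N by apply: measurableI => //; exact: measurable_strip.
have mL : measurable L by apply: measurableI => //; exact: measurable_strip.
have mQ : measurable Q by apply: measurableI => //; exact: measurable_strip.
have AE : A = P `|` N.
  apply/seteqP; split=> u.
    move=> Au; have [u0|u0] := leP 0 u.1; [left|right]; (split; first exact: Au).
      by rewrite /= in_itv/= u0.
    by rewrite /= in_itv.
  by move=> [] [].
have PN : P `&` N = set0.
  apply/seteqP; split=> [u|u []]; move=> -[] [_ +] [_ +].
  by rewrite /= !in_itv/= andbT ltNge => ->.
have PQ : P = Q `|` L.
  apply/seteqP; split=> u; last first.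
    move=> [] [Au]; rewrite /= in_itv/= => /andP[h _]; split.
    - exact: Au.
    - by rewrite /= in_itv/= (ltW h).
    - exact: Au.
    - by rewrite /= in_itv/= h.
  move=> [Au]; rewrite /= in_itv/= andbT => u0.
  have [u1|u1] := eqVneq u.1 0; [right|left]; (split; first exact: Au).
    by rewrite /= in_itv/= u1 lexx.
  by rewrite /= in_itv/= lt_neqAle eq_sym u1 u0.
have QL : Q `&` L = set0.
  apply/seteqP; split=> [u|u []]; move=> -[] [_ +] [_ +].
  by rewrite /= !in_itv/= andbT [u.1 <= 0]leNgt => ->; rewrite andbF.
have L0 : mu2 L = 0%E.
  apply/le_anti; rewrite measure_ge0 andbT.
  apply: (@le_trans _ _ (mu2
      [set u : plane | (u.1 \in `[0, 0]) /\ (u.2 \in `]-oo, +oo[)])).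
    apply: le_measure; rewrite ?inE//; first exact: measurable_box.
    by move=> u [].
  by rewrite measure_box lebesgue_measure_itv/= ltxx mul0e.
have QN : mu2 Q = mu2 N.
  have r01 : (0 : R) ^+ 2 + 1 ^+ 2 = 1 by rewrite expr0n expr1n add0r.
  have nz : 1 + 0 != 0 :> R by rewrite addr0 oner_eq0.
  rewrite -[RHS](measure_rotation r01 nz mN) -[RHS](measure_rotation r01 nz);
    last first.
    by rewrite -[X in measurable X]setTI; exact: measurable_rotation.
  have rr u : rotation 0 1 (rotation 0 1 u) = (- u.1, - u.2) :> plane.
    by rewrite /rotation/=; congr pair; ring.
  rewrite (_ : rotation 0 1 @^-1` _ = [set u | N (- u.1, - u.2)]); last first.
    by apply/funext => u; congr N; exact: rr.
  congr (mu2 _); apply/seteqP; split=> u.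
    move=> [Au]; rewrite /= in_itv/= andbT => h; split; first exact/symA.
    by rewrite /= in_itv/= oppr_lt0.
  move=> [] /symA Au; rewrite /= in_itv/= oppr_lt0 => h; split; first exact: Au.
  by rewrite /= in_itv/= h.
have sub B : measurable B -> B `<=` A -> mu2 B \is a fin_num.
  move=> mB BA; rewrite ge0_fin_numE//.
  apply: (@le_lt_trans _ _ (mu2 A)); first by apply: le_measure; rewrite ?inE.
  by rewrite -ge0_fin_numE.
have fP : mu2 P \is a fin_num by apply: sub => // u [].
have PQL : mu2 P = (mu2 Q + mu2 L)%E.
  by rewrite {1}PQ; exact: (measureU _ mQ mL QL).
have NP : mu2 N = mu2 P.
  by rewrite PQL L0 adde0 QN.
have -> : mu2 A = (mu2 P + mu2 N)%E.
  by rewrite {1}AE; exact: (measureU _ mP mN PN).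
by rewrite NP -(fineK fP) -EFinD/= mulr_natl mulr2n.
Qed.

Lemma measure_disc r : 0 < r -> mu2 (disc (r ^+ 2)) = (pi * r ^+ 2)%:E.
Proof.
move=> r0; have mD := @measurable_disc R (r ^+ 2).
rewrite measure_centrally_symmetric//; last 2 first.
- exact: (@measure_disc_fin _ (r ^+ 2) _ mD).
- by move=> u; rewrite /disc /norm2/= !sqrrN.
by rewrite measure_half_disc//; congr EFin; field.
Qed.

Definition annulus s t : set plane := [set u | s <= norm2 u < t].

Lemma measurable_annulus s t : measurable (annulus s t).
Proof.
rewrite (_ : annulus s t = @norm2 R @^-1` `[s, t[).
  rewrite -[X in measurable X]setTI.
  by apply: measurable_norm2 => //; exact: measurable_itv.
by apply/seteqP; split=> u /=; rewrite in_itv.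
Qed.

Lemma measure_annulus s t : 0 <= s -> s <= t ->
  mu2 (annulus s t) = (pi * (t - s))%:E.
Proof.
have D0 : disc 0 = set0 :> set plane.
  apply/seteqP; split=> u //=; rewrite /disc/norm2/=.
  by have := sqr_ge0 u.1; have := sqr_ge0 u.2; lra.
have Dx x : 0 <= x -> mu2 (disc x) = (pi * x)%:E.
  rewrite le_eqVlt => /orP[/eqP <-|x0]; first by rewrite D0 measure0 mulr0.
  by rewrite -(sqr_sqrtr (ltW x0)) measure_disc// sqrtr_gt0.
move=> s0 st; have t0 : 0 <= t by exact: le_trans st.
have mA := @measurable_annulus s t; have mD := @measurable_disc R s.
have DE : disc t = disc s `|` annulus s t.
  apply/seteqP; split=> u; rewrite /disc/annulus/=.
    by move=> ut; have [us|us] := ltP (norm2 u) s; [left|right; apply/andP].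
  by move=> [us|/andP[]//]; exact: lt_le_trans st.
have DA : disc s `&` annulus s t = set0.
  apply/seteqP; split=> [u|u []]; rewrite /disc/annulus/= => -[h /andP[]].
  by rewrite leNgt h.
have fA : mu2 (annulus s t) \is a fin_num.
  by apply: (@measure_disc_fin R t _ mA) => u /andP[].
have E : mu2 (disc t) = (mu2 (disc s) + mu2 (annulus s t))%E.
  by rewrite {1}DE; exact: (measureU _ mD mA DA).
move: E; rewrite (Dx _ t0) (Dx _ s0) -(fineK fA) -EFinD => -[] E.
by congr EFin; rewrite mulrBr E [X in X - _]addrC addrK.
Qed.

End PlaneDiscs.

(** * Replacing an integrand by its rotation average *)

Section RotationAverage.
Variable R : realType.
Local Notation mu := (@lebesgue_measure R).
Local Notation plane := (measurableTypeR R * measurableTypeR R)%type.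
Local Notation mu2 := (@lebesgue_measure R \x @lebesgue_measure R)%E.
Implicit Types (A : set plane) (J : plane -> R).

Definition cplx_of (u : plane) : R[i] := u.1 +i* u.2.

Definition rotate N : plane -> plane :=
  rotation (cos (2 * pi / N%:R)) (sin (2 * pi / N%:R)).

Lemma cplx_of_rotate N j u :
  cplx_of (iter j (rotate N) u) = root_of_unity R N ^+ j * cplx_of u.
Proof.
elim: j => [|j IH]; first by rewrite expr0 mul1r.
rewrite iterS exprS -mulrA -IH; case: (iter _ _ _) => x y.
rewrite /cplx_of/= /root_of_unity; apply/eqP; rewrite eq_complex/=.
by apply/andP; split; apply/eqP; ring.
Qed.

Lemma sqr_normc_cplx_of u : normc (cplx_of u) ^+ 2 = norm2 u.
Proof. by rewrite sqr_normcE. Qed.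

Lemma norm2_rotate N u : norm2 (rotate N u) = norm2 u.
Proof.
rewrite -!sqr_normc_cplx_of -[rotate N u]/(iter 1 (rotate N) u) cplx_of_rotate.
by rewrite expr1 normcM normc_root_of_unity mul1r.
Qed.

Lemma one_plus_cos_neq0 N : (2 < N)%N -> 1 + cos (2 * pi / N%:R) != 0 :> R.
Proof.
move=> N2; have := @root_of_unity_exp_neq1 R N 2; rewrite N2 => /(_ isT).
apply: contra => /eqP E.
have c1 : cos (2 * pi / N%:R) = - 1 :> R by move: E; lra.
have s0 : sin (2 * pi / N%:R) = 0 :> R.
  apply/eqP; rewrite -sqrf_eq0; have := cos2Dsin2 (2 * pi / N%:R : R).
  by rewrite c1 sqrrN expr1n => h; apply/eqP; lra.
by rewrite /root_of_unity c1 s0 expr2 eq_complex/= !mulr0 !mul0r subr0 addr0 mulrNN mulr1 !eqxx.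
Qed.

Lemma integral_iter_rotate N j A J : (2 < N)%N -> measurable A ->
    (forall u, A (rotate N u) <-> A u) ->
    measurable_fun A J -> (forall u, A u -> 0 <= J u) ->
  measurable_fun A (fun u => J (iter j (rotate N) u)) /\
  (\int[mu2]_(u in A) (J (iter j (rotate N) u))%:E =
   \int[mu2]_(u in A) (J u)%:E)%E.
Proof.
move=> N2 mA rA mJ J0; elim: j => [|j [IH1 IH2]]; first by split.
have AE : rotate N @^-1` A = A by apply/seteqP; split=> u /=; rewrite rA.
have itA k u : A u -> A (iter k (rotate N) u).
  by move=> Au; elim: k => [//|k IH]; rewrite iterS rA.
split.
  under eq_fun do rewrite iterSr.
  apply: (@measurable_comp _ _ _ _ _ _ A (fun u => J (iter j (rotate N) u))
    A (rotate N)) => //.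
    by move=> _ [u Au <-]; rewrite rA.
  by apply: measurable_funS (measurable_rotation _ _).
rewrite -IH2.
have := @integral_rotation R (cos (2 * pi / N%:R)) (sin (2 * pi / N%:R)) A
  (fun u => (J (iter j (rotate N) u))%:E) (cos2Dsin2 _) (one_plus_cos_neq0 N2) mA.
move=> H; rewrite -H//.
- by apply: eq_integral => u _; rewrite iterSr.
- exact/measurable_EFinP.
- by move=> u Au; rewrite /= lee_fin J0//; exact: itA.
Qed.

(** The integrals of [J] over [A] and of its rotated copies agree, so bounds on the
    sum of the copies bound the integral. *)
Lemma rotation_average N A J (m : R) : (2 < N)%N -> measurable A ->
    (forall u, A (rotate N u) <-> A u) -> mu2 A = m%:E ->
    measurable_fun A J -> (forall u, A u -> 0 <= J u) ->
  [/\ forall U, (forall u, A u -> \sum_(j < N) J (iter j (rotate N) u) <= N%:R * U) ->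
        (\int[mu2]_(u in A) (J u)%:E <= (U * m)%:E)%E &
      forall L, (forall u, A u -> N%:R * L <= \sum_(j < N) J (iter j (rotate N) u)) ->
        ((L * m)%:E <= \int[mu2]_(u in A) (J u)%:E)%E].
Proof.
move=> N2 mA rA Am mJ J0; set I := (\int[mu2]_(u in A) (J u)%:E)%E.
have N0 : 0 < N%:R :> R by rewrite ltr0n (ltn_trans _ N2).
have N0e : (0 < N%:R%:E :> \bar R)%E by rewrite lte_fin.
have itA k u : A u -> A (iter k (rotate N) u).
  by move=> Au; elim: k => [//|k IH]; rewrite iterS rA.
have m0 : 0 <= m by rewrite -lee_fin -Am measure_ge0.
have mJj (j : 'I_N) : measurable_fun A (fun u => J (iter j (rotate N) u)).
  by have [] := integral_iter_rotate j N2 mA rA mJ J0.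
have I0 : (0 <= I)%E by apply: integral_ge0 => u Au; rewrite lee_fin J0.
have mS : measurable_fun A (fun u => \sum_(j < N) J (iter j (rotate N) u)).
  by apply: measurable_sum => j; exact: mJj.
have key : (N%:R%:E * I = \int[mu2]_(u in A)
    (\sum_(j < N) J (iter j (rotate N) u))%:E)%E.
  under eq_integral do rewrite -sumEFin.
  rewrite ge0_integral_sum//.
  - rewrite (eq_bigr (fun=> I)); last first.
      by move=> j _; have [_ ->] := integral_iter_rotate j N2 mA rA mJ J0.
    by rewrite mule_natl big_const_ord iter_addr_0.
  - by move=> j; apply/measurable_EFinP; exact: mJj.
  - by move=> j u Au; rewrite lee_fin J0//; exact: itA.
have S0 u : A u -> 0 <= \sum_(j < N) J (iter j (rotate N) u).
  by move=> Au; apply: sumr_ge0 => j _; apply: J0; exact: itA.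
split=> [U HU|L HL].
  rewrite -(lee_pmul2l (x := N%:R%:E) _ N0e)//.
  rewrite key -EFinM mulrA EFinM -Am -integral_cst//.
  by apply: ge0_le_integral => //; exact/measurable_EFinP.
apply: (@le_trans _ _ (Num.max L 0 * m)%:E).
  by rewrite lee_fin ler_wpM2r// le_max lexx.
rewrite -(lee_pmul2l (x := N%:R%:E) _ N0e)//.
rewrite key -EFinM mulrA EFinM -Am -integral_cst//.
apply: ge0_le_integral => //.
- by move=> u Au; rewrite /= lee_fin mulr_ge0 ?(ltW N0)// le_max lexx orbT.
- exact/measurable_EFinP.
move=> u Au; rewrite /= lee_fin; have [L0|L0] := leP 0 L; first by rewrite HL.
by rewrite mulr0 S0.
Qed.

End RotationAverage.

(** * Area integrals of power series *)

Section AreaOfSeries.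
Variable R : realType.
Local Notation C := (R[i]).
Local Notation plane := (measurableTypeR R * measurableTypeR R)%type.
Local Notation mu2 := (@lebesgue_measure R \x @lebesgue_measure R)%E.
Implicit Types (p q : nat -> C) (f : C -> C) (s t x rho : R) (A : set plane).

Lemma measurable_cplx_power n :
  measurable_fun setT (fun u : plane => complex.Re (cplx_of u ^+ n)) /\
  measurable_fun setT (fun u : plane => complex.Im (cplx_of u ^+ n)).
Proof.
elim: n => [|n [IH1 IH2]].
  by split; under eq_fun do rewrite expr0; exact: measurable_cst.
split.
  rewrite (_ : (fun u => _) = (fun u : plane => u.1 * complex.Re (cplx_of u ^+ n)
     - u.2 * complex.Im (cplx_of u ^+ n))).
    by apply: measurable_funB; apply: measurable_funM.
  by apply/funext => u; rewrite exprS ReM.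
rewrite (_ : (fun u => _) = (fun u : plane => u.1 * complex.Im (cplx_of u ^+ n)
   + u.2 * complex.Re (cplx_of u ^+ n))).
  by apply: measurable_funD; apply: measurable_funM.
by apply/funext => u; rewrite exprS ImM.
Qed.

Lemma measurable_sqr_psum p n :
  measurable_fun setT (fun u : plane => normc (psum p n (cplx_of u)) ^+ 2).
Proof.
under eq_fun do rewrite sqr_normcE /psum Re_sum Im_sum.
apply: measurable_funD; apply: measurable_funX; apply: measurable_sum => k.
  under eq_fun do rewrite ReM.
  have [mr mi] := measurable_cplx_power k.
  by apply: measurable_funB; apply: measurable_funM => //; exact: measurable_cst.
under eq_fun do rewrite ImM.
have [mr mi] := measurable_cplx_power k.
by apply: measurable_funD; apply: measurable_funM => //; exact: measurable_cst.
Qed.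

Lemma sqr_psum_close p f rho : sums_to p f -> 0 <= rho < 1 ->
  exists K r, [/\ 0 <= K, 0 <= r < 1 & forall z n, normc z <= rho ->
    `|normc (f z) ^+ 2 - normc (psum p n z) ^+ 2| <= K * r ^+ n].
Proof.
move=> Hf r01; have [K [q [K0 q01 H]]] := Hf rho r01.
have [B B0 HB] := sums_to_bound Hf r01; have [q0 q1] := andP q01.
exists (K * (B + (B + K))), q; split=> //; first by rewrite mulr_ge0 ?addr_ge0.
move=> z n zr; have h1 := H z n zr; have h2 := HB z zr.
have Kq : K * q ^+ n <= K by rewrite ler_piMr// exprn_ile1// ltW.
have h3 : normc (psum p n z) <= B + K.
  have := le_normc_dist (psum p n z) (f z); rewrite normc_distC; lra.
rewrite subr_sqr normrM mulrAC; apply: ler_pM => //.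
  apply: le_trans h1; rewrite ler_norml; apply/andP; split.
    by rewrite lerNl opprB normc_distC le_normc_dist.
  exact: le_normc_dist.
by rewrite ger0_norm ?addr_ge0 ?normc_ge0// lerD.
Qed.

Section Pair.
Variables (p q : nat -> C) (h1 g1 : C -> C).
Hypotheses (Hh1 : sums_to p h1) (Hg1 : sums_to q g1).
Hypothesis Hpos : forall z, normc z < 1 -> normc (g1 z) <= normc (h1 z).

Let J (u : plane) : R :=
  normc (h1 (cplx_of u)) ^+ 2 - normc (g1 (cplx_of u)) ^+ 2.
Let Jn n (u : plane) : R :=
  normc (psum p n (cplx_of u)) ^+ 2 - normc (psum q n (cplx_of u)) ^+ 2.

(** The mean over the circle of squared radius [x] of the Jacobian, with both
    series truncated. *)
Definition radial_mean n x : R :=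
  \sum_(k < n) (normc (p k) ^+ 2 - normc (q k) ^+ 2) * x ^+ k.

Lemma normc_cplx_of_lt (u : plane) rho : 0 <= rho ->
  (normc (cplx_of u) < rho) = (norm2 u < rho ^+ 2).
Proof.
move=> r0; rewrite -sqr_normc_cplx_of ltr_pXn2r// ?nnegrE//.
exact: normc_ge0.
Qed.

Lemma Jn_close rho : 0 <= rho < 1 -> exists K r, [/\ 0 <= K, 0 <= r < 1 &
  forall u n, normc (cplx_of u) <= rho -> `|J u - Jn n u| <= K * r ^+ n].
Proof.
move=> r01; have [K [a [K0 /andP[a0 a1] H]]] := sqr_psum_close Hh1 r01.
have [K' [a' [K'0 /andP[a'0 a'1] H']]] := sqr_psum_close Hg1 r01.
exists (K + K'), (Num.max a a'); split; first exact: addr_ge0.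
  by rewrite le_max a0/= gt_max a1.
move=> u n ur; rewrite /J /Jn.
set X := normc (h1 _) ^+ 2; set Y := normc (g1 _) ^+ 2.
set X' := normc (psum p _ _) ^+ 2; set Y' := normc (psum q _ _) ^+ 2.
have -> : X - Y - (X' - Y') = (X - X') - (Y - Y') by ring.
apply: le_trans (ler_normB _ _) _; rewrite mulrDl; apply: lerD.
  apply: le_trans (H _ n ur) _; rewrite ler_wpM2l//.
  by apply: lerXn2r; rewrite ?nnegrE ?le_max ?a0 ?lexx.
apply: le_trans (H' _ n ur) _; rewrite ler_wpM2l//.
by apply: lerXn2r; rewrite ?nnegrE ?le_max ?a0 ?a'0 ?lexx ?orbT.
Qed.

Lemma measurable_J A : A `<=` @disc R 1 -> measurable_fun A J.
Proof.
move=> A1; apply: (@measurable_fun_cvg _ _ _ _ Jn).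
  move=> n; apply: (@measurable_funS _ _ _ _ setT) => //.
  by apply: measurable_funB; exact: measurable_sqr_psum.
move=> u /A1; rewrite /disc/= -(expr1n _ 2) -normc_cplx_of_lt// => u1.
have [|K [r [K0 r01 H]]] := @Jn_close (normc (cplx_of u)).
  by rewrite normc_ge0.
apply/cvgrPdist_le => e e0; have [n0 Hn0] := geometric_small K r01 e0.
exists n0 => // n /= n0n.
exact: le_trans (H u n (lexx _)) (Hn0 n n0n).
Qed.

Lemma J_ge0 (u : plane) : disc 1 u -> 0 <= J u.
Proof.
rewrite /disc/= -(expr1n _ 2) -normc_cplx_of_lt// => /Hpos gh.
by rewrite subr_ge0 lerXn2r ?nnegrE ?normc_ge0.
Qed.

Lemma sum_Jn_rotate n N u : (n <= N)%N ->
  \sum_(j < N) Jn n (iter j (rotate N) u) = N%:R * radial_mean n (norm2 u).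
Proof.
move=> nN; rewrite /Jn sumrB.
under eq_bigr do rewrite cplx_of_rotate.
under [X in _ - X]eq_bigr do rewrite cplx_of_rotate.
rewrite !parseval_root_of_unity// -mulrBr -sumrB; congr (_ * _).
by apply: eq_bigr => k _; rewrite sqr_normc_cplx_of mulrBl.
Qed.

(** At least [n] rotations are needed for orthogonality, and at least three to
    exclude the half turn, which the decomposition into shears does not reach. *)
Lemma sum_J_rotate_close t : 0 <= t < 1 -> exists K r, [/\ 0 <= K, 0 <= r < 1 &
  forall n u, norm2 u < t ->
  `|\sum_(j < n + 3) J (iter j (rotate (n + 3)) u)
    - (n + 3)%:R * radial_mean n (norm2 u)| <= (n + 3)%:R * (K * r ^+ n)].
Proof.
move=> /andP[t0 t1]; have rt01 : 0 <= Num.sqrt t < 1.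
  by rewrite sqrtr_ge0/= -(sqrtr1 R) ltr_sqrt.
have [K [r [K0 r01 H]]] := Jn_close rt01.
exists K, r; split=> // n u ut.
have iu j : normc (cplx_of (iter j (rotate (n + 3)) u)) <= Num.sqrt t.
  rewrite cplx_of_rotate normcM normcX normc_root_of_unity expr1n mul1r ltW//.
  by rewrite normc_cplx_of_lt ?sqrtr_ge0// sqr_sqrtr.
rewrite -sum_Jn_rotate ?leq_addr// -sumrB.
apply: le_trans (ler_norm_sum _ _ _) _.
apply: (@le_trans _ _ (\sum_(j < n + 3) K * r ^+ n)).
  by apply: ler_sum => j _; exact: H.
by rewrite sumr_const card_ord mulr_natl.
Qed.

Let area_integral A := (\int[mu2]_(u in A) (J u)%:E)%E.

Let annulus_sub s t : t < 1 -> annulus s t `<=` @disc R 1.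
Proof. by move=> t1 u /andP[_ ut]; exact: lt_trans t1. Qed.

Let annulus_rotate N s t (u : plane) : annulus s t (rotate N u) <-> annulus s t u.
Proof. by rewrite /annulus/= norm2_rotate. Qed.

Lemma area_annulus_le s t (c : R) : 0 <= s -> s <= t -> t < 1 ->
    (forall n u, annulus s t u -> radial_mean n (norm2 u) <= c) ->
  (area_integral (annulus s t) <= (c * (pi * (t - s)))%:E)%E.
Proof.
move=> s0 st t1 Hc; have t01 : 0 <= t < 1 by rewrite t1 (le_trans s0).
have [K [r [K0 r01 H]]] := sum_J_rotate_close t01.
have J0 u : annulus s t u -> 0 <= J u by move=> /(annulus_sub t1); exact: J_ge0.
have key n : (area_integral (annulus s t) <=
    ((c + K * r ^+ n) * (pi * (t - s)))%:E)%E.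
  have n3 : (2 < n + 3)%N by rewrite addnS ltnS leq_addl.
  have [up _] := rotation_average n3 (@measurable_annulus R s t)
    (@annulus_rotate (n + 3) s t) (measure_annulus s0 st)
    (measurable_J (annulus_sub t1)) J0.
  apply: up => u Au; have := H n u (proj2 (andP Au)).
  have := Hc n u Au; rewrite -(ler_pM2l (x := (n + 3)%:R)) ?ltr0n ?addn_gt0 ?orbT//.
  by rewrite ler_norml mulrDr => h2 /andP[_ h3]; lra.
have I0 : (0 <= area_integral (annulus s t))%E.
  by apply: integral_ge0 => u Au; rewrite lee_fin J0.
have fI : area_integral (annulus s t) \is a fin_num.
  by rewrite ge0_fin_numE// (le_lt_trans (key 0%N))// ltry.
rewrite -(fineK fI) lee_fin -subr_le0.
apply: (@geometric_le0 _ (K * (pi * (t - s))) r) => // n.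
have := key n; rewrite -(fineK fI) lee_fin mulrDl; lra.
Qed.

Lemma area_annulus_ge s t (c K : R) r : 0 <= s -> s <= t -> t < 1 ->
    0 <= r < 1 ->
    (forall n u, annulus s t u -> c - K * r ^+ n <= radial_mean n (norm2 u)) ->
  ((c * (pi * (t - s)))%:E <= area_integral (annulus s t))%E.
Proof.
move=> s0 st t1 r01 Hc; have t01 : 0 <= t < 1 by rewrite t1 (le_trans s0).
have [K' [r' [K'0 r'01 H]]] := sum_J_rotate_close t01.
have J0 u : annulus s t u -> 0 <= J u by move=> /(annulus_sub t1); exact: J_ge0.
have key n : (((c - K * r ^+ n - K' * r' ^+ n) * (pi * (t - s)))%:E <=
    area_integral (annulus s t))%E.
  have n3 : (2 < n + 3)%N by rewrite addnS ltnS leq_addl.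
  have [_ low] := rotation_average n3 (@measurable_annulus R s t)
    (@annulus_rotate (n + 3) s t) (measure_annulus s0 st)
    (measurable_J (annulus_sub t1)) J0.
  apply: low => u Au; have := H n u (proj2 (andP Au)).
  have h2 := ler_wpM2l (ler0n R (n + 3)) (Hc n u Au).
  rewrite ler_norml => /andP[h3 _].
  by move: h2 h3; rewrite !mulrBr; lra.
have I0 : (0 <= area_integral (annulus s t))%E.
  by apply: integral_ge0 => u Au; rewrite lee_fin J0.
case: (area_integral _) I0 key => [x||//] I0 key; last by rewrite leey.
rewrite lee_fin -subr_le0.
have m0 : 0 <= pi * (t - s) by rewrite mulr_ge0 ?pi_ge0 ?subr_ge0.
apply: (@geometric2_le0 _ _ r _ r' _ (mulr_ge0 (normr_ge0 K) m0)
  (mulr_ge0 K'0 m0)) => // n.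
have := key n; rewrite lee_fin !mulrBl.
have [q0 _] := andP r01.
have : K * r ^+ n * (pi * (t - s)) <= `|K| * (pi * (t - s)) * r ^+ n.
  rewrite mulrAC; apply: ler_wpM2r; first exact: exprn_ge0.
  by apply: ler_wpM2r => //; exact: ler_norm.
lra.
Qed.

Lemma area_disc_split s t : 0 <= s -> s <= t -> t < 1 ->
  (area_integral (disc t) = area_integral (disc s) + area_integral (annulus s t))%E.
Proof.
move=> s0 st t1.
have DE : disc t = disc s `|` annulus s t :> set plane.
  apply/seteqP; split=> u; rewrite /disc/annulus/=.
    by move=> ut; have [us|us] := ltP (norm2 u) s; [left|right; apply/andP].
  by move=> [us|/andP[]//]; exact: lt_le_trans st.
have sub : disc t `<=` @disc R 1 by move=> u ut; exact: lt_trans t1.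
rewrite /area_integral DE ge0_integral_setU//.
- exact: measurable_disc.
- exact: measurable_annulus.
- by apply/measurable_EFinP; apply: measurable_J; rewrite -DE.
- by move=> u; rewrite -DE => /sub ud; rewrite lee_fin J_ge0.
- rewrite disj_set2E; apply/eqP/seteqP; split=> [u|u []].
  by rewrite /disc/annulus/= => -[h /andP[]]; rewrite leNgt h.
Qed.

Definition disc_area t : R := fine (area_integral (disc t)).

Lemma area_disc_fin t : 0 <= t < 1 -> area_integral (disc t) \is a fin_num.
Proof.
move=> /andP[t0 t1].
have sub : disc t `<=` @disc R 1 by move=> u ut; exact: lt_trans t1.
have rt01 : 0 <= Num.sqrt t < 1.
  by rewrite sqrtr_ge0/= -(sqrtr1 R) ltr_sqrt.
have [B B0 HB] := sums_to_bound Hh1 rt01.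
have I0 : (0 <= area_integral (disc t))%E.
  by apply: integral_ge0 => u Au; rewrite lee_fin J_ge0//; exact: sub.
have mD := @measurable_disc R t.
rewrite ge0_fin_numE//.
apply: (@le_lt_trans _ _ (\int[mu2]_(u in disc t) (cst (B ^+ 2)%:E u))%E).
  apply: ge0_le_integral => //.
  - by move=> u Au; rewrite lee_fin J_ge0//; exact: sub.
  - by apply/measurable_EFinP; exact: measurable_J.
  move=> u ut; rewrite lee_fin /J.
  have : normc (h1 (cplx_of u)) <= B.
    apply: HB; rewrite ltW// normc_cplx_of_lt ?sqrtr_ge0// sqr_sqrtr//.
  move=> hB; have : normc (h1 (cplx_of u)) ^+ 2 <= B ^+ 2.
    by rewrite lerXn2r ?nnegrE ?normc_ge0.
  by have := sqr_ge0 (normc (g1 (cplx_of u))); lra.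
have fD : (mu2 (disc t) < +oo)%E.
  by rewrite -ge0_fin_numE//; exact: (measure_disc_fin mD (fun u h => h)).
rewrite integral_cst//; apply: lte_mul_pinfty => //.
by rewrite lee_fin sqr_ge0.
Qed.

Lemma disc_area_split s t : 0 <= s -> s <= t -> t < 1 ->
  disc_area t - disc_area s = fine (area_integral (annulus s t)) /\
  area_integral (annulus s t) \is a fin_num.
Proof.
move=> s0 st t1.
have ft : area_integral (disc t) \is a fin_num.
  by apply: area_disc_fin; rewrite t1 (le_trans s0).
have fs : area_integral (disc s) \is a fin_num.
  by apply: area_disc_fin; rewrite s0 (le_lt_trans st).
have E := area_disc_split s0 st t1.
have fa : area_integral (annulus s t) \is a fin_num.
  by move: ft; rewrite E fin_numD => /andP[].
by split=> //; rewrite /disc_area E fineD// [X in X - _]addrC addrK.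
Qed.

Lemma disc_area0 : disc_area 0 = 0.
Proof.
rewrite /disc_area (_ : disc 0 = set0); first by rewrite /area_integral integral_set0.
apply/seteqP; split=> [u|u []]; rewrite /disc /norm2/=.
by have := sqr_ge0 u.1; have := sqr_ge0 u.2; lra.
Qed.

(** [Psi] is a primitive of [psi]: on each thin annulus the area grows by at most
    [pi psi y (y - x)]. *)
Lemma disc_area_le t (Psi psi : R -> R) : 0 <= t < 1 -> Psi 0 = 0 ->
    (forall x y, 0 <= x -> x <= y -> y <= t ->
       psi x * (y - x) <= Psi y - Psi x) ->
    (forall x y n u, 0 <= x -> x <= y -> y <= t -> annulus x y u ->
       radial_mean n (norm2 u) <= psi y) ->
  disc_area t <= pi * Psi t.
Proof.
move=> /andP[t0 t1] P0 HP Hpsi.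
have pi0 := pi_ge0 R.
have := @subdivision_le R (fun x => pi * Psi x - disc_area x) (fun x => pi * psi x) 0 t t0.
rewrite P0 mulr0 disc_area0 subrr subr_ge0; apply=> x y x0 xy yt.
have y1 : y < 1 by exact: le_lt_trans t1.
have [E fa] := disc_area_split x0 xy y1.
have := area_annulus_le x0 xy y1 (fun n u => Hpsi x y n u x0 xy yt).
rewrite -(fineK fa) lee_fin -E => h.
by have := ler_wpM2l pi0 (HP _ _ x0 xy yt); lra.
Qed.

Lemma disc_area_ge t (Psi psi : R -> R) (K : R) r : 0 <= t < 1 -> Psi 0 = 0 ->
    0 <= r < 1 ->
    (forall x y, 0 <= x -> x <= y -> y <= t ->
       Psi y - Psi x <= psi y * (y - x)) ->
    (forall x y n u, 0 <= x -> x <= y -> y <= t -> annulus x y u ->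
       psi x - K * r ^+ n <= radial_mean n (norm2 u)) ->
  pi * Psi t <= disc_area t.
Proof.
move=> /andP[t0 t1] P0 r01 HP Hpsi.
have pi0 := pi_ge0 R.
have := @subdivision_le R (fun x => disc_area x - pi * Psi x) (fun x => pi * psi x) 0 t t0.
rewrite P0 mulr0 disc_area0 subrr subr_ge0; apply=> x y x0 xy yt.
have y1 : y < 1 by exact: le_lt_trans t1.
have [E fa] := disc_area_split x0 xy y1.
have := area_annulus_ge x0 xy y1 r01 (fun n u => Hpsi x y n u x0 xy yt).
rewrite -(fineK fa) lee_fin -E => h.
by have := ler_wpM2l pi0 (HP _ _ x0 xy yt); lra.
Qed.

End Pair.
End AreaOfSeries.

(** * The function that determines the radius *)

Section RadiusFunction.
Variable R : realType.
Implicit Types (x y s t r alpha p : R) (mu lambda : R -> R).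

Lemma ln_tangent s t : s < 1 -> t < 1 ->
  (t - s) / (1 - s) <= ln (1 - s) - ln (1 - t).
Proof.
move=> s1 t1; rewrite -lerN2 opprB -ln_div ?posrE; [|lra|lra].
have -> : (1 - t) / (1 - s) = 1 + - ((t - s) / (1 - s)) by field; lra.
by apply: le_ln1Dx; rewrite ltrN2 ltr_pdivrMr; lra.
Qed.

Lemma expr_increment s t k : 0 <= s -> s <= t ->
  (t - s) * s ^+ k <= (t ^+ k.+1 - s ^+ k.+1) / k.+1%:R <= (t - s) * t ^+ k.
Proof.
move=> s0 st; have t0 : 0 <= t by exact: le_trans st.
rewrite ler_pdivlMr ?ltr0n// ler_pdivrMr ?ltr0n//.
elim: k => [|k /andP[IH1 IH2]]; first by rewrite !expr1 !expr0 !mulr1 lexx.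
have sk : 0 <= s ^+ k by rewrite exprn_ge0.
have tk : 0 <= t ^+ k by rewrite exprn_ge0.
have st0 : 0 <= t - s by rewrite subr_ge0.
have E : t ^+ k.+2 - s ^+ k.+2 = t * (t ^+ k.+1 - s ^+ k.+1) + (t - s) * s ^+ k.+1.
  by rewrite (exprS t k.+1) (exprS s k.+1); ring.
have E' : t ^+ k.+2 - s ^+ k.+2 = s * (t ^+ k.+1 - s ^+ k.+1) + (t - s) * t ^+ k.+1.
  by rewrite (exprS t k.+1) (exprS s k.+1); ring.
have skt : s ^+ k.+1 <= t ^+ k.+1 by rewrite lerXn2r ?nnegrE.
rewrite -[k.+2%:R]natr1; apply/andP; split.
  rewrite E'; have := ler_wpM2l s0 IH1; have := ler_wpM2l st0 skt.
  by rewrite [s ^+ k.+1]exprS; lra.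
rewrite E; have := ler_wpM2l t0 IH2; have := ler_wpM2l st0 skt.
by rewrite [t ^+ k.+1]exprS; lra.
Qed.

Definition log_poly n x : R := \sum_(k < n) x ^+ k.+1 / k.+1%:R.

Lemma log_poly_increment n s t : 0 <= s -> s <= t ->
  (t - s) * \sum_(k < n) s ^+ k <= log_poly n t - log_poly n s <=
  (t - s) * \sum_(k < n) t ^+ k.
Proof.
move=> s0 st; rewrite /log_poly -sumrB !mulr_sumr; apply/andP; split.
  apply: ler_sum => k _; rewrite -mulrBl.
  by have /andP[] := expr_increment k s0 st.
apply: ler_sum => k _; rewrite -mulrBl.
by have /andP[] := expr_increment k s0 st.
Qed.

Lemma geometric_sum x n : x < 1 -> \sum_(k < n) x ^+ k = (1 - x ^+ n) / (1 - x).
Proof.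
move=> x1; have x0 : 1 - x != 0 by rewrite subr_eq0 gt_eqF.
apply: (mulfI x0); rewrite mulrCA divff// mulr1.
by rewrite -opprB mulNr -subrX1 opprB.
Qed.

Lemma log_poly0 n : log_poly n 0 = 0.
Proof. by rewrite /log_poly big1// => k _; rewrite exprS !mul0r. Qed.

(** Compare increments: the derivative of the partial sum is a partial geometric
    sum, that of the logarithm the whole one. *)
Lemma log_poly_close n x : 0 <= x < 1 ->
  0 <= - ln (1 - x) - log_poly n x <= x / (1 - x) * x ^+ n.
Proof.
move=> /andP[x0 x1]; apply/andP; split.
  have := @subdivision_le R (fun t => - ln (1 - t) - log_poly n t)
    (fun t => (1 - t)^-1) 0 x x0.
  rewrite log_poly0 !subr0 ln1 oppr0; apply=> s t s0 st tx.
  have [s1 t1] : s < 1 /\ t < 1 by lra.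
  have /andP[_] := log_poly_increment n s0 st.
  rewrite geometric_sum// => h1; have h2 := ln_tangent s1 t1.
  have h3 : (1 - t ^+ n) / (1 - t) <= (1 - t)^-1.
    rewrite ler_piMl ?invr_ge0 ?subr_ge0 ?(ltW t1)//.
    by rewrite gerBl exprn_ge0// (le_trans s0).
  have ts0 : 0 <= t - s by rewrite subr_ge0.
  by have := ler_wpM2l ts0 h3; lra.
have := @subdivision_le R
  (fun t => log_poly n t - - ln (1 - t) + x ^+ n / (1 - x) * t)
  (fun t => (1 - t)^-1) 0 x x0.
rewrite log_poly0 !subr0 ln1 !oppr0 mulr0 !addr0 => H.
suff : 0 <= log_poly n x - - ln (1 - x) + x ^+ n / (1 - x) * x.
  by rewrite [x / _ * _]mulrAC [x * _]mulrC [_ * x / _]mulrAC; lra.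
apply: H => s t s0 st tx.
have [s1 t1] : s < 1 /\ t < 1 by lra.
have /andP[h1 _] := log_poly_increment n s0 st.
rewrite geometric_sum// in h1; have h2 := ln_tangent t1 s1.
have ts0 : 0 <= t - s by rewrite subr_ge0.
have h3 : s ^+ n / (1 - s) <= x ^+ n / (1 - x).
  have sx : s <= x by exact: le_trans tx.
  apply: ler_pM.
  - exact: exprn_ge0.
  - by rewrite invr_ge0 subr_ge0 ltW.
  - by rewrite lerXn2r ?nnegrE.
  - by rewrite lef_pV2 ?posrE ?subr_gt0// lerD2l lerN2.
have := ler_wpM2l ts0 h3.
have e : (1 - s ^+ n) / (1 - s) = (1 - s)^-1 - s ^+ n / (1 - s).
  by rewrite mulrBl mul1r.
rewrite e in h1.
have e2 : (s - t) / (1 - t) = - ((t - s) / (1 - t)) by rewrite -mulNr opprB.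
by rewrite e2 in h2; lra.
Qed.

Lemma log_poly_cvg x : 0 <= x < 1 -> log_poly n x @[n --> \oo] --> - ln (1 - x).
Proof.
move=> x01; apply/cvgrPdist_le => e e0.
have [n0 Hn0] := geometric_small (x / (1 - x)) x01 e0.
exists n0 => // n /= n0n; have /andP[h1 h2] := log_poly_close n x01.
by rewrite ger0_norm// (le_trans h2)// Hn0.
Qed.

Lemma sum_from2_log_poly n x : (0 < n)%N ->
  \sum_(2 <= k < n.+1) x ^+ k / k%:R = log_poly n x - x.
Proof.
case: n => // n _; rewrite /log_poly big_ord_recl/= expr1 divr1 [RHS]addrC addKr.
rewrite -{1}[2%N]/(0 + 2)%N big_addn big_mkord subSS subn1/=.
by apply: eq_bigr => k _; rewrite /bump/= add1n addn2.
Qed.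

Lemma cvg_sum_from2 x : 0 <= x < 1 ->
  (fun n => \sum_(2 <= k < n) x ^+ k / k%:R) @ \oo --> - ln (1 - x) - x.
Proof.
move=> x01; rewrite -cvg_shiftS.
apply: (@cvg_trans _ ((fun n => log_poly n x - x) @ \oo)); last first.
  by apply: cvgB; [exact: log_poly_cvg|exact: cvg_cst].
apply: near_eq_cvg; exists 1%N => // n /= n0.
by rewrite sum_from2_log_poly.
Qed.

(** The value of [M_ alpha] in the variable [t = r^2], with the series summed. *)
Definition area_bound alpha t : R :=
  t + 4 * (1 - alpha) ^+ 2 * (- ln (1 - t) - t).

(** The derivative of [area_bound]. *)
Definition area_density alpha t : R :=
  1 + 4 * (1 - alpha) ^+ 2 * ((1 - t)^-1 - 1).

Lemma M_E alpha r : 0 <= r < 1 -> M_ alpha r = area_bound alpha (r ^+ 2).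
Proof.
move=> /andP[r0 r1]; rewrite /M_ /area_bound; congr (_ + _ * _).
have r201 : 0 <= r ^+ 2 < 1 by rewrite exprn_ge0//= expr_lt1.
apply/cvg_lim => //; have := cvg_sum_from2 r201.
by under eq_fun do under eq_bigr do rewrite -exprM.
Qed.

Lemma area_bound_increment alpha s t : 0 <= s -> s <= t -> t < 1 ->
  area_density alpha s * (t - s) <= area_bound alpha t - area_bound alpha s <=
  area_density alpha t * (t - s).
Proof.
move=> s0 st t1; have s1 : s < 1 by exact: le_lt_trans t1.
have B0 : 0 <= 4 * (1 - alpha) ^+ 2 by rewrite mulr_ge0 ?sqr_ge0.
have h1 := ler_wpM2l B0 (ln_tangent s1 t1).
have h2 := ler_wpM2l B0 (ln_tangent t1 s1).
have e : (s - t) / (1 - t) = - ((t - s) / (1 - t)) by rewrite -mulNr opprB.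
by rewrite e in h2; rewrite /area_bound /area_density; lra.
Qed.

Lemma area_bound0 alpha : area_bound alpha 0 = 0.
Proof. by rewrite /area_bound !subr0 ln1 oppr0 mulr0 addr0. Qed.

Lemma area_density_gt0 alpha t : 0 <= t < 1 -> 0 < area_density alpha t.
Proof.
move=> /andP[t0 t1]; rewrite /area_density ltr_wpDr//.
apply: mulr_ge0; first by rewrite mulr_ge0 ?sqr_ge0.
have t1' : 0 < 1 - t by rewrite subr_gt0.
by rewrite subr_ge0 -[leLHS]invr1 lef_pV2 ?posrE// gerBl.
Qed.

Lemma area_bound_homo alpha s t : 0 <= s -> s <= t -> t < 1 ->
  area_bound alpha s <= area_bound alpha t.
Proof.
move=> s0 st t1; have /andP[h _] := area_bound_increment alpha s0 st t1.
rewrite -subr_ge0; apply: le_trans h; rewrite mulr_ge0 ?subr_ge0// ltW//.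
by rewrite area_density_gt0// s0 (le_lt_trans st).
Qed.

Lemma area_bound_ge0 alpha t : 0 <= t < 1 -> 0 <= area_bound alpha t.
Proof. by move=> /andP[t0 t1]; rewrite -(area_bound0 alpha) area_bound_homo. Qed.

Section J1.
Variables (alpha p : R) (mu lambda : R -> R).
Hypotheses (alpha01 : 0 <= alpha < 1) (p1 : 1 <= p).
Hypotheses (Hmu : nonneg_increasing mu) (Hlambda : nonneg_increasing lambda).

Lemma M_homo r s : 0 <= r -> r <= s -> s < 1 ->
  0 <= M_ alpha r /\ M_ alpha r <= M_ alpha s.
Proof.
move=> r0 rs s1; have s0 : 0 <= s by exact: le_trans rs.
have s21 : s ^+ 2 < 1 by rewrite expr_lt1.
have r2s2 : r ^+ 2 <= s ^+ 2 by rewrite lerXn2r ?nnegrE.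
rewrite !M_E ?r0 ?s0 ?(le_lt_trans rs)//; split.
  by rewrite area_bound_ge0// sqr_ge0 (le_lt_trans r2s2).
by rewrite area_bound_homo// sqr_ge0.
Qed.

(** Every summand is monotone, and [- (r + ln (1 - r))] has derivative
    [r / (1 - r) >= r], which makes the increase strict. *)
Lemma J1_increment r s : 0 <= r -> r <= s -> s < 1 ->
  2 * (1 - alpha) * (r * (s - r)) <= J1 alpha p mu lambda s - J1 alpha p mu lambda r.
Proof.
move=> r0 rs s1; have s0 : 0 <= s by exact: le_trans rs.
have r1 : r < 1 by exact: le_lt_trans s1.
have [al0 al1] := andP alpha01.
have [M0 Mrs] := M_homo r0 rs s1.
have h1 : r `^ p <= s `^ p.
  by apply: ge0_ler_powR; rewrite ?nnegrE ?(le_trans ler01 p1).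
have h2 : mu (M_ alpha r) <= mu (M_ alpha s) by apply: Hmu.2.
have h3 : lambda (M_ alpha r ^+ 2) <= lambda (M_ alpha s ^+ 2).
  apply: Hlambda.2; first exact: sqr_ge0.
  by rewrite lerXn2r ?nnegrE// (le_trans M0).
have h4 : r * (s - r) <= - (s + ln (1 - s)) + (r + ln (1 - r)).
  have := ln_tangent r1 s1.
  have : (s - r) * (1 + r) <= (s - r) / (1 - r).
    rewrite ler_pdivlMr ?subr_gt0// -mulrA ler_piMr ?subr_ge0//.
    by have := sqr_ge0 r; rewrite expr2; lra.
  lra.
have a0 : 0 <= 2 * (1 - alpha) by lra.
have := ler_wpM2l a0 h4.
rewrite /J1; lra.
Qed.

Lemma J1_le r s : 0 <= r -> r <= s -> s < 1 ->
  J1 alpha p mu lambda r <= J1 alpha p mu lambda s.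
Proof.
move=> r0 rs s1; rewrite -subr_ge0; apply: le_trans (J1_increment r0 rs s1).
have [al0 al1] := andP alpha01.
by rewrite !mulr_ge0 ?subr_ge0// ltW.
Qed.

Lemma J1_lt r s : 0 < r -> r < s -> s < 1 ->
  J1 alpha p mu lambda r < J1 alpha p mu lambda s.
Proof.
move=> r0 rs s1; rewrite -subr_gt0; apply: lt_le_trans (J1_increment (ltW r0) (ltW rs) s1).
have [al0 al1] := andP alpha01.
by rewrite !mulr_gt0 ?subr_gt0.
Qed.

(** Reflection extends a function continuous on the half line to one continuous
    on the whole line. *)
Lemma continuous_comp_norm (f : R -> R) :
  {within `[0, +oo[, continuous f} -> continuous (fun x => f `|x|).
Proof.
move=> /subspace_continuousP fc x; apply/cvgrPdist_le => e e0.
have x0 : `[0, +oo[%classic `|x| by rewrite /= in_itv/= normr_ge0.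
have /cvgrPdist_le/(_ e e0) := fc _ x0.
rewrite /within/= => /nbhs_ballP[d /= d0 Hd].
apply/nbhs_ballP; exists d => //= y; rewrite /ball/= => xy.
apply: Hd; last by rewrite in_itv/= normr_ge0.
by rewrite /ball/=; apply: le_lt_trans xy; exact: ler_dist_dist.
Qed.

(** Intermediate value theorem; the logarithm makes [J1] positive near 1. *)
Lemma J1_root_exists :
  {within `[0, +oo[, continuous mu} -> {within `[0, +oo[, continuous lambda} ->
  J1 alpha p mu lambda 0 < 0 ->
  exists2 r, 0 < r < 1 & J1 alpha p mu lambda r = 0.
Proof.
move=> cmu clam J0; have [al0 al1] := andP alpha01.
have p0 : 0 < p by exact: lt_le_trans p1.
(* At [r1 = 1 - exp (- K)] the term [- 2 (1 - alpha) ln (1 - r1)] is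
   [2 (1 - alpha) K = 1 + 4 (1 - alpha)], enough for the negative terms. *)
pose K := (2 * (1 - alpha))^-1 + 2.
have K0 : 0 < K by rewrite ltr_wpDl ?invr_ge0 ?mulr_ge0 ?subr_ge0 ?(ltW al1).
pose r1 := 1 - expR (- K).
have r1lt : r1 < 1 by rewrite ltrBlDr ltrDl expR_gt0.
have r10 : 0 <= r1 by rewrite subr_ge0 -expR0 ler_expR; lra.
have cpow : {within `[0, +oo[, continuous (fun x => x `^ p)}.
  apply/continuous_within_itvcyP; split.
    move=> x; rewrite in_itv/= andbT => x0.
    apply: differentiable_continuous; apply/derivable1_diffP.
    by apply: derivable_powR; rewrite in_itv/= andbT.
  by rewrite powR0 ?gt_eqF//; exact: powR_cvg0.
(* Agrees with [J1] on [0, 1) and is continuous on both sides of 0. *)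
pose G r := `|r| `^ p - 2 * (1 - alpha) * (r + ln (1 - r))
  + mu `|area_bound alpha (r ^+ 2)| + lambda `|area_bound alpha (r ^+ 2) ^+ 2|
  - 1 - 2 * (1 - alpha) * (ln 2 - 1).
have GE r : 0 <= r < 1 -> G r = J1 alpha p mu lambda r.
  move=> r01; have [r0 rl] := andP r01; rewrite /G /J1 M_E//.
  rewrite ger0_norm// ger0_norm; last first.
    by rewrite area_bound_ge0// sqr_ge0 expr_lt1.
  by rewrite ger0_norm ?sqr_ge0.
have cG : {within `[0, r1], continuous G}.
  apply: continuous_in_subspaceT => r; rewrite inE/= in_itv/= => /andP[r0 rr1].
  have rlt : r < 1 by exact: le_lt_trans r1lt.
  have cid : {for r, continuous (fun x : R => x)} by exact: cvg_id.
  have cln (f : R -> R) : {for r, continuous f} -> 0 < 1 - f r ->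
      {for r, continuous (fun x => ln (1 - f x))}.
    move=> cf f1; apply: (@continuous_comp _ _ _ (fun x => 1 - f x) (@ln R)).
      by apply: cvgB => //; exact: cvg_cst.
    exact: continuous_ln.
  have csq : {for r, continuous (fun x : R => x ^+ 2)} by exact: exprn_continuous.
  have cab : {for r, continuous (fun x => area_bound alpha (x ^+ 2))}.
    rewrite /area_bound; apply: cvgD => //; apply: cvgM; first exact: cvg_cst.
    apply: cvgB => //; apply: cvgN; apply: (cln (fun x => x ^+ 2)) => //.
    by rewrite subr_gt0 expr_lt1.
  rewrite /G; apply: cvgB; last exact: cvg_cst.
  apply: cvgB; last exact: cvg_cst.
  apply: cvgD; last first.
    apply: (@continuous_comp _ _ _ (fun x => area_bound alpha (x ^+ 2) ^+ 2)
      (fun x => lambda `|x|)); last exact: continuous_comp_norm.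
    apply: (@continuous_comp _ _ _ (fun x => area_bound alpha (x ^+ 2))
      (fun x => x ^+ 2)) => //; exact: exprn_continuous.
  apply: cvgD; last first.
    apply: (@continuous_comp _ _ _ (fun x => area_bound alpha (x ^+ 2))
      (fun x => mu `|x|)) => //; exact: continuous_comp_norm.
  apply: cvgB; first exact: (continuous_comp_norm cpow).
  apply: cvgM; first exact: cvg_cst.
  by apply: cvgD => //; apply: (cln id) => //; rewrite subr_gt0.
have G0 : G 0 < 0 by rewrite GE// lexx ltr01.
have G1 : 0 <= G r1.
  have lnr1 : ln (1 - r1) = - K by rewrite /r1 opprB addrC subrK expRK.
  rewrite GE ?r10// /J1 lnr1.
  have := powR_ge0 r1 p.
  have r101 : 0 <= r1 < 1 by rewrite r10.
  have := Hmu.1 _ (proj1 (M_homo r10 (lexx _) r1lt)).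
  have := Hlambda.1 _ (sqr_ge0 (M_ alpha r1)).
  have ln2 : ln 2 <= 1 :> R.
    have := @le_ln1Dx R 1; have -> : 1 + 1 = 2 :> R by [].
    by apply; lra.
  have a0 : 0 <= 2 * (1 - alpha) by lra.
  have E : 2 * (1 - alpha) * K = 1 + 2 * (2 * (1 - alpha)).
    by rewrite /K mulrDr divff ?gt_eqF//; lra.
  have h1 : 2 * (1 - alpha) * r1 <= 2 * (1 - alpha) by rewrite ler_piMr// ltW.
  have h2 : 2 * (1 - alpha) * ln 2 <= 2 * (1 - alpha) by rewrite ler_piMr.
  lra.
have [|r] := IVT r10 cG (v := 0).
  by rewrite ge_min (ltW G0) le_max G1 orbT.
rewrite in_itv/= => /andP[r0 rr1] Gr.
have rlt : r < 1 by exact: le_lt_trans r1lt.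
exists r; last by rewrite -GE ?r0.
rewrite rlt andbT lt_neqAle r0 andbT eq_sym; apply/eqP => rE.
by move: G0; rewrite -[X in G X < _]rE Gr ltxx.
Qed.

End J1.
End RadiusFunction.

(** * From the given expansions to power series *)

Section Expansions.
Variable R : realType.
Local Notation C := (R[i]).
Implicit Types (h g f : cplx R -> cplx R) (a b : nat -> cplx R) (z : cplx R).

Lemma cvg_cplx_normc (u : nat -> cplx R) (l : cplx R) : u @ \oo --> l ->
  (fun n => normc (l - u n)) @ \oo --> 0.
Proof.
move=> /cvgrPdist_le ul; apply/cvgr0Pnorm_le => e e0.
have e0' : 0 < e%:C by rewrite ltcR.
have [n0 _ H] := ul _ e0'; exists n0 => // n /H.
by rewrite /= -normc_norm lecR [X in _ -> X <= _]ger0_norm ?normc_ge0.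
Qed.

Lemma cplx_normc_cvg (u : nat -> cplx R) (l : cplx R) :
  (fun n => normc (l - u n)) @ \oo --> 0 -> u @ \oo --> l.
Proof.
move=> /cvgr0Pnorm_le ul; apply/cvgrPdist_le => /= eps eps0.
have /complex_realP[x xE] := gtr0_real eps0; subst eps.
have x0 : 0 < x by move: eps0; rewrite ltcR.
have [n0 _ H] := ul _ x0; exists n0 => // n /H.
by rewrite /= -normc_norm lecR [X in X <= _ -> _]ger0_norm ?normc_ge0.
Qed.

Lemma sums_to_derive a f f' z : coef_geometric a -> sums_to a f ->
  sums_to (dcoef a) f' -> normc z < 1 -> derivable f z 1 /\ derive1 f z = f' z.
Proof.
move=> Ha Hf Hf' z1; have z0 := normc_ge0 z.
pose rho := (1 + normc z) / 2.
have rho01 : 0 < rho < 1 by rewrite /rho; lra.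
have [M M0 HM] := sums_to_taylor Ha Hf Hf' rho01.
apply: (@taylor_is_derive R f z (f' z) M ((1 - normc z) / 2)).
  by rewrite divr_gt0// subr_gt0.
move=> w wz; apply: HM; first by rewrite /rho; lra.
rewrite -(subrK z w); apply: le_trans (le_normcD _ _) _.
by apply: le_trans (lerD wz (lexx _)) _; rewrite /rho; lra.
Qed.

(** The expansion says nothing about [a 0] and [a 1]; the coefficients of the
    series are 0 and 1 there. *)
Definition h_coef a : nat -> C :=
  fun n => if n == 0%N then 0 else if n == 1%N then 1 else a n.
Definition g_coef b : nat -> C := fun n => if n == 0%N then 0 else b n.

Lemma psum_h_coef a n z :
  psum (h_coef a) n.+2 z = z + \sum_(2 <= k < n.+2) a k * z ^+ k.
Proof.
rewrite /psum !big_ord_recl/= mul0r add0r /bump/= mul1r expr1; congr (_ + _).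
rewrite -{1}[2%N]/(0 + 2)%N big_addn big_mkord subn2/=.
by apply: eq_bigr => k _; rewrite /h_coef/= !add1n addn2.
Qed.

Lemma psum_g_coef b n z :
  psum (g_coef b) n.+1 z = \sum_(1 <= k < n.+1) b k * z ^+ k.
Proof.
rewrite /psum !big_ord_recl/= mul0r add0r.
rewrite -{1}[1%N]/(0 + 1)%N big_addn big_mkord subn1/=.
by apply: eq_bigr => k _; rewrite /g_coef/= /bump/= add1n addn1.
Qed.

Lemma h_expansion_sums a h : h_expansion h a ->
  coef_geometric (h_coef a) /\ sums_to (h_coef a) h.
Proof.
move=> Hh; apply: pointwise_sums_to => z z1.
apply: cvg_trans (cvg_cplx_normc (Hh z z1)).
apply: near_eq_cvg; exists 2%N => // -[|[|n]]//= _.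
by rewrite psum_h_coef.
Qed.

Lemma g_expansion_sums b g : g_expansion g b ->
  coef_geometric (g_coef b) /\ sums_to (g_coef b) g.
Proof.
move=> Hg; apply: pointwise_sums_to => z z1.
apply: cvg_trans (cvg_cplx_normc (Hg z z1)).
apply: near_eq_cvg; exists 1%N => // -[|n]//= _.
by rewrite psum_g_coef.
Qed.

Lemma harmonic_mapE h g : harmonic_map h g = fun z => h z + (g z)^*.
Proof. by []. Qed.

Lemma area_disc_area h g (h1 g1 : C -> C) (r : R) :
    (forall z, normc z < 1 -> derive1 h z = h1 z) ->
    (forall z, normc z < 1 -> derive1 g z = g1 z) -> 0 <= r < 1 ->
  area h g r = disc_area h1 g1 (r ^+ 2).
Proof.
move=> Hh Hg /andP[r0 r1]; rewrite /area /disc_area.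
have -> : [set u : R * R | disk r (u.1 +i* u.2)] = disc (r ^+ 2).
  by apply/seteqP; split=> u; rewrite /disk /disc/= -(normc_cplx_of_lt _ r0).
apply: eq_Rintegral => u; rewrite inE /disc/= -(normc_cplx_of_lt _ r0) => ur.
have u1 : normc (cplx_of u) < 1 by exact: lt_trans r1.
by rewrite /Defs.jacobian Hh// Hg.
Qed.

End Expansions.

Section SeriesBound.
Variable R : realType.
Implicit Types (c : nat -> R) (r B : R).

Lemma nneseries_log B r : 0 <= B -> 0 <= r < 1 ->
  (\sum_(2 <= n <oo) (B / n%:R * r ^+ n)%:E = (B * (- ln (1 - r) - r))%:E)%E.
Proof.
move=> B0 r01; apply/cvg_lim => //.
rewrite (_ : (fun n => _) =
    EFin \o (fun n => B * \sum_(2 <= k < n) r ^+ k / k%:R)).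
  apply: cvg_EFin; first exact: nearW.
  apply: (@cvg_trans _ ((fun n => B * \sum_(2 <= k < n) r ^+ k / k%:R) @ \oo)) => //.
  by apply: cvgM; [exact: cvg_cst|exact: cvg_sum_from2].
apply/funext => n /=; rewrite sumEFin mulr_sumr; congr EFin.
by apply: eq_bigr => k _; rewrite mulrAC mulrA.
Qed.

Lemma nneseries_le_log B c r : (forall n, 0 <= c n) ->
    (forall n, (1 < n)%N -> c n <= B / n%:R) -> 0 <= B -> 0 <= r < 1 ->
  (\sum_(2 <= n <oo) (c n * r ^+ n)%:E <= (B * (- ln (1 - r) - r))%:E)%E.
Proof.
move=> c0 cB B0 r01; have [r0 _] := andP r01.
apply: lime_le.
  by apply: is_cvg_nneseries => n _ _; rewrite lee_fin; apply: mulr_ge0;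
    rewrite ?exprn_ge0.
exists 1%N => // -[|n]//= _; rewrite sumEFin lee_fin.
apply: (@le_trans _ _ (B * \sum_(2 <= k < n.+1) r ^+ k / k%:R)).
  rewrite mulr_sumr [leLHS]big_nat_cond [leRHS]big_nat_cond.
  apply: ler_sum => k /andP[/andP[k2 _] _].
  by rewrite mulrCA [leLHS]mulrC ler_wpM2l ?exprn_ge0// cB.
rewrite ler_wpM2l//; have /andP[h _] := log_poly_close n r01.
case: n h => [_|n h]; last by rewrite sum_from2_log_poly//; lra.
rewrite big_geq//; have := log_poly_close 1 r01.
by rewrite /log_poly big_ord1 expr1 divr1 => /andP[].
Qed.

End SeriesBound.

(** * The Bohr inequality *)

Section Bohr.
Variable R : realType.
Local Notation C := (R[i]).
Variables (alpha p : R) (mu lambda : R -> R).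
Hypotheses (alpha01 : 0 <= alpha < 1) (p1 : 1 <= p).
Hypotheses (Hmu : nonneg_increasing mu) (Hlambda : nonneg_increasing lambda).

(** [|A|^2 - |B|^2 <= (|A| + |B|)^2], and the bounds form a geometric series. *)
Lemma radial_mean_le (a b : nat -> C) n x : 0 <= x < 1 ->
    a 1%N = 1 -> b 1%N = 0 ->
    (forall n, (1 < n)%N -> normc (a n) + normc (b n) <= 2 * (1 - alpha) / n%:R) ->
  radial_mean (dcoef a) (dcoef b) n x <= area_density alpha x.
Proof.
move=> x01 a1 b1 Hab; have [x0 x1] := andP x01.
have [al0 al1] := andP alpha01.
case: n => [|n].
  by rewrite /radial_mean big_ord0 ltW// area_density_gt0.
have d0 : normc (dcoef a 0) ^+ 2 - normc (dcoef b 0) ^+ 2 = 1.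
  by rewrite /dcoef a1 b1 mulr1 mulr0 normc0 normc1 expr1n expr0n subr0.
rewrite /radial_mean big_ord_recl d0 expr0 mulr1 /area_density lerD2l.
apply: (@le_trans _ _ (\sum_(k < n) 4 * (1 - alpha) ^+ 2 * x ^+ k.+1)).
  apply: ler_sum => k _; rewrite !lift0 ler_wpM2r ?exprn_ge0//.
  rewrite !normcM !normc_nat.
  have := Hab k.+2 isT; rewrite ler_pdivlMr ?ltr0n//.
  set A := normc (a _); set B := normc (b _); set N := k.+2%:R => h.
  have [A0 B0] : 0 <= A /\ 0 <= B by rewrite !normc_ge0.
  have N0 : 0 <= N by rewrite ler0n.
  have : ((A + B) * N) ^+ 2 <= (2 * (1 - alpha)) ^+ 2.
    have hb : 0 <= 2 * (1 - alpha) by lra.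
    have hA : 0 <= (A + B) * N by rewrite mulr_ge0// addr_ge0.
    by rewrite lerXn2r ?nnegrE.
  have : 0 <= N ^+ 2 * (2 * B ^+ 2 + 2 * A * B).
    by rewrite mulr_ge0 ?sqr_ge0// addr_ge0 ?mulr_ge0 ?sqr_ge0.
  by rewrite !exprMn; lra.
have B0 : 0 <= 4 * (1 - alpha) ^+ 2 by rewrite mulr_ge0 ?sqr_ge0.
rewrite -mulr_sumr ler_wpM2l//.
have -> : \sum_(k < n) x ^+ k.+1 = \sum_(k < n.+1) x ^+ k - 1.
  by rewrite [in RHS]big_ord_recl expr0 [RHS]addrC addKr.
rewrite geometric_sum// lerD2r ler_piMl ?invr_ge0 ?subr_ge0 ?(ltW x1)//.
by rewrite gerBl exprn_ge0.
Qed.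

Section Member.
Variables (h g : cplx R -> cplx R) (a b : nat -> cplx R).
Hypotheses (Hf : classP0 alpha h g) (Hh : h_expansion h a) (Hg : g_expansion g b).

(** With [r = |z|] the left side is at most [J1 r + growth 1], while the distance
    is at least [growth 1]. *)
Lemma bohr_inequality_le (z : cplx R) : normc z < 1 ->
    J1 alpha p mu lambda (normc z) <= 0 ->
  bohr_inequality p mu lambda h g a b z.
Proof.
move=> z1 J0; have [[_ _ _ Hjac] Hre dg0] := Hf.
have [ga sa] := h_expansion_sums Hh; have [gb sb] := g_expansion_sums Hg.
have [h1 sh1] := exists_sums_to (coef_geometric_dcoef ga).
have [g1 sg1] := exists_sums_to (coef_geometric_dcoef gb).
have dh w : normc w < 1 -> derive1 h w = h1 w.
  by move=> w1; have [] := sums_to_derive ga sa sh1 w1.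
have dg w : normc w < 1 -> derive1 g w = g1 w.
  by move=> w1; have [] := sums_to_derive gb sb sg1 w1.
have a0 : h_coef a 0 = 0 by [].
have a1 : h_coef a 1 = 1 by [].
have b0 : g_coef b 0 = 0 by [].
have b1 : g_coef b 1 = 0.
  have : g1 0 = 0 by rewrite -dg ?normc0.
  by rewrite (sums_to_0 sg1) /dcoef mul1r.
have Hpos w : normc w < 1 -> normc (g1 w) <= complex.Re (h1 w) - alpha.
  move=> w1; rewrite -dh// -dg// -[X in _ - X](Re_real alpha) -ReB ltW//.
  exact: Hre.
have Hgh w : normc w < 1 -> normc (g1 w) <= normc (h1 w).
  move=> w1; have := Hpos w w1; have := Re_le_normc (h1 w).
  by case/andP: alpha01; lra.
have cb := coef_bound ga gb sh1 sg1 a1 b1 Hpos.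
have [al0 al1] := andP alpha01.
have B0 : 0 <= 2 * (1 - alpha) by lra.
set r := normc z; have r01 : 0 <= r < 1 by rewrite normc_ge0.
have [r0 r1] := andP r01.
have r201 : 0 <= r ^+ 2 < 1 by rewrite sqr_ge0 expr_lt1.
have s0 : 0 <= area h g r / pi.
  rewrite divr_ge0 ?pi_ge0// (area_disc_area dh dg r01).
  apply: fine_ge0; apply: integral_ge0 => u ur; rewrite lee_fin.
  by apply: J_ge0 => //; apply: lt_trans ur _; case/andP: r201.
have sM : area h g r / pi <= M_ alpha r.
  rewrite M_E// ler_pdivrMr ?pi_gt0// mulrC (area_disc_area dh dg r01).
  apply: (@disc_area_le _ _ _ _ _ sh1 sg1 Hgh _ _ (area_density alpha)) => //.
  - exact: area_bound0.
  - move=> x y x0 xy yr; have y1 : y < 1 by case/andP: r201 => _; exact: le_lt_trans.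
    by have /andP[] := area_bound_increment alpha x0 xy y1.
  move=> x y n u x0 xy yr /andP[xu uy].
  have y1 : y < 1 by case/andP: r201 => _; exact: le_lt_trans.
  have u0 : 0 <= norm2 u by exact: le_trans xu.
  have u1 : norm2 u < 1 by exact: lt_trans y1.
  apply: le_trans (_ : area_density alpha (norm2 u) <= _).
    by apply: radial_mean_le; rewrite ?u0.
  have B40 : 0 <= 4 * (1 - alpha) ^+ 2 by rewrite mulr_ge0 ?sqr_ge0.
  rewrite /area_density lerD2l ler_wpM2l// lerD2r.
  by rewrite lef_pV2 ?posrE ?subr_gt0// lerD2l lerN2 ltW.
have m1 := Hmu.2 _ _ s0 sM.
have m2 : lambda ((area h g r / pi) ^+ 2) <= lambda (M_ alpha r ^+ 2).
  apply: Hlambda.2; first exact: sqr_ge0.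
  by rewrite lerXn2r ?nnegrE// (le_trans s0).
have sumle : (\sum_(2 <= n <oo) ((normc (a n) + normc (b n)) * r ^+ n)%:E <=
    (2 * (1 - alpha) * (- ln (1 - r) - r))%:E)%E.
  apply: nneseries_le_log => //.
    by move=> n; rewrite addr_ge0 ?normc_ge0.
  by move=> [|[|n]]// n2; exact: (cb n.+2 n2).
rewrite /bohr_inequality; apply: (@le_trans _ _ (growth alpha 1)%:E).
  apply: (@le_trans _ _ ((r `^ p)%:E + (2 * (1 - alpha) * (- ln (1 - r) - r))%:E
      + (mu (M_ alpha r))%:E + (lambda (M_ alpha r ^+ 2))%:E)%E).
    by rewrite !leeD ?lee_fin.
  by rewrite -!EFinD lee_fin growth1; move: J0; rewrite /J1 -/r; lra.
apply: le_ereal_inf_tmp => _ [v Bv <-]; rewrite lee_fin.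
have -> : harmonic_map h g 0 = 0.
  by rewrite harmonic_mapE (sums_to_0 sa) (sums_to_0 sb) a0 b0 -[0]/(0%:C)
    conjc_realE addr0.
rewrite subr0.
exact: (boundary_normc_ge ga gb sa sh1 sb sg1 a0 a1 b0 b1 alpha01 Hpos).
Qed.

End Member.
End Bohr.

(** * The extremal map *)

Section Extremal.
Variable R : realType.
Local Notation C := (R[i]).
Variable alpha : R.
Hypothesis alpha01 : 0 <= alpha < 1.
Implicit Types (z w : C) (s t x rho : R).

Let B : R := 2 * (1 - alpha).

Let B02 : 0 < B <= 2.
Proof. by case/andP: alpha01 => a0 a1; rewrite /B; lra. Qed.

(** The power series of [z + sum_(n >= 2) 2 (1 - alpha) z^n / n]. *)
Definition extremal_coef (n : nat) : R :=
  if n == 0%N then 0 else if n == 1%N then 1 else 2 * (1 - alpha) / n%:R.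

Let a n : C := (extremal_coef n)%:C.

Definition extremal_deriv z : C := 1 + (2 * (1 - alpha))%:C * (z / (1 - z)).

Lemma extremal_coef_geometric : coef_geometric a.
Proof.
have [B0 B2] := andP B02.
apply: coef_geometric_of_bounded => rho /andP[r0 r1]; exists 2 => n.
have h : normc (a n) <= 2.
  rewrite /a normc_real /extremal_coef; case: n => [|[|n]]/=.
  - by rewrite normr0.
  - by rewrite normr1 ler1n.
  rewrite -/B ger0_norm ?divr_ge0 ?(ltW B0)// ler_pdivrMr ?ltr0n//.
  by apply: le_trans B2 _; rewrite ler_peMr// ler1n.
have h2 : rho ^+ n <= 1 by rewrite exprn_ile1// ltW.
apply: le_trans (_ : 2 * 1 <= _); last by rewrite mulr1.
by apply: ler_pM; rewrite ?normc_ge0 ?exprn_ge0// ltW.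
Qed.

Lemma extremal_dcoef n : dcoef a n = (if n == 0%N then 1 else 2 * (1 - alpha))%:C.
Proof.
rewrite /dcoef /a /extremal_coef; case: n => [|n]/=; first by rewrite mulr1.
rewrite -(rmorph_nat (real_complex R)) -rmorphM/=; congr (_%:C).
by rewrite mulrC divfK// pnatr_eq0.
Qed.

Lemma one_minus_neq0 z : normc z < 1 -> 1 - z != 0.
Proof.
by move=> z1; apply/eqP => /eqP; rewrite subr_eq0 => /eqP E;
  move: z1; rewrite -E normc1 ltxx.
Qed.

Lemma extremal_deriv_sums : sums_to (dcoef a) extremal_deriv.
Proof.
have [B0 B2] := andP B02.
move=> rho /andP[r0 r1]; have r1' : 0 < 1 - rho by rewrite subr_gt0.
exists (1 + B / (1 - rho)), rho; split=> //.
- by rewrite addr_ge0// divr_ge0// ltW.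
- by rewrite r0.
move=> z n zr; have z1 : normc z < 1 by exact: le_lt_trans r1.
have nz := one_minus_neq0 z1.
have nu : (normc (1 - z))^-1 <= (1 - rho)^-1.
  have h : 1 - rho <= normc (1 - z).
    by have := le_normc_dist 1 z; rewrite normc1; lra.
  by rewrite lef_pV2// posrE// (lt_le_trans r1').
have BE : normc (2 * (1 - alpha))%:C = B by rewrite normc_real gtr0_norm.
have zn m : normc z ^+ m <= rho ^+ m by rewrite lerXn2r ?nnegrE ?normc_ge0.
case: n => [|n].
  rewrite /psum big_ord0 subr0 expr0 mulr1 /extremal_deriv.
  apply: le_trans (le_normcD _ _) _; rewrite normc1 lerD2l normcM BE.
  rewrite ler_wpM2l ?(ltW B0)// normcM normcV.
  rewrite -[leRHS]mul1r; apply: ler_pM; rewrite ?normc_ge0 ?invr_ge0//.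
    exact: normc_ge0.
  exact: ltW.
have E : psum (dcoef a) n.+1 z =
    1 + (2 * (1 - alpha))%:C * ((z - z ^+ n.+1) / (1 - z)).
  rewrite /psum (sum_ordS n (fun k => dcoef a k * z ^+ k)) extremal_dcoef.
  rewrite expr0 mulr1; congr (_ + _).
  rewrite (eq_bigr (fun k : 'I_n => (2 * (1 - alpha))%:C * (z * z ^+ k))).
    rewrite -!mulr_sumr; congr (_ * _); apply: (mulfI nz).
    rewrite [RHS]mulrCA divff// mulr1 mulrCA -[1 - z]opprB mulNr -subrX1.
    by rewrite exprS; ring.
  by move=> k _; rewrite extremal_dcoef/= exprS.
rewrite E /extremal_deriv.
have -> : 1 + (2 * (1 - alpha))%:C * (z / (1 - z)) -
    (1 + (2 * (1 - alpha))%:C * ((z - z ^+ n.+1) / (1 - z))) =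
    (2 * (1 - alpha))%:C * (z ^+ n.+1 / (1 - z)).
  by move: (2 * (1 - alpha))%:C => c; field.
rewrite normcM BE normcM normcV normcX.
apply: (@le_trans _ _ (B * (rho ^+ n.+1 / (1 - rho)))).
  rewrite ler_wpM2l ?(ltW B0)//; apply: ler_pM; rewrite ?exprn_ge0 ?normc_ge0//.
  by rewrite invr_ge0 normc_ge0.
rewrite mulrA mulrAC ler_wpM2r ?exprn_ge0//.
by rewrite lerDr.
Qed.

(** The shape [alpha + (1 - alpha) (1 + z) / (1 - z)] shows that [f' - alpha]
    maps the disk to the right half plane. *)
Lemma extremal_derivE z : normc z < 1 -> extremal_deriv z =
  alpha%:C + (1 - alpha)%:C * ((1 + z) / (1 - z)).
Proof.
move=> z1; rewrite /extremal_deriv.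
have -> : (2 * (1 - alpha))%:C = 2 * (1 - alpha)%:C.
  by rewrite rmorphM rmorph_nat.
have -> : (1 - alpha)%:C = 1 - alpha%:C by rewrite rmorphB.
by move: (alpha%:C) (one_minus_neq0 z1) => al nz; field.
Qed.

Lemma extremal_deriv_rate z : normc z < 1 ->
  harnack_rate alpha (normc z) <= complex.Re (extremal_deriv z).
Proof.
have [a0 a1] := andP alpha01.
move=> z1; rewrite extremal_derivE// ReD Re_real ReZ lerD2l.
by rewrite ler_wpM2l ?subr_ge0 ?(ltW a1)// Re_cayley_ge.
Qed.

Lemma extremal_deriv_opp t : 0 <= t < 1 ->
  extremal_deriv (- t%:C) = (harnack_rate alpha t)%:C.
Proof.
move=> /andP[t0 t1]; rewrite extremal_derivE; last first.
  by rewrite normcN normc_real ger0_norm.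
have -> : (1 + - t%:C) / (1 - - t%:C) = ((1 - t) / (1 + t))%:C.
  by rewrite rmorphM fmorphV rmorphB rmorphD !rmorph1 opprK.
by rewrite -rmorphM -rmorphD.
Qed.

(** The coefficient bound is an equality, so only the truncation separates the
    mean from [area_density]. *)
Lemma extremal_radial_mean n x : 0 <= x < 1 ->
  radial_mean (dcoef a) (dcoef (fun=> 0)) n.+1 x =
  area_density alpha x - 4 * (1 - alpha) ^+ 2 / (1 - x) * x ^+ n.+1.
Proof.
move=> /andP[x0 x1]; rewrite /radial_mean.
have d0 k : normc (dcoef (fun=> 0 : C) k) ^+ 2 = 0.
  by rewrite /dcoef mulr0 normc0 expr0n.
rewrite (eq_bigr (fun k : 'I_n.+1 =>
   (if (k : nat) == 0%N then 1 else 4 * (1 - alpha) ^+ 2) * x ^+ k)); last first.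
  move=> k _; rewrite d0 subr0 extremal_dcoef normc_real real_normK ?num_real//.
  by case: eqP => _; rewrite ?expr1n// exprMn; congr (_ * _ * _); ring.
rewrite big_ord_recl/= mul1r expr0.
have -> : \sum_(i < n) 4 * (1 - alpha) ^+ 2 * x ^+ bump 0 i =
    4 * (1 - alpha) ^+ 2 * (\sum_(k < n.+1) x ^+ k - 1).
  by rewrite [in RHS]big_ord_recl expr0 [X in _ * (X - _)]addrC addrK mulr_sumr.
have x1' : 1 - x != 0 by rewrite subr_eq0 gt_eqF.
by rewrite geometric_sum// /area_density; field.
Qed.

Variable f : C -> C.
Hypothesis Hf : sums_to a f.

Let a0 : a 0%N = 0. Proof. by []. Qed.
Let a1 : a 1%N = 1. Proof. by []. Qed.

Lemma zero_coef_geometric : coef_geometric (fun=> 0 : C).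
Proof.
by move=> rho r01; exists 0, 0; split=> [||n]; rewrite ?lexx ?ltr01//
  normc0 !mul0r.
Qed.

Lemma zero_sums (b : nat -> C) : (forall n, b n = 0) -> sums_to b (fun=> 0).
Proof.
move=> b0 rho r01; exists 0, 0; split=> [||z n _]; rewrite ?lexx ?ltr01//.
by rewrite /psum big1 ?subrr ?normc0 ?mul0r// => k _; rewrite b0 mul0r.
Qed.

Lemma zero_dcoef n : dcoef (fun=> 0 : C) n = 0.
Proof. by rewrite /dcoef mulr0. Qed.

Let zc := zero_coef_geometric.
Let zs := zero_sums (fun=> erefl 0).
Let zs1 := zero_sums zero_dcoef.

Let Hpos z : normc z < 1 -> normc (0 : C) <= complex.Re (extremal_deriv z) - alpha.
Proof.
move=> z1; rewrite normc0 subr_ge0; apply: le_trans (extremal_deriv_rate z1).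
have [al0 al1] := andP alpha01; have nz := normc_ge0 z.
rewrite /harnack_rate lerDl mulr_ge0 ?divr_ge0//; lra.
Qed.

Lemma extremal_derive z : normc z < 1 ->
  derivable (f : cplx R -> cplx R) z 1 /\
  derive1 (f : cplx R -> cplx R) z = extremal_deriv z.
Proof.
exact: sums_to_derive extremal_coef_geometric Hf extremal_deriv_sums.
Qed.

(** On the negative radius [f'] equals [harnack_rate], so that [- f (- t)] and
    [growth] have the same derivative; [f] is real there because its
    coefficients are. *)
Lemma extremal_opp t : 0 <= t < 1 -> f (- t%:C) = (- growth alpha t)%:C.
Proof.
move=> /andP[t0 t1].
have nt x : 0 <= x -> normc (- x%:C : C) = x.
  by move=> x0; rewrite normcN normc_real ger0_norm.
have imf : complex.Im (f (- t%:C)) = 0.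
  have [|K [q [K0 q01 H]]] := Hf (rho := t); first by rewrite t0.
  apply/eqP; rewrite -normr_eq0 eq_le normr_ge0 andbT.
  apply: (@geometric_le0 _ K q) => // n.
  apply: le_trans (H (- t%:C) n _); last by rewrite nt.
  have -> : psum a n (- t%:C) = (\sum_(k < n) extremal_coef k * (- t) ^+ k)%:C.
    rewrite /psum rmorph_sum; apply: eq_bigr => k _.
    by rewrite rmorphM rmorphXn rmorphN.
  apply: le_trans (ler_Im_normc _).
  by case: (f _) => x y /=; rewrite oppr0 addr0.
have [t00|tn0] := eqVneq t 0.
  rewrite t00 oppr0 (sums_to_0 Hf) /growth addr0 ln1 !mulr0 subr0 mulr0 addr0.
  by rewrite oppr0.
have t01 : 0 < t < 1 by rewrite lt_neqAle eq_sym tn0 t0.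
have [M M0 HM] := sums_to_taylor extremal_coef_geometric Hf extremal_deriv_sums t01.
pose F x := - complex.Re (f (- x%:C)).
have F0 : F 0 = 0 by rewrite /F oppr0 (sums_to_0 Hf) oppr0.
have G0 : growth alpha 0 = 0.
  by rewrite /growth addr0 ln1 !mulr0 subr0 mulr0 addr0.
have FT x y : 0 <= x -> x <= y -> y <= t ->
    `|F y - F x - harnack_rate alpha x * (y - x)| <= M * (y - x) ^+ 2.
  move=> x0 xy yt; have y0 : 0 <= y by exact: le_trans xy.
  have xt : x <= t by exact: le_trans yt.
  have := HM (- x%:C) (- y%:C); rewrite !nt// => /(_ xt yt).
  rewrite extremal_deriv_opp ?x0 ?(le_lt_trans xt)//.
  have -> : - y%:C - - x%:C = (x - y)%:C :> C by rewrite rmorphB opprK addrC.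
  rewrite normc_real real_normK ?num_real// -rmorphM => h.
  have -> : (y - x) ^+ 2 = (x - y) ^+ 2 by rewrite -sqrrN opprB.
  apply: le_trans h; apply: le_trans (ler_Re_normc _).
  rewrite !ReB Re_real /F -normrN le_eqVlt; apply/orP; left; apply/eqP.
  by congr `|_|; ring.
have D1 := @subdivision_le R (fun x => growth alpha x - F x)
  (fun x => M * x - harnack_rate alpha x) 0 t t0.
have D2 := @subdivision_le R (fun x => F x - growth alpha x)
  (fun x => M * x) 0 t t0.
have {}D1 : growth alpha 0 - F 0 <= growth alpha t - F t.
  apply: D1 => x y x0 xy yt; have y0 : 0 <= y by exact: le_trans xy.
  have := FT x y x0 xy yt; rewrite ler_norml => /andP[_ h].
  by have := growth_tangent alpha01 y0 x0; lra.
have {}D2 : F 0 - growth alpha 0 <= F t - growth alpha t.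
  apply: D2 => x y x0 xy yt; have y0 : 0 <= y by exact: le_trans xy.
  have := FT x y x0 xy yt; rewrite ler_norml => /andP[h _].
  by have := growth_tangent alpha01 x0 y0; lra.
apply/eqP; rewrite eq_complex/= imf eqxx andbT; apply/eqP.
by move: D1 D2; rewrite F0 G0 /F; lra.
Qed.

Lemma growth_near1 x : 0 <= x <= 1 ->
  growth alpha 1 - x <= growth alpha (1 - x) <= growth alpha 1.
Proof.
move=> /andP[x0 x1]; have x10 : 0 <= 1 - x by rewrite subr_ge0.
apply/andP; split; last by apply: growth_homo => //; rewrite gerBl.
have [al0 al1] := andP alpha01.
have := growth_tangent alpha01 x10 (@ler01 R).
have : harnack_rate alpha (1 - x) <= 1.
  have := harnack_rate_decr alpha01 (lexx 0) x10.
  by rewrite {2}/harnack_rate addr0 subr0 divr1; lra.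
by move=> /(ler_wpM2r x0); rewrite mul1r opprB addrCA subrr addr0; lra.
Qed.

(** A preimage [z] would contradict strong monotonicity: [f (- t)] tends to
    [- growth 1], while half of the segment from [z] to [- t] stays in a fixed
    smaller disk, which keeps [f (- t)] away from [f z]. *)
Lemma extremal_value_missed z : normc z < 1 -> f z != (- growth alpha 1)%:C.
Proof.
move=> z1; apply/eqP => fz; set r := normc z in z1.
have r0 : 0 <= r by exact: normc_ge0.
pose rho := (1 + r) / 2.
have rho01 : 0 < rho < 1 by rewrite /rho; lra.
have [rho0 rho1] := andP rho01.
pose c := harnack_rate alpha rho.
have c0 : 0 < c by apply: harnack_rate_gt0 => //; exact: ltW.
have c1 : c <= 1.
  have [al0 al1] := andP alpha01.
  have := harnack_rate_decr alpha01 (lexx 0) (ltW rho0).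
  by rewrite -/c {1}/harnack_rate addr0 subr0 divr1; lra.
(* Small enough that [f (- t)], within [x] of [- growth 1], cannot be as far
   from [f z] as monotonicity demands. *)
pose x := c * (1 - r) / 4.
have r1' : 0 < 1 - r by rewrite subr_gt0.
have x0 : 0 < x by rewrite /x divr_gt0// mulr_gt0.
have x1 : x <= (1 - r) / 4.
  by rewrite /x ler_pdivrMr// divfK// ler_piMl// ltW.
pose t := 1 - x.
have t01 : 0 <= t < 1 by rewrite /t; lra.
have [t0 t1] := andP t01.
pose zt : C := - t%:C; pose m := (zt + z) / 2; pose u := (zt - z) / 2.
have nzt : normc zt = t by rewrite normcN normc_real ger0_norm.
have n2 (w : C) : normc (w / 2) = normc w / 2.
  by rewrite normcM normcV (normc_nat R 2).
have nm : normc m <= rho.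
  rewrite n2 /rho ler_pM2r ?invr_gt0//; apply: le_trans (le_normcD _ _) _.
  by rewrite nzt lerD2r ltW.
have e1 : zt - m = u by rewrite /m /u; field.
have e2 : m - z = u by rewrite /m /u; field.
have Hc w : normc w <= rho -> c <= complex.Re (extremal_deriv w) - normc (0 : C).
  move=> wr; rewrite normc0 subr0.
  apply: le_trans (extremal_deriv_rate _); last exact: le_lt_trans rho1.
  by apply: harnack_rate_decr => //; exact: normc_ge0.
have zr : normc z <= rho by rewrite -/r /rho; lra.
have m1 := strongly_monotone extremal_coef_geometric zc Hf extremal_deriv_sums
  zs zs1 rho01 Hc nm zr.
(* The outer half of the segment reaches the point [- t], where only
   monotonicity with constant 0 is used. *)
pose rho' := Num.max t rho.
have rho'01 : 0 < rho' < 1 by rewrite /rho' lt_max rho0 orbT/= gt_max t1.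
have H0 w : normc w <= rho' -> 0 <= complex.Re (extremal_deriv w) - normc (0 : C).
  move=> wr; have w1 : normc w < 1 by case/andP: rho'01 => _; exact: le_lt_trans.
  by have := Hpos w1; rewrite normc0; case/andP: alpha01; lra.
have ztr : normc zt <= rho' by rewrite nzt /rho' le_max lexx.
have mr : normc m <= rho' by rewrite /rho' le_max nm orbT.
have m2 := strongly_monotone extremal_coef_geometric zc Hf extremal_deriv_sums
  zs zs1 rho'01 H0 ztr mr.
rewrite e1 mul0r in m2; rewrite e2 in m1.
have conj0 : (0 : C)^* = 0 by rewrite /conjc/= oppr0.
rewrite conj0 !addr0 in m1 m2.
have : c * normc u ^+ 2 <= complex.Re ((f zt - f z) * u^*).
  have -> : (f zt - f z) * u^* = (f zt - f m) * u^* + (f m - f z) * u^* by ring.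
  by rewrite ReD; lra.
have nu : (t - r) / 2 <= normc u.
  by rewrite n2 ler_pM2r ?invr_gt0// -nzt le_normc_dist.
have u0 : 0 < normc u by apply: lt_le_trans nu; rewrite divr_gt0// subr_gt0 /t; lra.
have : complex.Re ((f zt - f z) * u^*) <= x * normc u.
  apply: le_trans (Re_le_normc _) _; rewrite normcM normcJ ler_wpM2r ?normc_ge0//.
  rewrite fz /zt extremal_opp// -rmorphB normc_real opprK addrC.
  have /andP[h1 h2] : growth alpha 1 - x <= growth alpha t <= growth alpha 1.
    by apply: growth_near1; lra.
  by rewrite ger0_norm ?subr_ge0//; lra.
move=> h1 h2; have := le_trans h2 h1.
rewrite expr2 mulrA ler_pM2r// => h3.
have := ler_wpM2l (ltW c0) nu; rewrite /t => h4.
have h5 : c * ((1 - r) / 4) = x by rewrite /x mulrA.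
have h6 : c * x <= x by rewrite ler_piMl// ltW.
have : c * ((1 - x - r) / 2) = 2 * x - c * x / 2 by rewrite -h5; field.
by lra.
Qed.

Lemma extremal_boundary :
  boundary ((fun z : cplx R => f z : cplx R) @` disk 1) (- growth alpha 1)%:C.
Proof.
split; last first.
  move=> /nbhs_singleton[z z1 /eqP fz].
  by move: fz; rewrite (negbTE (extremal_value_missed z1)).
move=> A /nbhs_normcP[e e0 HA].
pose x := Num.min (e / 2) (1 / 2).
have x0 : 0 < x by rewrite /x lt_min !divr_gt0.
have [xe x2] : x <= e / 2 /\ x <= 1 / 2 by rewrite /x !ge_min !lexx orbT.
have t01 : 0 <= 1 - x < 1 by lra.
exists (f (- (1 - x)%:C)); split.
  have d : normc (- (1 - x)%:C : C) < 1.
    by rewrite normcN normc_real ger0_norm; case/andP: t01.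
  by exists (- (1 - x)%:C).
apply: HA; rewrite extremal_opp// -rmorphB normc_real opprK addrC.
have x01 : 0 <= x <= 1 by lra.
have /andP[h1 h2] := growth_near1 x01.
by rewrite ger0_norm ?subr_ge0//; lra.
Qed.

Section Sharpness.
Variables (p : R) (mu lambda : R -> R).
Hypotheses (Hmu : nonneg_increasing mu) (Hlambda : nonneg_increasing lambda).

Lemma extremal_classP0 : classP0 alpha (f : cplx R -> cplx R) (fun=> 0).
Proof.
have dz z : derive1 ((fun=> 0) : cplx R -> cplx R) z = 0 by exact: derive1_cst.
have [al0 al1] := andP alpha01.
have pos z : normc z < 1 -> 0 < complex.Re (extremal_deriv z) - alpha.
  move=> z1; rewrite subr_gt0; apply: lt_le_trans (extremal_deriv_rate z1).
  have nz := normc_ge0 z.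
  by rewrite /harnack_rate ltrDl mulr_gt0 ?divr_gt0//; lra.
split; last exact: dz.
- split.
  + by move=> z z1; have [] := extremal_derive z1.
  + by move=> z z1; exact: derivable_cst.
  + split; first by rewrite (sums_to_0 Hf).
      have [|_ ->] := @extremal_derive 0; first by rewrite normc0 ltr01.
      by rewrite /extremal_deriv mul0r mulr0 addr0.
    by [].
  + move=> z z1; rewrite /Defs.jacobian dz normc0 expr0n/= subr0.
    have [_ ->] := extremal_derive z1; rewrite exprn_gt0//.
    by have := pos z z1; have := Re_le_normc (extremal_deriv z); lra.
move=> z z1; rewrite dz normc0; have [_ ->] := extremal_derive z1.
by rewrite ReB Re_real pos.
Qed.

Lemma extremal_expansions :
  h_expansion (f : cplx R -> cplx R) a /\
  g_expansion ((fun=> 0) : cplx R -> cplx R) (fun=> 0).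
Proof.
split=> z z1; apply: cplx_normc_cvg.
  have [|K [q [K0 q01 H]]] := Hf (rho := normc z); first by rewrite normc_ge0.
  apply/cvgr0Pnorm_le => e e0; have [n0 Hn0] := geometric_small K q01 e0.
  exists (n0 + 2)%N => // -[|[|n]] n0n; [by rewrite /= addn2 in n0n..|].
  rewrite /= addn2 in n0n; rewrite ger0_norm ?normc_ge0//.
  have -> : z + \sum_(2 <= k < n.+2) a k * z ^+ k = psum a n.+2 z.
    rewrite /psum (sum_ordS _ (fun k => a k * z ^+ k)).
    rewrite (sum_ordS _ (fun k => a k.+1 * z ^+ k.+1)).
    rewrite a0 mul0r add0r a1 mul1r expr1; congr (_ + _).
    rewrite -{1}[2%N]/(0 + 2)%N big_addn big_mkord subn2/=.
    by apply: eq_bigr => k _; rewrite addn2.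
  apply: le_trans (H z n.+2 (lexx _)) (Hn0 _ _); lia.
apply: cvg_near_cst; apply: nearW => n.
by rewrite big1 ?subr0 ?normc0// => k _; rewrite mul0r.
Qed.

(** The circular means of the Jacobian converge to [area_density]. *)
Lemma extremal_area r : 0 <= r < 1 ->
  pi * M_ alpha r <= area (f : cplx R -> cplx R) (fun=> 0) r.
Proof.
move=> r01; have [r0 r1] := andP r01.
have dz z : derive1 ((fun=> 0) : cplx R -> cplx R) z = 0 by exact: derive1_cst.
rewrite (@area_disc_area _ _ _ extremal_deriv (fun=> 0))//; last 1 first.
  by move=> z z1; have [] := extremal_derive z1.
have r201 : 0 <= r ^+ 2 < 1 by rewrite sqr_ge0 expr_lt1.
have [r20 r21] := andP r201.
rewrite M_E//; set T := r ^+ 2 in r201 r20 r21 *.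
have B40 : 0 <= 4 * (1 - alpha) ^+ 2 by rewrite mulr_ge0 ?sqr_ge0.
have T1 : 0 < 1 - T by rewrite subr_gt0.
have gh z : normc z < 1 -> normc (0 : C) <= normc (extremal_deriv z).
  by rewrite normc0 normc_ge0.
have dens x y : 0 <= x -> x <= y -> y < 1 -> area_density alpha x <= area_density alpha y.
  move=> x0 xy y1; rewrite /area_density lerD2l ler_wpM2l// lerD2r.
  by rewrite lef_pV2 ?posrE ?subr_gt0 ?(le_lt_trans xy)// lerD2l lerN2.
apply: (@disc_area_ge _ _ _ _ _ extremal_deriv_sums zs1 gh T (area_bound alpha)
  (area_density alpha) (area_density alpha T + 4 * (1 - alpha) ^+ 2 / (1 - T)) T) => //.
- exact: area_bound0.
- move=> x y x0 xy yT; have y1 : y < 1 by exact: le_lt_trans r21.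
  by have /andP[] := area_bound_increment alpha x0 xy y1.
move=> x y n u x0 xy yT /andP[xu uy].
have u0 : 0 <= norm2 u by exact: le_trans xu.
have uT : norm2 u < T by exact: lt_le_trans yT.
have u1 : norm2 u < 1 by exact: lt_trans r21.
have dT := area_density_gt0 alpha r201.
have q0 : 0 <= 4 * (1 - alpha) ^+ 2 / (1 - T) by rewrite divr_ge0// ltW.
case: n => [|n].
  rewrite /radial_mean big_ord0 expr0 mulr1.
  by have := dens x T x0 (le_trans xy yT) r21; lra.
rewrite extremal_radial_mean ?u0//.
have h1 := dens x (norm2 u) x0 xu u1.
have h2 : 4 * (1 - alpha) ^+ 2 / (1 - norm2 u) * norm2 u ^+ n.+1 <=
    4 * (1 - alpha) ^+ 2 / (1 - T) * T ^+ n.+1.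
  apply: ler_pM; rewrite ?exprn_ge0// ?divr_ge0// ?subr_ge0 ?(ltW u1)//.
    by rewrite ler_wpM2l// lef_pV2 ?posrE ?subr_gt0// lerD2l lerN2 ltW.
  by rewrite lerXn2r ?nnegrE// ltW.
have h3 : 0 <= area_density alpha T * T ^+ n.+1.
  by rewrite mulr_ge0 ?exprn_ge0// ltW.
by rewrite mulrDl; lra.
Qed.

(** The coefficient sum is exact, the area is at least its bound, and the distance
    is at most [growth 1]; hence the left side exceeds the right one by at least [J1 r]. *)
Lemma extremal_violates r : 0 <= r < 1 -> 0 < J1 alpha p mu lambda r ->
  ~ bohr_inequality p mu lambda (f : cplx R -> cplx R) (fun=> 0) a (fun=> 0) r%:C.
Proof.
move=> r01 J0; have [r0 r1] := andP r01; have [B0 B2] := andP B02.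
rewrite /bohr_inequality; have -> : normc r%:C = r by rewrite normc_real ger0_norm.
have f0 : harmonic_map (f : cplx R -> cplx R) (fun=> 0) 0 = 0.
  by rewrite harmonic_mapE (sums_to_0 Hf) /conjc/= oppr0 addr0.
have fE : harmonic_map (f : cplx R -> cplx R) (fun=> 0) = (fun z : cplx R => f z).
  by apply/funext => z; rewrite harmonic_mapE /conjc/= oppr0 addr0.
have G1 : 0 <= growth alpha 1.
  have := growth_homo alpha01 (lexx 0) ler01 (lexx 1).
  by rewrite {1}/growth addr0 ln1 !mulr0 subr0 mulr0 addr0.
rewrite f0 fE => H.
have dist_le : (dist_to (0%R : cplx R) (boundary ((fun z : cplx R => f z : cplx R) @` disk 1))
    <= (growth alpha 1)%:E)%E.
  apply: ge_ereal_inf; exists (normc ((- growth alpha 1)%:C - 0 : C))%:E.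
    by exists (- growth alpha 1)%:C => //; exact: extremal_boundary.
  by rewrite subr0 normc_real normrN ger0_norm.
have := le_trans H dist_le.
have -> : (\sum_(2 <= n <oo) ((normc (a n) + normc (0 : C)) * r ^+ n)%:E =
    (B * (- ln (1 - r) - r))%:E)%E.
  rewrite -nneseries_log ?(ltW B0)//; congr (limn _); apply/funext => N.
  apply: eq_big_nat => -[|[|n]]// _; congr (_ * _)%:E.
  rewrite normc0 addr0 normc_real; apply: ger0_norm.
  by apply: divr_ge0; [exact: ltW|exact: ler0n].
rewrite -!EFinD lee_fin growth1.
have [M0 _] := M_homo alpha r0 (lexx r) r1.
have hM : M_ alpha r <= area (f : cplx R -> cplx R) (fun=> 0) r / pi.
  by rewrite ler_pdivlMr ?pi_gt0// mulrC extremal_area.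
have m1 := Hmu.2 _ _ M0 hM.
have m2 : lambda (M_ alpha r ^+ 2) <=
    lambda ((area (f : cplx R -> cplx R) (fun=> 0) r / pi) ^+ 2).
  apply: Hlambda.2; first exact: sqr_ge0.
  by rewrite lerXn2r ?nnegrE// (le_trans M0).
by move: J0; rewrite /J1 /B; lra.
Qed.

End Sharpness.
End Extremal.

Theorem theorem2p1 (R : realType) (alpha p : R) (mu lambda : R -> R)
    (halpha : 0 <= alpha < 1) (hp : 1 <= p)
    (hmu : nonneg_increasing mu) (hlambda : nonneg_increasing lambda) :
  (* existence of the root *)
  ({within `[0, +oo[, continuous mu} ->
   {within `[0, +oo[, continuous lambda} ->
   J1 alpha p mu lambda 0 < 0 ->
   exists2 Rf : R, 0 < Rf < 1 & J1 alpha p mu lambda Rf = 0) /\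
  (* uniqueness, the inequality, and sharpness *)
  (forall Rf : R, 0 < Rf < 1 -> J1 alpha p mu lambda Rf = 0 ->
   [/\ forall s : R, 0 < s < 1 -> J1 alpha p mu lambda s = 0 -> s = Rf,
       bohr_holds_upto alpha p mu lambda Rf &
       forall rho : R, Rf < rho < 1 ->
         ~ bohr_holds_upto alpha p mu lambda rho]).
Proof.
split; first exact: J1_root_exists.
move=> Rf /andP[Rf0 Rf1] JRf; split.
- move=> s /andP[s0 s1] Js; apply/eqP; rewrite eq_le !leNgt.
  apply/andP; split; apply/negP => lt.
    by have := J1_lt halpha hp hmu hlambda Rf0 lt s1; rewrite JRf Js ltxx.
  by have := J1_lt halpha hp hmu hlambda s0 lt Rf1; rewrite JRf Js ltxx.
- move=> h g a b Hf Hh Hg z zR.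
  have z1 : normc z < 1 by exact: le_lt_trans Rf1.
  apply: (@bohr_inequality_le _ alpha) => //.
  by rewrite -JRf; apply: J1_le => //; exact: normc_ge0.
- move=> rho /andP[Rrho rho1] H.
  have [f Hf] := exists_sums_to (extremal_coef_geometric halpha).
  have rho0 : 0 < rho by exact: lt_trans Rrho.
  have [Eh Eg] := extremal_expansions halpha Hf.
  apply: (extremal_violates halpha Hf hmu hlambda (p := p) (r := rho)).
  + by rewrite (ltW rho0).
  + by rewrite -JRf; exact: J1_lt.
  have nrho : normc rho%:C <= rho by rewrite normc_real gtr0_norm.
  exact: (H _ _ _ _ (extremal_classP0 halpha Hf) Eh Eg _ nrho).
Qed.
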